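(* Let $A=(a_1\ \cdots\ a_n)\in\mathbb{Z}^{d\times n}$ have rank $d$, let $\beta\in\mathbb{C}^d$, and let $\sigma\subseteq\{1,\dots,n\}$ have cardinality $d$ with $\det(A_\sigma)\neq 0$. Put $s_i=|A_\sigma^{-1}a_i|$ for $i\notin\sigma$, $s=\max\{s_i : i\notin\sigma\}$ and $\tau=\{i : a_i\notin H_\sigma^+\}$. Let $\mathbf{k}\in\mathbb{N}^{n-d}$ be such that $v^{\mathbf{k}}$ has minimal negative support. Then for any set $\varsigma$ with $\sigma\subseteq\varsigma\subseteq\tau$, the series $$\phi_\sigma^{\mathbf{k}}=\sum_{\mathbf{k}+\mathbf{m}\in S_{\mathbf{k}}}\frac{[v^{\mathbf{k}}]_{u(\mathbf{m})_-}}{[v^{\mathbf{k}}+u(\mathbf{m})]_{u(\mathbf{m})_+}}\,x^{v^{\mathbf{k}}+u(\mathbf{m})}$$ is a Gevrey series solution of $\mathcal{M}_A(\beta)$ of order $s$ along $Y_\varsigma$ at any point of $Y_\varsigma\cap U_\sigma$. If $\beta$ is very generic then $s$ is its Gevrey index.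
   Context: Hypergeometric modules: $X=\mathbb{C}^n$, $\mathcal{D}$ is the sheaf of linear differential operators with holomorphic coefficients on $X$, $\partial_i=\partial/\partial x_i$. $H_A(\beta)$ is the left ideal generated by $\Box_u=\partial^{u_+}-\partial^{u_-}$ for $u\in L_A:=\ker(A)\cap\mathbb{Z}^n$ ($u=u_+-u_-$, $u_\pm\in\mathbb{N}^n$ with disjoint supports) and $E_i-\beta_i=\sum_j a_{ij}x_j\partial_j-\beta_i$, $i=1,\dots,d$; $\mathcal{M}_A(\beta)=\mathcal{D}/\mathcal{D}H_A(\beta)$. A solution in a sheaf of $\mathcal{D}$-modules is a section annihilated by $H_A(\beta)$. Gevrey series: for $\varsigma\subseteq\{1,\dots,n\}$ put $\overline\varsigma=\{1,\dots,n\}\setminus\varsigma$, $Y_\varsigma=\{x_i=0: i\notin\varsigma\}$. $\mathcal{O}_{\widehat{X|Y_\varsigma}}$ is the formal completion of $\mathcal{O}_X$ along $Y_\varsigma$; its germs at $p\in Y_\varsigma$ are series $f=\sum_\alpha f_\alpha(x_\varsigma)x_{\overline\varsigma}^\alpha$ with all $f_\alpha$ holomorphic in a common neighbourhood of $p$ in $Y_\varsigma$. Such $f$ is Gevrey of order $s\in\mathbb{R}$ along $Y_\varsigma$ at $p$ if $\sum_\alpha f_\alpha(x_\varsigma)(\alpha!)^{1-s}x_{\overline\varsigma}^\alpha$ converges at $p$ (i.e. in a neighbourhood of $p$), and has Gevrey index $s$ if in addition this fails with $s$ replaced by any $s'<s$. Simplex notation: $A_\tau$ is the submatrix of columns indexed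 by $\tau$; $|w|$ is the sum of the coordinates of a vector $w$ in $\mathbb{R}^d$; $H_\sigma=\{y\in\mathbb{R}^d: |A_\sigma^{-1}y|=1\}$, $H_\sigma^+=\{y\in\mathbb{R}^d: |A_\sigma^{-1}y|>1\}$. For $\mathbf{k}\in\mathbb{N}^{n-d}$ (indexed by $\overline\sigma$), $v^{\mathbf{k}}\in\mathbb{C}^n$ has $\sigma$-coordinates $A_\sigma^{-1}(\beta-A_{\overline\sigma}\mathbf{k})$ and $\overline\sigma$-coordinates $\mathbf{k}$; for $\mathbf{m}\in\mathbb{Z}^{n-d}$, $u(\mathbf{m})$ has $\sigma$-coordinates $-A_\sigma^{-1}A_{\overline\sigma}\mathbf{m}$ and $\overline\sigma$-coordinates $\mathbf{m}$. For $w\in\mathbb{C}^n$, $\operatorname{nsupp}(w)=\{i: w_i\in\mathbb{Z}_{<0}\}$. $v^{\mathbf{k}}$ has minimal negative support if there is no $u\in L_A$ with $\operatorname{nsupp}(v^{\mathbf{k}}+u)\subsetneq\operatorname{nsupp}(v^{\mathbf{k}})$. $\Lambda_{\mathbf{k}}=\{\mathbf{k}+\mathbf{m}\in\mathbb{N}^{n-d}: A_{\overline\sigma}\mathbf{m}\in\mathbb{Z}A_\sigma\}$, $S_{\mathbf{k}}=\{\mathbf{k}+\mathbf{m}\in\Lambda_{\mathbf{k}}: \operatorname{nsupp}(v^{\mathbf{k}+\mathbf{m}})=\operatorname{nsupp}(v^{\mathbf{k}})\}$. $[v]_u=\prod_i[v_i]_{u_i}$ with $[v_i]_{u_i}=\prod_{j=1}^{u_i}(v_i-j+1)$.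 Powers of $x_i$, $i\in\sigma$, are taken with a local branch where $x_i\neq0$. The open set $U_\sigma$: fix $R>0$, depending only on $A,\sigma$, such that for all $\beta,\mathbf{k}$ the series $\sum_{\mathbf{k}+\mathbf{m}\in S_{\mathbf{k}}}\frac{[v^{\mathbf{k}}]_{u(\mathbf{m})_-}}{[v^{\mathbf{k}}+u(\mathbf{m})]_{u(\mathbf{m})_+}}\prod_{i\notin\sigma}((k_i+m_i)!)^{1-s_i}\,y^{\mathbf{k}+\mathbf{m}}$ converges on $\{y\in\mathbb{C}^{n-d}: |y_j|<R\ \forall j\}$ (such $R$ exists). Then $U_\sigma=\{x\in\mathbb{C}^n: \prod_{i\in\sigma}x_i\neq0,\ |x_j|<R\,|x_\sigma^{A_\sigma^{-1}a_j}|\ \text{for all } j\notin\sigma \text{ with } a_j\in H_\sigma\}$. Very generic: ''$\beta$ very generic'' means that $\beta$ lies in a suitable countable intersection of nonempty Zariski open subsets of $\mathbb{C}^d$ (depending on $A$).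
   Formalization: The Gevrey index claim is stated under the added condition that s = s_i for some i not in ς; without it φ has order smaller than s along Y_ς (e.g. A=(1 1), σ={1}, ς={1,2}), so s is not the index. *)

(* Defs.v *)
From HB Require Import structures.
From mathcomp Require Import all_boot all_order all_algebra.
From mathcomp Require Import all_classical all_reals all_analysis.
From mathcomp Require Import complex.
From mathcomp Require mpoly.
From mathcomp.analysis.showcase Require summability.

Set Implicit Arguments.
Unset Strict Implicit.
Unset Printing Implicit Defensive.

Import Order.TTheory GRing.Theory Num.Theory.
Import numFieldNormedType.Exports.

Local Open Scope classical_set_scope.
Local Open Scope ring_scope.

(* The field R[i], typed as a numClosedFieldType so that the generic topology
   of numeric fields (and of matrices over them) applies to it.  As a
   consequence [differentiable] and ['D_v] below are complex notions. *)
Definition Cx (R : realType) : numClosedFieldType := R[i]%C.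

Section Complex.
Variable R : realType.
Local Notation C := (Cx R).

Definition cmod (z : C) : R := ComplexField.Normc.normc z.

Definition toC (r : R) : C := real_complex R r.

Definition cexp (z : C) : C :=
  let: (a +i* b)%C := (z : R[i]%C) in
  (expR a * cos b +i* (expR a * sin b))%C.

Definition log_branch (z0 : C) (l : C -> C) : Prop :=
  \forall z \near z0, cexp (l z) = z /\ {for z, continuous l}.

(* Unconditional sum over S; a junk value if the family is not summable. *)
Definition csum (I : choiceType) (S : set I) (F : I -> C) : C :=
  summability.sum (patch (fun=> 0) S F).

Definition abs_summable (I : choiceType) (S : set I) (F : I -> C) : Prop :=
  summable S (fun i => (cmod (F i))%:E).

End Complex.

(* Multi-indices in N^I, for I the complement of sg in {1..n}, are encoded as
   vectors of N^n that vanish on sg. *)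
Definition Nbar n (sg : {set 'I_n}) : set 'cV[nat]_n :=
  [set k | forall i, i \in sg -> k i 0 = 0%N].

Definition pospart (F : archiNumDomainType) n (u : 'cV[F]_n) : 'cV[nat]_n :=
  map_mx (@Num.truncn F) u.

Definition negpart (F : archiNumDomainType) n (u : 'cV[F]_n) : 'cV[nat]_n :=
  pospart (- u).

Definition toZ n (k : 'cV[nat]_n) : 'cV[int]_n := map_mx Posz k.

Definition mfact n (a : 'cV[nat]_n) : nat := (\prod_i (a i 0%R)`!)%N.

Definition monomial (F : comNzRingType) n (x : 'cV[F]_n) (a : 'cV[nat]_n) : F :=
  \prod_i x i 0 ^+ a i 0.

Section GevreySeries.
Variables (R : realType) (n : nat).
Local Notation C := (Cx R).

(* A formal series sum_a f_a(x_vs) x_vsbar^a along Y_vs.  Only the indices a in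
   Nbar vs are meaningful.  A function on Y_vs is encoded as a function on C^n
   which depends only on the coordinates in vs. *)
Definition fseries := 'cV[nat]_n -> 'cV[C]_n -> C.

Definition Yplane (vs : {set 'I_n}) : set 'cV[C]_n :=
  [set x | forall i, i \notin vs -> x i 0 = 0].

(* f is a germ at p of the formal completion of O_X along Y_vs. *)
Definition formal_germ (vs : {set 'I_n}) (p : 'cV[C]_n) (f : fseries) : Prop :=
  (forall a (x y : 'cV[C]_n), Nbar vs a ->
     (forall i, i \in vs -> x i 0 = y i 0) -> f a x = f a y) /\
  (\forall x \near p, forall a, Nbar vs a -> differentiable (f a) x).

Definition zero_germ (vs : {set 'I_n}) (p : 'cV[C]_n) (f : fseries) : Prop :=
  \forall x \near p, forall a, Nbar vs a -> f a x = 0.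

(* Normal convergence in a neighbourhood of p in X, i.e. the series belongs to
   the ring O_{X,p} of germs of holomorphic functions. *)
Definition converges_at (vs : {set 'I_n}) (p : 'cV[C]_n) (f : fseries) : Prop :=
  exists2 M : 'cV[nat]_n -> R, summable (Nbar vs) (fun a => (M a)%:E) &
    \forall x \near p, forall a, Nbar vs a ->
      cmod (f a x * monomial x a) <= M a.

Definition gevrey_order (vs : {set 'I_n}) (p : 'cV[C]_n) (s : R)
    (f : fseries) : Prop :=
  formal_germ vs p f /\
  converges_at vs p (fun a x => f a x * toC ((mfact a)%:R `^ (1 - s))).

Definition gevrey_index (vs : {set 'I_n}) (p : 'cV[C]_n) (s : R)
    (f : fseries) : Prop :=
  gevrey_order vs p s f /\ forall s', s' < s -> ~ gevrey_order vs p s' f.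

(* Expressions for the elements of the Weyl algebra; an expression is only ever
   used through its action [act] on formal series. *)
Inductive diffop : Type :=
| OCst of C
| OX of 'I_n
| OD of 'I_n
| OAdd of diffop & diffop
| OMul of diffop & diffop.

Fixpoint act (vs : {set 'I_n}) (P : diffop) (f : fseries) : fseries :=
  match P with
  | OCst c => fun a x => c * f a x
  | OX i =>
      if i \in vs then fun a (x : 'cV[C]_n) => x i 0 * f a x
      else fun a x => if a i 0 == 0%N then 0
                      else f (\col_j (a j 0%R - (j == i))%N) x
  | OD i =>
      if i \in vs then fun a x => 'D_(delta_mx i 0) (f a) x
      else fun a x => (a i 0).+1%:R * f (\col_j (a j 0%R + (j == i))%N) x
  | OAdd P Q => fun a x => act vs P f a x + act vs Q f a x
  | OMul P Q => act vs P (act vs Q f)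
  end.

Definition osub (P Q : diffop) : diffop := OAdd P (OMul (OCst (-1)) Q).

Definition dpow (a : 'cV[nat]_n) : diffop :=
  \big[OMul/OCst 1]_(i < n) iter (a i 0) (OMul (OD i)) (OCst 1).

End GevreySeries.

Arguments OCst {R n} _.
Arguments OX {R n} _.
Arguments OD {R n} _.
Arguments fseries : clear implicits.
Arguments diffop : clear implicits.

Section Hypergeometric.
Variables (R : realType) (d n : nat) (A : 'M[int]_(d, n)).
Local Notation C := (Cx R).

Definition box (u : 'cV[int]_n) : diffop R n :=
  osub (dpow R (pospart u)) (dpow R (negpart u)).

Definition euler (b : 'cV[C]_d) (i : 'I_d) : diffop R n :=
  osub (\big[@OAdd R n/OCst 0]_(j < n)
          OMul (OCst (A i j)%:~R) (OMul (OX j) (OD j)))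
       (OCst (b i 0)).

(* The left ideal H_A(b). *)
Inductive HA (b : 'cV[C]_d) : diffop R n -> Prop :=
| HA_box u : A *m u = 0 -> HA b (box u)
| HA_euler i : HA b (euler b i)
| HA_add P Q : HA b P -> HA b Q -> HA b (OAdd P Q)
| HA_mul P Q : HA b Q -> HA b (OMul P Q).

Definition hyp_solution (b : 'cV[C]_d) (vs : {set 'I_n}) (p : 'cV[C]_n)
    (f : fseries R n) : Prop :=
  formal_germ vs p f /\ forall P, HA b P -> zero_germ vs p (act vs P f).

Definition nsupp (w : 'cV[C]_n) : set 'I_n :=
  [set i | exists2 z : int, z < 0 & w i 0 = z%:~R].

Definition min_neg_support (w : 'cV[C]_n) : Prop :=
  ~ exists2 u : 'cV[int]_n, A *m u = 0 &
      nsupp (w + map_mx intr u) `<` nsupp w.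

Definition bracket (v : 'cV[C]_n) (a : 'cV[nat]_n) : C :=
  \prod_i \prod_(1 <= j < (a i 0).+1) (v i 0 - j%:R + 1).

Section Simplex.
Variables (sg : {set 'I_n}) (hsg : #|sg| = d).

Definition sg_index (j : 'I_d) : 'I_n := enum_val (cast_ord (esym hsg) j).

Definition Asub : 'M[int]_d := \matrix_(i, j) A i (sg_index j).

Definition Ainv (F : fieldType) : 'M[F]_d := invmx (map_mx intr Asub).

(* The vector of F^n with sg-coordinates w and all other coordinates zero. *)
Definition emb (F : fieldType) (w : 'cV[F]_d) : 'cV[F]_n :=
  \col_i \sum_(j | sg_index j == i) w j 0.

Definition vsum (w : 'cV[R]_d) : R := \sum_i w i 0.

Definition acol (j : 'I_n) : 'cV[R]_d := map_mx intr (col j A).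

Definition Hsg : set 'cV[R]_d := [set y | vsum (Ainv R *m y) = 1].

Definition Hsg_plus : set 'cV[R]_d := [set y | 1 < vsum (Ainv R *m y)].

Definition slope (i : 'I_n) : R := vsum (Ainv R *m acol i).

Definition tau : set 'I_n := [set i | ~ Hsg_plus (acol i)].

(* v^k, for k in Nbar sg *)
Definition vk (b : 'cV[C]_d) (k : 'cV[nat]_n) : 'cV[C]_n :=
  map_mx intr (toZ k)
  + emb (Ainv C *m (b - map_mx intr (A *m toZ k))).

(* u(m), for m in Z^n vanishing on sg; it is used both over F = R, to extract
   u(m)_+ and u(m)_-, and over F = C. *)
Definition um (F : fieldType) (m : 'cV[int]_n) : 'cV[F]_n :=
  map_mx intr m - emb (Ainv F *m map_mx intr (A *m m)).

Definition Lambda (k : 'cV[nat]_n) : set 'cV[nat]_n :=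
  [set l | Nbar sg l /\
     exists z : 'cV[int]_d, A *m (toZ l - toZ k) = Asub *m z].

Definition Sk (b : 'cV[C]_d) (k : 'cV[nat]_n) : set 'cV[nat]_n :=
  [set l | Lambda k l /\ nsupp (vk b l) = nsupp (vk b k)].

(* The coefficient of phi at the index l = k + m. *)
Definition coef (b : 'cV[C]_d) (k l : 'cV[nat]_n) : C :=
  let m := toZ l - toZ k in
  bracket (vk b k) (negpart (um R m))
  / bracket (vk b k + um C m) (pospart (um R m)).

(* "r depends only on A and sg, and for all b, k the series converges for
   |y_j| < r"; y ranges over C^n, only its coordinates outside sg matter. *)
Definition convergence_bound (r : R) : Prop :=
  0 < r /\
  forall (b : 'cV[C]_d) (k : 'cV[nat]_n), Nbar sg k ->
  forall y : 'cV[C]_n, (forall j, j \notin sg -> cmod (y j 0) < r) ->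
    abs_summable (Sk b k) (fun l =>
      coef b k l
      * toC (\prod_(i | i \notin sg) ((l i 0)`!)%:R `^ (1 - slope i))
      * \prod_(i | i \notin sg) y i 0 ^+ l i 0).

(* |x_sg^(A_sg^-1 a_j)| is a product of real powers of the |x_i|, whatever the
   branch. *)
Definition Usg (r : R) : set 'cV[C]_n :=
  [set x | (forall i, i \in sg -> x i 0 != 0) /\
     forall j, j \notin sg -> Hsg (acol j) ->
       cmod (x j 0) <
       r * \prod_(i in sg) cmod (x i 0) `^ (emb (Ainv R *m acol j) i 0)].

(* The terms of phi as an element of the completion along Y_vs: the factor
   x_vsbar^(l_vsbar) of the monomial x^(v^k+u(m)) is left out; outside sg, the
   exponent v^k+u(m) is l.  lg i is a branch of the logarithm near p_i. *)
Definition phi_term (vs : {set 'I_n}) (lg : 'I_n -> C -> C) (b : 'cV[C]_d)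
    (k l : 'cV[nat]_n) (x : 'cV[C]_n) : C :=
  coef b k l
  * \prod_(i in sg) cexp ((vk b k + um C (toZ l - toZ k)) i 0 * lg i (x i 0))
  * \prod_(i in vs :\: sg) x i 0 ^+ l i 0.

Definition phi_index (vs : {set 'I_n}) (b : 'cV[C]_d) (k a : 'cV[nat]_n) :
    set 'cV[nat]_n :=
  [set l | Sk b k l /\ forall i, i \notin vs -> l i 0 = a i 0].

Definition phi (vs : {set 'I_n}) (lg : 'I_n -> C -> C) (b : 'cV[C]_d)
    (k : 'cV[nat]_n) : fseries R n :=
  fun a x => csum (phi_index vs b k a) (fun l => phi_term vs lg b k l x).

(* All the sums that define the coefficients of phi converge near p. *)
Definition phi_defined (vs : {set 'I_n}) (lg : 'I_n -> C -> C) (b : 'cV[C]_d)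
    (k : 'cV[nat]_n) (p : 'cV[C]_n) : Prop :=
  \forall x \near p, forall a, Nbar vs a ->
    abs_summable (phi_index vs b k a) (fun l => phi_term vs lg b k l x).

End Simplex.
End Hypergeometric.

Definition is_max (R : realType) (E : set R) (s : R) : Prop :=
  E s /\ ubound E s.

Definition zariski_open (F : fieldType) (d : nat) (U : set 'cV[F]_d) : Prop :=
  exists I : set (mpoly.mpoly d F),
    U = [set b | exists2 g, I g & mpoly.meval (fun i => b i 0) g != 0].

(* Main.v *)
Require Import Defs.
From HB Require Import structures.
From mathcomp Require Import all_boot all_order all_algebra.
From mathcomp Require Import all_classical all_reals all_analysis.
From mathcomp Require Import complex finmap cyclic separable cyclotomic.
From mathcomp Require Import ring lra zify.
From mathcomp Require mpoly.
From mathcomp.analysis.showcase Require summability.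

Set Implicit Arguments.
Unset Strict Implicit.
Unset Printing Implicit Defensive.

Import Order.TTheory GRing.Theory Num.Theory.
Import numFieldNormedType.Exports.

Local Open Scope classical_set_scope.
Local Open Scope ring_scope.

(* The series phi is a sum of terms c(l) x^(v(l)), where the sg-part of the
   exponent v(l) is affine in l.  On every slice (l prescribed outside vs) it
   converges normally near p, and differentiating term by term turns each d_i
   into an operation on the pair (coefficients, exponents).  The box operators
   then amount to an identity between products of falling factorials, in which
   the terms that leave S_k vanish by minimality of the negative support; the
   Euler operators amount to A v(l) = b.

   Gevrey order s: on the torus the substitution y_j = x_j x_sg^(-A_sg^-1 a_j)
   turns the terms into those of the majorant that defines the convergence
   bound, and the slopes of the indices outside vs are at most s.

   Index: for very generic b no v(l) has an integer coordinate in sg, so S_k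
   contains a ray l_N = k + N M e_i with slope(i) = s, along which |c(l_N)| is at
   least D^N N^(N M (s-1)).  If phi had order s' < s, its slice through l_N would
   be at most D^N N^(N M (s'-1)) on a small polydisc around p.  A slice is a
   power series in the x_j, j in vs \ sg, and c(l_N) is one of its Taylor
   coefficients at 0, whereas p may lie away from 0: the bound is propagated by a
   two constants theorem, which loses only a fixed power th of the gain
   N^(-N M (s-s')). *)

(** * The complex modulus and exponential *)

(** The branches are only assumed continuous and the exponents v(l) are unbounded, so termwise
    differentiation rests on first order expansions whose quadratic error is uniform in l. For z^w
    this costs a factor exp(eta |w|); as w is affine in l, the cost is geometric in l and is
    absorbed by a polyradius still below the radii of convergence. Derivatives leave the
    hypergeometric family; hence series with arbitrary coefficients, subject to summability at all
    smaller polyradii, a condition that survives multiplication by l_j. For the index, order s'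
    bounds a slice near p only, while order s bounds it, with growth N^(N M (s-1)), on a polydisc in
    the variables of vs \ sg that is centred at 0 and contains p. The coordinates of l_N in vs do
    not move along the ray, so the same Taylor coefficient is estimated in every slice, with th and
    the constants free of N. Slices are truncated to polynomials, so that a polynomial form of
    Cauchy's estimate is enough. The lower bound would then give N^(N M th (s-s')) <= K D^N for all
    N. *)

Arguments cmod : simpl never.
Arguments toC : simpl never.
Arguments cexp : simpl never.

Section ComplexModulus.
Variable R : realType.
Local Notation C := (Cx R).
Implicit Types (u z : C) (a b : R).

Lemma toC_inj : injective (@toC R).
Proof. by move=> a b [] . Qed.

Lemma le_toC a b : (toC a <= toC b) = (a <= b).
Proof. exact: lecR. Qed.

Lemma lt_toC a b : (toC a < toC b) = (a < b).
Proof. exact: ltcR. Qed.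

Lemma normE z : `|z| = toC (cmod z).
Proof. by []. Qed.

Lemma toCD a b : toC (a + b) = toC a + toC b. Proof. exact: rmorphD. Qed.
Lemma toCB a b : toC (a - b) = toC a - toC b. Proof. exact: rmorphB. Qed.
Lemma toCM a b : toC (a * b) = toC a * toC b. Proof. exact: rmorphM. Qed.
Lemma toCV a : toC a^-1 = (toC a)^-1. Proof. exact: fmorphV. Qed.
Lemma toC0 : toC 0 = 0 :> C. Proof. by []. Qed.
Lemma toC1 : toC 1 = 1 :> C. Proof. by []. Qed.
Lemma toC_nat n : toC n%:R = n%:R :> C. Proof. exact: rmorph_nat. Qed.
Lemma toC_int (n : int) : toC n%:~R = n%:~R :> C. Proof. exact: rmorph_int. Qed.
Lemma toC_sum (I : Type) (s : seq I) (P : pred I) (F : I -> R) :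
  toC (\sum_(i <- s | P i) F i) = \sum_(i <- s | P i) toC (F i).
Proof. exact: rmorph_sum. Qed.
Lemma toCX a n : toC (a ^+ n) = toC a ^+ n. Proof. exact: rmorphXn. Qed.

Lemma cmod_ge0 z : 0 <= cmod z.
Proof. by rewrite -le_toC -normE; exact: normr_ge0. Qed.

Lemma cmodD u z : cmod (u + z) <= cmod u + cmod z.
Proof. by rewrite -le_toC toCD -!normE; exact: ler_normD. Qed.

Lemma cmodM u z : cmod (u * z) = cmod u * cmod z.
Proof. by apply: toC_inj; rewrite toCM -!normE; exact: normrM. Qed.

Lemma cmodN z : cmod (- z) = cmod z.
Proof. by apply: toC_inj; rewrite -!normE; exact: normrN. Qed.

Lemma cmodBC u z : cmod (u - z) = cmod (z - u).
Proof. by rewrite -cmodN opprB. Qed.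

Lemma cmodB u z : cmod (u - z) <= cmod u + cmod z.
Proof. by rewrite -(cmodN z) cmodD. Qed.

Lemma cmod0 : cmod (0 : C) = 0.
Proof. by apply: toC_inj; rewrite -normE normr0. Qed.

Lemma cmod1 : cmod (1 : C) = 1.
Proof. by apply: toC_inj; rewrite -normE normr1. Qed.

Lemma cmod_eq0 z : (cmod z == 0) = (z == 0).
Proof. by rewrite -(inj_eq toC_inj) -normE normr_eq0. Qed.

Lemma cmod_gt0 z : (0 < cmod z) = (z != 0).
Proof. by rewrite lt_def cmod_eq0 cmod_ge0 andbT. Qed.

Lemma cmod_toC a : cmod (toC a) = `|a|.
Proof. by rewrite /cmod /toC /= expr0n /= addr0 sqrtr_sqr. Qed.

Lemma cmod_nat n : cmod (n%:R : C) = n%:R.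
Proof. by rewrite -toC_nat cmod_toC ger0_norm. Qed.

Lemma cmodV z : cmod z^-1 = (cmod z)^-1.
Proof. by apply: toC_inj; rewrite toCV -!normE; exact: normfV. Qed.

Lemma cmodX z n : cmod (z ^+ n) = cmod z ^+ n.
Proof. by apply: toC_inj; rewrite toCX -!normE; exact: normrX. Qed.

Lemma cmod_sum (I : Type) (s : seq I) (P : pred I) (F : I -> C) :
  cmod (\sum_(i <- s | P i) F i) <= \sum_(i <- s | P i) cmod (F i).
Proof. by rewrite -le_toC toC_sum -normE; exact: ler_norm_sum. Qed.

Lemma cmod_prod (I : Type) (s : seq I) (P : pred I) (F : I -> C) :
  cmod (\prod_(i <- s | P i) F i) = \prod_(i <- s | P i) cmod (F i).
Proof. by apply: (big_morph _ cmodM cmod1). Qed.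

Lemma cmod_rect a b : cmod (a +i* b : C)%C = Num.sqrt (a ^+ 2 + b ^+ 2).
Proof. by []. Qed.

Lemma sqr_cmod a b : cmod (a +i* b : C)%C ^+ 2 = a ^+ 2 + b ^+ 2.
Proof. by rewrite cmod_rect sqr_sqrtr // addr_ge0 ?sqr_ge0. Qed.

Lemma le_cmod_rect a b : cmod (a +i* b : C)%C <= `|a| + `|b|.
Proof.
rewrite -(ler_pXn2r (n := 2)) ?nnegrE ?cmod_ge0 ?addr_ge0 // sqr_cmod.
rewrite sqrrD !real_normK ?num_real // addrAC lerDl.
by rewrite mulrn_wge0 // mulr_ge0.
Qed.

Lemma Re_le_cmod a b : `|a| <= cmod (a +i* b : C)%C.
Proof.
rewrite -(ler_pXn2r (n := 2)) ?nnegrE ?cmod_ge0 // sqr_cmod.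
by rewrite real_normK ?num_real // lerDl sqr_ge0.
Qed.

Lemma Im_le_cmod a b : `|b| <= cmod (a +i* b : C)%C.
Proof.
rewrite -(ler_pXn2r (n := 2)) ?nnegrE ?cmod_ge0 // sqr_cmod.
by rewrite real_normK ?num_real // lerDr sqr_ge0.
Qed.

Definition re z : R := complex.Re (z : R[i]).

Lemma reD u z : re (u + z) = re u + re z.
Proof. by case: u; case: z. Qed.
Lemma reN z : re (- z) = - re z.
Proof. by case: z. Qed.
Lemma reMl a z : re (toC a * z) = a * re z.
Proof. by case: z => c d; rewrite /re /= mul0r subr0. Qed.
Lemma re_sum (I : Type) (s : seq I) (P : pred I) (F : I -> C) :
  re (\sum_(i <- s | P i) F i) = \sum_(i <- s | P i) re (F i).
Proof. by apply: (big_morph _ reD). Qed.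

Lemma re_le_cmod z : `|re z| <= cmod z.
Proof. by case: z => a b; exact: Re_le_cmod. Qed.

Lemma cexpD u z : cexp (u + z) = cexp u * cexp z.
Proof.
case: u z => [a b] [c d]; rewrite /cexp /=.
by apply/eqP; rewrite eq_complex /= expRD cosD sinD; apply/andP; split; apply/eqP; ring.
Qed.

Lemma cexp0 : cexp 0 = 1 :> C.
Proof. by rewrite /cexp /= expR0 cos0 sin0 mulr0 mulr1. Qed.

Lemma cexp_sum (I : Type) (s : seq I) (P : pred I) (F : I -> C) :
  cexp (\sum_(i <- s | P i) F i) = \prod_(i <- s | P i) cexp (F i).
Proof. by apply: (big_morph _ cexpD cexp0). Qed.

Lemma cmod_cexp z : cmod (cexp z) = expR (re z).
Proof.
case: z => a b; rewrite /cexp cmod_rect !exprMn -mulrDr cos2Dsin2 mulr1 sqrtr_sqr.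
by rewrite ger0_norm // expR_ge0.
Qed.

Lemma cexp_neq0 z : cexp z != 0.
Proof. by rewrite -cmod_gt0 cmod_cexp expR_gt0. Qed.

Lemma cexpN z : cexp (- z) = (cexp z)^-1.
Proof.
apply: (mulfI (cexp_neq0 z)); rewrite -cexpD subrr cexp0 mulfV //.
exact: cexp_neq0.
Qed.

Lemma cexp_natr n z : cexp (n%:R * z) = cexp z ^+ n.
Proof.
elim: n => [|n IH]; first by rewrite mul0r cexp0.
by rewrite -natr1 mulrDl mul1r cexpD IH exprSr.
Qed.

Lemma MVT_le (f df : R -> R) (x M : R) :
  (forall y : R, is_derive y 1 f (df y)) ->
  (forall y : R, `|y| <= `|x| -> `|df y| <= M) -> `|f x - f 0| <= M * `|x|.
Proof.
move=> fd dM; have cf (a b : R) : {within `[a, b], continuous f}.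
  apply: derivable_within_continuous => y _; exact: (@ex_derive _ _ _ _ _ _ _ (fd y)).
have M0 : 0 <= M by apply: le_trans (dM 0 _) => //; rewrite normr0.
case: (ltgtP x 0) => [x0|x0|->]; last by rewrite subrr !normr0 mulr0.
- have [c /[!in_itv]/= /andP[c1 c2] e] := MVT x0 (fun y _ => fd y) (cf _ _).
  rewrite distrC e normrM sub0r normrN ler_wpM2r //; apply: dM.
  by rewrite !ler0_norm ?lerN2 1?ltW.
- have [c /[!in_itv]/= /andP[c1 c2] e] := MVT x0 (fun y _ => fd y) (cf _ _).
  rewrite e normrM subr0 ler_wpM2r //; apply: dM.
  by rewrite !ger0_norm // ltW.
Qed.

Lemma cos1_le b : `|cos b - 1| <= `|b|.
Proof.
have h (x : R) : is_derive x 1 cos (- sin x) := is_derive_cos x.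
have := @MVT_le cos (fun x : R => - sin x) b 1 h.
by rewrite cos0 mul1r; apply=> x _; rewrite normrN sin_max.
Qed.

Lemma sin_le b : `|sin b| <= `|b|.
Proof.
have h (x : R) : is_derive x 1 sin (cos x) := is_derive_sin x.
have := @MVT_le sin cos b 1 h.
by rewrite sin0 subr0 mul1r; apply=> x _; exact: cos_max.
Qed.

Lemma cos1_le2 b : `|cos b - 1| <= b ^+ 2.
Proof.
have h (x : R) : is_derive x 1 cos (- sin x) := is_derive_cos x.
have := @MVT_le cos (fun x : R => - sin x) b `|b| h.
rewrite cos0 -expr2 real_normK ?num_real //; apply=> x xb.
by rewrite normrN; apply: le_trans xb; exact: sin_le.
Qed.

Lemma sin_sub_le b : `|sin b - b| <= b ^+ 2.
Proof.
have h (x : R) : is_derive x 1 (fun x : R => sin x - x) (cos x - 1).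
  by apply: is_deriveB.
have := @MVT_le (fun x : R => sin x - x) (fun x : R => cos x - 1) b `|b| h.
rewrite sin0 !subr0 -expr2 real_normK ?num_real //; apply=> x xb.
by apply: le_trans xb; exact: cos1_le.
Qed.

Lemma expR_sub1_le a : `|expR a - 1| <= `|a| * expR `|a|.
Proof.
have h1 := expR_ge1Dx a; have h2 := expR_ge1Dx (- a).
have := expRxMexpNx_1 a; have := expR_gt0 a => p0 e.
have h3 : expR a - 1 <= a * expR a by nra.
have [a0|a0] := leP 0 a.
  by rewrite !ger0_norm //; lra.
rewrite (ltr0_norm a0) ltr0_norm ?subr_lt0 ?expR_lt1 //.
have h4 := expR_ge0 (- a); nra.
Qed.

Lemma expR_sub1B_le a : `|expR a - 1 - a| <= a ^+ 2 * expR `|a|.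
Proof.
have h1 := expR_ge1Dx a; have h2 := expR_ge1Dx (- a).
have := expRxMexpNx_1 a; have p0 := expR_gt0 a => e.
have h3 : expR a - 1 <= a * expR a by nra.
rewrite ger0_norm; last by lra.
have h4 := expR_sub1_le a.
apply: (@le_trans _ _ (a * (expR a - 1))); first by lra.
apply: le_trans (ler_norm _) _; rewrite normrM -(real_normK (num_real a)) expr2 -mulrA.
by rewrite ler_wpM2l.
Qed.

(** Taylor's formula for the real and imaginary parts; the constant 3 adds their bounds 1 and 2.
    Only the quadratic order matters later. *)
Lemma cexp_sub1B_le z :
  cmod (cexp z - 1 - z) <= 3 * cmod z ^+ 2 * expR (cmod z).
Proof.
case: z => a b; rewrite sqr_cmod.
have e1 := @Re_le_cmod a b.
set r := cmod _ in e1 *; rewrite -ler_expR in e1.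
rewrite (_ : _ - _ - _ = ((expR a * cos b - 1 - a) +i* (expR a * sin b - b) : C)%C);
  last by rewrite /cexp; apply/eqP; rewrite eq_complex /= !subr0 !eqxx.
apply: le_trans (le_cmod_rect _ _) _.
have p0 := expR_ge0 a; have p1 := ler_norm a; rewrite -ler_expR in p1.
have h1 := expR_sub1B_le a; have h2 := cos1_le2 b; have h3 := sin_sub_le b.
have h4 := expR_sub1_le a.
have A : `|expR a * cos b - 1 - a| <= (a ^+ 2 + b ^+ 2) * expR r.
  rewrite (_ : _ - _ = (expR a - 1 - a) + expR a * (cos b - 1)); last by ring.
  apply: le_trans (ler_normD _ _) _; rewrite normrM (ger0_norm p0) mulrDl lerD //.
    by apply: le_trans h1 _; rewrite ler_wpM2l ?sqr_ge0.
  by rewrite mulrC ler_pM //; apply: le_trans e1.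
have B : `|expR a * sin b - b| <= 2 * (a ^+ 2 + b ^+ 2) * expR r.
  rewrite (_ : _ - _ = expR a * (sin b - b) + (expR a - 1) * b); last by ring.
  apply: le_trans (ler_normD _ _) _; rewrite !normrM (ger0_norm p0).
  apply: (@le_trans _ _ (expR r * b ^+ 2 + (`|a| * expR r) * `|b|)).
    rewrite lerD //.
      by rewrite ler_pM //; apply: le_trans e1.
    by rewrite ler_wpM2r //; apply: le_trans h4 _; rewrite ler_wpM2l.
  have := expR_ge0 r; rewrite -(real_normK (num_real a)) -(real_normK (num_real b)).
  move: (`|a|) (`|b|) => u v p2.
  have : v ^+ 2 + u * v <= 2 * (u ^+ 2 + v ^+ 2).
    by have := sqr_ge0 (u - v); have := sqr_ge0 u; have := sqr_ge0 v; lra.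
  by move=> /(ler_wpM2r p2); lra.
lra.
Qed.

End ComplexModulus.

(** * Neighbourhoods and differentiability in C^n *)

Lemma diff_of_littleo (K : numFieldType) (V W : normedModType K) (f : V -> W)
    (df : {linear V -> W}) (x : V) : continuous df ->
  (forall eps : K, 0 < eps ->
     \forall h \near (0 : V), `|f (h + x) - f x - df h| <= eps * `|h|) ->
  differentiable f x /\ 'd f x = df :> (V -> W).
Proof.
move=> dfc H.
have E : f \o shift x = cst (f x) + df +o_ 0 id.
  apply/eqaddoP => eps /H; rewrite !near_simpl; apply: filterS => h /=.
  by rewrite !fctE opprD addrA.
have dE : 'd f x = df :> (V -> W) by exact: diff_unique.
by split=> //; apply/diff_locallyP; rewrite dE.
Qed.

Section Neighbourhoods.
Variable R : realType.
Local Notation C := (Cx R).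

Lemma posC (e : C) : 0 < e -> exists2 r : R, 0 < r & e = toC r.
Proof.
case: e => a b; rewrite ltcE /= => /andP[/eqP b0 a0]; exists a => //.
by rewrite /toC /real_complex_def b0.
Qed.

Lemma nnegC (e : C) : 0 <= e -> exists2 r : R, 0 <= r & e = toC r.
Proof.
case: e => a b; rewrite lecE /= => /andP[/eqP b0 a0]; exists a => //.
by rewrite /toC /real_complex_def b0.
Qed.

Lemma nearCP (z0 : C) (P : C -> Prop) :
  (\forall z \near z0, P z) <->
  exists2 e : R, 0 < e & forall z, cmod (z - z0) < e -> P z.
Proof.
split=> [/nbhs_ballP[_ /posC[r r0 ->] h]|[e e0 h]].
  exists r => // z zz; apply: h.
  by rewrite -ball_normE /= normE lt_toC cmodBC.
apply/nbhs_ballP; exists (toC e); first by rewrite /= -toC0 lt_toC.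
move=> z; rewrite -ball_normE /= normE lt_toC cmodBC; exact: h.
Qed.

Lemma nearVP n (p : 'cV[C]_n) (P : 'cV[C]_n -> Prop) :
  (\forall x \near p, P x) <->
  exists2 e : R, 0 < e &
    forall x : 'cV[C]_n, (forall i, cmod (x i 0 - p i 0) < e) -> P x.
Proof.
split=> [/nbhs_ballP[_ /posC[r r0 ->] h]|[e e0 h]].
  exists r => // x xx; apply: h; split; first by rewrite -toC0 lt_toC.
  by move=> i j; rewrite ord1 -ball_normE /= normE lt_toC cmodBC.
apply/nbhs_ballP; exists (toC e); first by rewrite /= -toC0 lt_toC.
move=> x [_ xx]; apply: h => i; have := xx i 0.
by rewrite -ball_normE /= normE lt_toC cmodBC.
Qed.

Lemma near_coord n (p : 'cV[C]_n) i (P : C -> Prop) :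
  (\forall z \near p i 0, P z) -> \forall x \near p, P ((x : 'cV[C]_n) i 0).
Proof.
move=> /nearCP[e e0 h]; apply/nearVP; exists e => // x xp; exact: h.
Qed.

(** A quadratic remainder on a polydisc is more than differentiability asks. The bound runs over a
    real [t] dominating all |h_i|, a form in which the remainders of the terms of a series can be
    added up. *)
Lemma diff_of_quad n (f : 'cV[C]_n -> C) (x : 'cV[C]_n) (D : 'I_n -> C) (K e : R) :
  0 < e ->
  (forall (h : 'cV[C]_n) (t : R), t < e -> (forall i, cmod (h i 0) <= t) -> 
     0 <= t ->
     cmod (f (h + x) - f x - \sum_i h i 0 * D i) <= K * t ^+ 2) ->
  differentiable f x /\ forall i, 'D_(delta_mx i 0) f x = D i.
Proof.
move=> e0 H.
pose g (h : 'cV[C]_n) : C := \sum_i h i 0 * D i.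
have gl : linear g.
  move=> a u v; rewrite /g scaler_sumr -big_split /=; apply: eq_bigr => i _.
  by rewrite !mxE mulrDl scalerAl.
pose gL := GRing.isLinear.Build C 'cV[C]_n C _ g gl.
pose G : {linear 'cV[C]_n -> C} := HB.pack g gL.
have coordK (h : 'cV[C]_n) (t : R) : `|h| <= toC t -> forall i, cmod (h i 0) <= t.
  move=> ht i; rewrite -le_toC -normE; apply: le_trans ht.
  rewrite {2}/Num.norm /= mx_normE.
  exact: (@le_bigmax _ _ _ _ (fun ij : 'I_n * 'I_1 => `|h ij.1 ij.2|%:nng) (i, 0)).
have Gc : continuous G.
  have -> : (G : 'cV[C]_n -> C) = \sum_i (fun h : 'cV[C]_n => h i 0 * D i).
    by apply/funext => h; rewrite fct_sumE.
  apply: (@big_rec _ (fun F : 'cV[C]_n -> C => continuous F)).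
    exact: (@cst_continuous _ _ (0 : C)).
  move=> i F _ Fc h; apply: continuousD; last exact: Fc.
  apply: (@continuousM C _ (fun h : 'cV[C]_n => h i 0) (fun=> D i)).
    exact: coord_continuous.
  exact: cst_continuous.
have [df dE] : differentiable f x /\ 'd f x = G :> ('cV[C]_n -> C).
  apply: diff_of_littleo => // _ /posC[r r0 ->].
  have K1 : 0 < `|K| + 1 by rewrite ltr_wpDl.
  have m0 : 0 < Num.min e (r / (`|K| + 1)) by rewrite lt_min e0 divr_gt0.
  apply/nbhs_ballP; exists (toC (Num.min e (r / (`|K| + 1)))).
    by rewrite /= -toC0 lt_toC.
  move=> h; rewrite -ball_normE /= sub0r normrN.
  have [t t0 ht] := nnegC (normr_ge0 h).
  rewrite ht lt_toC lt_min => /andP[te tr].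
  rewrite normE -toCM le_toC.
  apply: (le_trans (H h t te _ t0)); first by apply: coordK; rewrite ht.
  rewrite expr2 mulrA ler_wpM2r //.
  move: tr; rewrite ltr_pdivlMr // => tr.
  by have := ler_norm K; nra.
split=> // i.
rewrite deriveE // dE /= /g (bigD1 i) //= big1 ?addr0 ?mxE ?eqxx ?mul1r // => j ji.
by rewrite mxE (negPf ji) mul0r.
Qed.
End Neighbourhoods.

(** * Unconditional sums *)

Section UnconditionalSums.
Variables (R : realType) (I : choiceType).
Local Notation C := (Cx R).
Implicit Types (F G : I -> C) (A B : {fset I}).

Definition hsum F (z : C) := forall e : R, 0 < e ->
  exists A : {fset I}, forall B : {fset I}, (A `<=` B)%fset ->
    cmod (\sum_(i <- B) F i - z) < e.

Definition absb F (K : R) := forall B : {fset I}, \sum_(i <- B) cmod (F i) <= K.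

Lemma rsum_ex (G : I -> R) (K : R) : (forall i, 0 <= G i) ->
  (forall B : {fset I}, \sum_(i <- B) G i <= K) ->
  exists S, forall e : R, 0 < e -> exists A : {fset I}, forall B : {fset I},
    (A `<=` B)%fset -> `|\sum_(i <- B) G i - S| < e.
Proof.
move=> G0 GK.
pose E := [set \sum_(i <- B) G i | B in [set: {fset I}]].
have hE : has_sup E.
  split; first by exists (\sum_(i <- fset0) G i), fset0.
  by exists K => _ [B _ <-]; exact: GK.
exists (sup E) => e e0.
have [_ [A _ <-] hA] := sup_adherent e0 hE.
exists A => B AB.
have h1 : \sum_(i <- B) G i <= sup E by apply: ub_le_sup; [case: hE|exists B].
have h2 : \sum_(i <- A) G i <= \sum_(i <- B) G i.
  rewrite [leRHS](big_fsetID _ (mem A)) /=.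
  rewrite (_ : [fset x in B | x \in A]%fset = A); first by rewrite lerDl sumr_ge0.
  apply/fsetP => i; rewrite !inE /=; apply/andP/idP => [[]//|iA].
  by split=> //; exact: (fsubsetP AB).
rewrite distrC ger0_norm ?subr_ge0 //; lra.
Qed.

(** The real part of F is the difference of the nonnegative families |F| + Re F and |F|, whose sums
    are suprema of finite sums; likewise for the imaginary part. *)
Lemma hsum_ex F K : absb F K -> exists z, hsum F z.
Proof.
move=> FK.
have rex (p : C -> R) : (forall z, `|p z| <= cmod z) ->
    exists S, forall e : R, 0 < e -> exists A : {fset I}, forall B : {fset I},
    (A `<=` B)%fset -> `|\sum_(i <- B) p (F i) - S| < e.
  move=> hp.
  have [i|B|S1 h1] := @rsum_ex (fun i => cmod (F i)) K; [exact: cmod_ge0|exact: FK|].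
  have [i|B|S2 h2] := @rsum_ex (fun i => cmod (F i) + p (F i)) (2 * K).
  - by have := hp (F i); rewrite ler_norml => /andP[? _]; lra.
  - apply: le_trans (_ : _ <= \sum_(i <- B) (2 * cmod (F i))) _.
      by apply: ler_sum => i _; have := hp (F i); rewrite ler_norml => /andP[_ ?]; lra.
    by rewrite -mulr_sumr ler_wpM2l.
  exists (S2 - S1) => e e0.
  have e2 : 0 < e / 2 by rewrite divr_gt0.
  have [A1 hA1] := h1 _ e2; have [A2 hA2] := h2 _ e2.
  exists (A1 `|` A2)%fset => B; rewrite fsubUset => /andP[/hA1 b1 /hA2 b2].
  move: b1 b2; rewrite big_split /= !ltr_norml => /andP[? ?] /andP[? ?].
  by apply/andP; split; lra.
have [a ha] := rex _ (@re_le_cmod R).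
have him (z : C) : `|complex.Im (z : R[i])| <= cmod z by case: z => u v; exact: Im_le_cmod.
have [b hb] := rex _ him.
exists (a +i* b)%C => e e0.
have e2 : 0 < e / 2 by rewrite divr_gt0.
have [A1 hA1] := ha _ e2; have [A2 hA2] := hb _ e2.
exists (A1 `|` A2)%fset => B; rewrite fsubUset => /andP[/hA1 b1 /hA2 b2].
have rs : re (\sum_(i <- B) F i) = \sum_(i <- B) re (F i) by rewrite re_sum.
have is_ : complex.Im (\sum_(i <- B) F i : R[i]) = \sum_(i <- B) complex.Im (F i : R[i]).
  by apply: (big_morph (fun z : C => complex.Im (z : R[i]))) => // -[? ?] [? ?].
move: rs is_ b1 b2; case: (\sum_(i <- B) F i) => u v /= <- <- b1 b2.
by apply: le_lt_trans (le_cmod_rect _ _) _ => /=; rewrite /re /= in b1; lra.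
Qed.

Definition tsum F : C := summability.sum F.

Lemma hsum_tsum F z : hsum F z -> tsum F = z.
Proof.
move=> h.
pose pf := @summability.totally_filter I.
apply: cvg_lim => //.
apply/cvgrPdist_lt => _ /posC[e e0 ->].
have [A hA] := h _ e0.
exists A => // B AB; rewrite normE lt_toC cmodBC.
by have := hA _ AB; rewrite big_seq_fsetE.
Qed.

Lemma absb_hsum F K : absb F K -> hsum F (tsum F).
Proof. by move=> /hsum_ex[z h]; rewrite (hsum_tsum h). Qed.

Lemma absb_tsum_le F K : absb F K -> cmod (tsum F) <= K.
Proof.
move=> FK; have h := absb_hsum FK; apply/ler_addgt0Pr => e e0.
have [A /(_ A (fsubset_refl _)) hA] := h _ e0.
have := cmodB (\sum_(i <- A) F i) (\sum_(i <- A) F i - tsum F).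
rewrite opprB addrC subrK => h1; apply: (le_trans h1).
apply: lerD; last exact: ltW.
by apply: le_trans (FK A); exact: cmod_sum.
Qed.

Lemma hsumD F G y z : hsum F y -> hsum G z -> hsum (fun i => F i + G i) (y + z).
Proof.
move=> h1 h2 e e0; have e2 : 0 < e / 2 by rewrite divr_gt0.
have [A1 hA1] := h1 _ e2; have [A2 hA2] := h2 _ e2.
exists (A1 `|` A2)%fset => B; rewrite fsubUset => /andP[/hA1 b1 /hA2 b2].
rewrite big_split /= opprD addrACA.
by apply: le_lt_trans (cmodD _ _) _; lra.
Qed.

Lemma hsumZ c F z : hsum F z -> hsum (fun i => c * F i) (c * z).
Proof.
move=> h e e0; have c1 : 0 < cmod c + 1 by rewrite ltr_wpDl ?cmod_ge0.
have [A hA] := h _ (divr_gt0 e0 c1).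
exists A => B /hA; rewrite ltr_pdivlMr // => b.
rewrite -mulr_sumr -mulrBr cmodM.
by have := cmod_ge0 (\sum_(i <- B) F i - z); have := cmod_ge0 c; nra.
Qed.

Lemma hsum0 : hsum (fun=> 0) 0.
Proof. by move=> e e0; exists fset0 => B _; rewrite big1 // subr0 cmod0. Qed.

Lemma hsum_sum (J : Type) (s : seq J) (F : J -> I -> C) (z : J -> C) :
  (forall j, hsum (F j) (z j)) ->
  hsum (fun i => \sum_(j <- s) F j i) (\sum_(j <- s) z j).
Proof.
move=> h; elim: s => [|j s IH].
  by under eq_fun do rewrite big_nil; rewrite big_nil; exact: hsum0.
by under eq_fun do rewrite big_cons; rewrite big_cons; exact: hsumD.
Qed.

Lemma absb_le F G K : (forall i, cmod (F i) <= cmod (G i)) -> absb G K -> absb F K.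
Proof. by move=> FG GK B; apply: le_trans (GK B); exact: ler_sum. Qed.

Lemma absb_le_real F (G : I -> R) K : (forall i, cmod (F i) <= G i) ->
  (forall B : {fset I}, \sum_(i <- B) G i <= K) -> absb F K.
Proof. by move=> FG GK B; apply: le_trans (GK B); exact: ler_sum. Qed.

Lemma absbZ c F K : absb F K -> absb (fun i => c * F i) (cmod c * K).
Proof.
move=> FK B; under eq_bigr do rewrite cmodM.
by rewrite -mulr_sumr ler_wpM2l // cmod_ge0.
Qed.

Lemma absbD F G K L : absb F K -> absb G L -> absb (fun i => F i + G i) (K + L).
Proof.
move=> FK GL B; apply: le_trans (lerD (FK B) (GL B)); rewrite -big_split /=.
by apply: ler_sum => i _; exact: cmodD.
Qed.

Lemma absb_comp (h : I -> I) F K : injective h -> absb F K -> absb (F \o h) K.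
Proof.
move=> hi FK B; apply: le_trans (FK [fset h x | x in B]%fset).
by rewrite big_imfset //= => x y _ _; exact: hi.
Qed.

Lemma hsum_reindex (h : I -> I) F z : injective h ->
  (forall i, F i != 0 -> exists j, i = h j) -> hsum F z -> hsum (F \o h) z.
Proof.
move=> hi hF H e e0; have [A hA] := H _ e0.
have fA : finite_set (h @^-1` [set` A]).
  by apply: finite_preimage => // x y _ _; exact: hi.
exists (fset_set (h @^-1` [set` A])) => B AB.
have -> : \sum_(i <- B) (F \o h) i = \sum_(i <- ([fset h x | x in B] `|` A)%fset) F i.
  transitivity (\sum_(i <- [fset h x | x in B]%fset) F i).
    by rewrite big_imfset //= => x y _ _; exact: hi.
  apply: big_fset_incl; first exact: fsubsetUl.
  move=> i; rewrite inE => /orP[->//|iA] iB.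
  apply/eqP; apply: contraNT iB => /hF[j ij].
  apply/imfsetP; exists j => //=; apply: (fsubsetP AB).
  by rewrite in_fset_set //; apply: mem_set; rewrite /= -ij.
by apply: hA; exact: fsubsetUr.
Qed.

Lemma abs_summableP (S : set I) F :
  abs_summable S F <-> exists K, absb (patch (fun=> 0) S F) K.
Proof.
have E : (\esum_(i in S) `|(cmod (F i))%:E| =
    \esum_(i in setT) (cmod (patch (fun=> 0) S F i))%:E)%E.
  rewrite esum_mkcond; apply: eq_esum => i _; rewrite /patch.
  by case: ifP => _; rewrite ?cmod0 // gee0_abs // lee_fin cmod_ge0.
have p0 i : (0 <= (cmod (patch (fun=> 0) S F i))%:E)%E by rewrite lee_fin cmod_ge0.
rewrite /abs_summable /summable E; split=> [h|[K h]].
  exists (fine (\esum_(i in setT) (cmod (patch (fun=> 0) S F i))%:E)) => B.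
  rewrite -lee_fin fineK; last by rewrite ge0_fin_numE // esum_ge0.
  apply: ereal_sup_ubound; exists [set` B]; first by split.
  by rewrite fsbig_finite //= set_fsetK sumEFin.
apply: (@le_lt_trans _ _ K%:E); last exact: ltry.
apply: ge_ereal_sup => _ [A [fA _] <-].
by rewrite fsbig_finite //= sumEFin lee_fin.
Qed.

End UnconditionalSums.

(** * First order expansions with relative errors *)

Section Jets.
Variable R : realType.
Local Notation C := (Cx R).

(* A first order expansion of [h] at [z], with all errors measured relatively
   to the size bound [U]: this normalization is stable under products. *)
Definition qjet (h : C -> C) (z D : C) (U K e : R) : Prop :=
  [/\ cmod (h z) <= U, cmod D <= K * U &
   forall t, cmod t < e -> cmod (h (t + z) - h z - t * D) <= K * U * cmod t ^+ 2].

Lemma qjet_le h z D U K e K' e' :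
  K <= K' -> e' <= e -> qjet h z D U K e -> qjet h z D U K' e'.
Proof.
move=> KK ee [h1 h2 h3]; have U0 : 0 <= U by apply: le_trans h1; exact: cmod_ge0.
split=> // [|t te]; first by apply: le_trans h2 _; rewrite ler_wpM2r.
apply: (le_trans (h3 t (lt_le_trans te ee))).
by rewrite ler_wpM2r ?sqr_ge0 // ler_wpM2r.
Qed.

Lemma powD_le (r d : R) (l : nat) : 0 <= r -> 0 < d ->
  l%:R * r ^+ l.-1 * d <= (r + d) ^+ l.
Proof.
move=> r0 d0; elim: l => [|l IH]; first by rewrite !mul0r expr0.
have h : r ^+ l <= (r + d) ^+ l by apply: lerXn2r; rewrite ?nnegrE; lra.
have e : l%:R * r ^+ l = r * (l%:R * r ^+ l.-1).
  by case: (l) => [|m]; rewrite ?mul0r ?mulr0 //= exprS mulrCA.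
rewrite exprS /= -natr1 mulrDl mul1r e.
have := ler_wpM2l r0 IH; have := ler_wpM2l (ltW d0) h; lra.
Qed.

(** By the binomial formula the remainder is the sum over j >= 2 of C(l,j) t^j z^(l-j), and |t|^j <=
    (|t|/d)^2 d^j there; the right side is the same sum with nonnegative terms. *)
Lemma pow_rem_le (z t : C) (d : R) (l : nat) : 0 < d -> cmod t <= d ->
  cmod ((t + z) ^+ l - z ^+ l - t * (l%:R * z ^+ l.-1)) <=
  (cmod t / d) ^+ 2 *
    ((cmod z + d) ^+ l - cmod z ^+ l - d * (l%:R * cmod z ^+ l.-1)).
Proof.
move=> d0 td; elim: l => [|l IH].
  by rewrite !expr0 !mul0r !mulr0 !subr0 !subrr cmod0 mulr0.
set a := (X in cmod X) in IH; set A := (X in _ <= _ * X) in IH.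
have A0 : cmod a <= (cmod t / d) ^+ 2 * A by [].
have ez (K : comNzRingType) (y : K) : l%:R * y ^+ l = y * (l%:R * y ^+ l.-1).
  by case: (l) => [|m]; rewrite ?mul0r ?mulr0 //= exprS mulrCA.
have -> : (t + z) ^+ l.+1 - z ^+ l.+1 - t * (l.+1%:R * z ^+ l) =
   (t + z) * a + t ^+ 2 * (l%:R * z ^+ l.-1).
  rewrite /a !exprS -natr1 [(_ + 1) * _]mulrDl mul1r (ez C z); ring.
have -> : (cmod z + d) ^+ l.+1 - cmod z ^+ l.+1 - d * (l.+1%:R * cmod z ^+ l) =
   (cmod z + d) * A + d ^+ 2 * (l%:R * cmod z ^+ l.-1).
  rewrite /A !exprS -natr1 [(_ + 1) * _]mulrDl mul1r (ez R (cmod z)); ring.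
rewrite [leRHS]mulrDr; apply: (le_trans (cmodD _ _)); apply: lerD.
  rewrite cmodM mulrCA; apply: ler_pM => //; rewrite ?cmod_ge0 //.
  by apply: le_trans (cmodD _ _) _; rewrite addrC lerD.
rewrite !cmodM !cmodX cmod_nat [leRHS]mulrA -exprMn divfK ?lt0r_neq0 //.
Qed.

(** Measuring against (|z| + d)^l absorbs the factor l of the derivative and all binomial
    coefficients: the constant and the radius do not depend on l. *)
Lemma pow_qjet (z : C) (d : R) (l : nat) : 0 < d ->
  qjet (fun z => z ^+ l) z (l%:R * z ^+ l.-1) ((cmod z + d) ^+ l)
    (d^-1 + d ^- 2) d.
Proof.
move=> d0; have z0 := cmod_ge0 z.
have U0 : 0 <= (cmod z + d) ^+ l by rewrite exprn_ge0 // addr_ge0 // ltW.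
have h1 : l%:R * cmod z ^+ l.-1 <= d^-1 * (cmod z + d) ^+ l.
  by rewrite ler_pdivlMl // mulrC powD_le.
split.
- by rewrite cmodX; apply: lerXn2r; rewrite ?nnegrE; lra.
- rewrite cmodM cmodX cmod_nat; apply: le_trans h1 _.
  by rewrite ler_wpM2r // lerDl invr_ge0 sqr_ge0.
- move=> t td; apply: le_trans (pow_rem_le z l d0 (ltW td)) _.
  set A := _ - _ - _; set U := (_ + _) ^+ l in U0 A *.
  have AU : A <= U.
    have p1 : 0 <= cmod z ^+ l by exact: exprn_ge0.
    have p2 : 0 <= d * (l%:R * cmod z ^+ l.-1).
      by rewrite !mulr_ge0 ?exprn_ge0 // ltW.
    rewrite /A; lra.
  rewrite exprMn exprVn [leRHS]mulrC -mulrA ler_wpM2l ?sqr_ge0 // mulrDl.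
  have d1 : 0 <= d^-1 * U by rewrite mulr_ge0 // invr_ge0 ltW.
  have := ler_wpM2l (_ : 0 <= d ^- 2) AU; rewrite invr_ge0 sqr_ge0 => /(_ isT); lra.
Qed.

(** Continuity is all that is known of the branch: with lam = l(t + z0) - l(z0) one has exp(lam) = 1
    + t/z0, and inverting the expansion of exp for small lam gives that of the logarithm. *)
Lemma log_jet (z0 : C) (l : C -> C) : log_branch z0 l ->
  exists k e, [/\ 0 < k, 0 < e & forall t, cmod t < e ->
    [/\ cexp (l (t + z0)) = t + z0, cmod (l (t + z0) - l z0) <= k * cmod t &
     cmod (l (t + z0) - l z0 - t / z0) <= k * cmod t ^+ 2]].
Proof.
move=> lb; have [ez cz] := nbhs_singleton lb.
have z0n : z0 != 0 by rewrite -ez cexp_neq0.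
have p0 : 0 < cmod z0 by rewrite cmod_gt0.
have /nearCP[e1 e10 h1] := lb.
(* |lam| < 1/20 makes 3 |lam|^2 exp|lam| <= 6 |lam|^2 <= 3/10 |lam|, whence |lam| <= 2 |t/z0|. *)
have e200 : 0 < toC (20^-1 : R) by rewrite -toC0 lt_toC invr_gt0.
have /nearCP[e2 e20 h2] : \forall z \near z0, `|l z0 - l z| < toC (20^-1 : R).
  by move: cz => /cvgrPdist_lt; apply.
(* The quadratic constant is 6 (2/|z0|)^2. *)
exists (2 / cmod z0 + 24 / cmod z0 ^+ 2), (Num.min e1 e2); split.
- by rewrite addr_gt0 // divr_gt0 // exprn_gt0.
- by rewrite lt_min e10.
move=> t; rewrite lt_min => /andP[t1 t2].
have [//|ezt _] := h1 (t + z0); first by rewrite addrK.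
have /= := h2 (t + z0); rewrite addrK normE lt_toC cmodBC => /(_ t2) h.
set lam := l _ - l z0 in h *.
have elam : cexp lam = 1 + t / z0.
  by rewrite /lam cexpD cexpN ez ezt mulrDl divff // addrC.
have := cexp_sub1B_le lam; rewrite elam [1 + _]addrC addrK cmodBC.
set x := cmod lam in h *; have x0 : 0 <= x by exact: cmod_ge0.
have ex2 : expR x <= 2.
  have := expR_ge1Dx (- x); have := expRxMexpNx_1 x; have := expR_gt0 x; nra.
move=> hB; have {}hB : cmod (lam - t / z0) <= 6 * x ^+ 2.
  by apply: le_trans hB _; have := sqr_ge0 x; nra.
have hl : x <= 2 * (cmod t / cmod z0).
  have := cmodD (lam - t / z0) (t / z0); rewrite subrK -/x cmodM cmodV => h3.
  have : x ^+ 2 <= x / 20 by rewrite expr2 ler_wpM2l // ltW.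
  lra.
have t0 := cmod_ge0 t.
split=> //.
- rewrite mulrDl (le_trans hl) // mulrA mulrAC lerDl mulr_ge0 // divr_ge0 //.
  exact: exprn_ge0 (ltW p0).
- apply: (le_trans hB); rewrite -exprVn.
  have h4 : x ^+ 2 <= (2 * (cmod t / cmod z0)) ^+ 2.
    by apply: lerXn2r; rewrite ?nnegrE // mulr_ge0 // divr_ge0 // ltW.
  have y0 : 0 <= (cmod z0)^-1 by rewrite invr_ge0 ltW.
  move: h4; rewrite !exprMn; move: (cmod z0)^-1 y0 => y y0 h4.
  have := mulr_ge0 y0 (sqr_ge0 (cmod t)); lra.
Qed.

Lemma sqr_le_expR (x : R) : 0 <= x -> x ^+ 2 <= expR (2 * x).
Proof.
move=> x0; rewrite mulr_natl mulr2n expRD -expr2 lerXn2r ?nnegrE ?expR_ge0 //.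
by apply: le_trans (expR_ge1Dx x); rewrite lerDr.
Qed.

(** The point is that [K] and [e] serve all exponents [w] at once. The factors w and w^2 that
    derivative and remainder bring are paid for by exp(eta |w|), with eta as small as desired. *)
Lemma exp_qjet (z0 : C) (l : C -> C) (eta : R) : log_branch z0 l -> 0 < eta ->
  exists K e, [/\ 0 <= K, 0 < e & forall w : C,
    qjet (fun z => cexp (w * l z)) z0 (w * cexp (w * l z0) / z0)
      (expR (re (w * l z0) + eta * cmod w)) K e].
Proof.
move=> lb eta0; have [k [e [k0 e0 H]]] := log_jet lb.
have z0n : z0 != 0.
  by have := H 0; rewrite cmod0 add0r => /(_ e0)[<- _ _]; exact: cexp_neq0.
have p0 : 0 < cmod z0 by rewrite cmod_gt0.
(* The summands come from the remainder of exp, where 48 = 3 * 16 through |w|^2 <= 16/eta^2 exp(eta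
   |w|/2), from w (lam - t/z0), and from the derivative. The radius eta/(2k) ensures |w lam| <= eta
   |w|/2, so that two half exponentials make up exp(eta |w|). *)
exists (48 * k ^+ 2 / eta ^+ 2 + k / eta + (eta * cmod z0)^-1).
exists (Num.min e (eta / (2 * k))).
have K1 : 0 <= 48 * k ^+ 2 / eta ^+ 2 by rewrite divr_ge0 ?sqr_ge0 // mulr_ge0 ?sqr_ge0.
have K2 : 0 <= k / eta by rewrite divr_ge0 // ltW.
have K3 : 0 <= (eta * cmod z0)^-1 by rewrite invr_ge0 mulr_ge0 // ltW.
split; [by rewrite !addr_ge0 | by rewrite lt_min e0 divr_gt0 // mulr_gt0 |].
move=> w; rewrite expRD; set hm := expR (re _); set E := expR (eta * _).
have w0 := cmod_ge0 w.
have E1 : eta * cmod w <= E by apply: le_trans (expR_ge1Dx _); rewrite lerDr.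
have E1' : cmod w <= E / eta by rewrite ler_pdivlMr // mulrC.
have Ege1 : 1 <= E.
  by rewrite -expR0 ler_expR mulr_ge0 // ltW.
have hm0 : 0 < hm by exact: expR_gt0.
have hmE : cmod (cexp (w * l z0)) = hm by rewrite cmod_cexp.
split.
- by rewrite hmE ler_peMr // ltW.
- have h5 : cmod w / cmod z0 <= (eta * cmod z0)^-1 * E.
    rewrite invfM (_ : _ * _ * E = E / eta / cmod z0); last by ring.
    by rewrite ler_wpM2r // invr_ge0 ltW.
  rewrite !cmodM cmodV hmE; move: K1 K2 h5.
  set k1 := 48 * _ / _; set k2 := k / eta; set k3 := _^-1 => K1 K2 h5.
  have hE : 0 <= hm * E by rewrite mulr_ge0 // ltW // expR_gt0.
  have := ler_wpM2l (ltW hm0) h5; have := mulr_ge0 K1 hE; have := mulr_ge0 K2 hE.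
  lra.
- move=> t; rewrite lt_min => /andP[te tk].
  have [_ hl hl2] := H t te.
  set lam := l (t + z0) - l z0 in hl hl2.
  have -> : cexp (w * l (t + z0)) - cexp (w * l z0) - t * (w * cexp (w * l z0) / z0)
     = cexp (w * l z0) * ((cexp (w * lam) - 1 - w * lam) + w * (lam - t / z0)).
    rewrite -[l (t + z0)](subrK (l z0)) -/lam mulrDr cexpD.
    by ring.
  rewrite cmodM hmE [leRHS](_ : _ = hm * ((48 * k ^+ 2 / eta ^+ 2 + k / eta +
    (eta * cmod z0)^-1) * E * cmod t ^+ 2)); last by ring.
  rewrite ler_wpM2l ?(ltW hm0) //.
  have t0 := cmod_ge0 t.
  have h1 : cmod (w * lam) <= eta * cmod w / 2.
    have hl' : cmod lam <= eta / 2.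
      apply: le_trans hl _; move: tk; rewrite ltr_pdivlMr ?mulr_gt0 //; lra.
    by rewrite cmodM; have := ler_wpM2l w0 hl'; lra.
  have h2 := cexp_sub1B_le (w * lam).
  have h3 : expR (cmod (w * lam)) <= expR (eta * cmod w / 2) by rewrite ler_expR.
  have h4 : cmod w ^+ 2 <= 16 / eta ^+ 2 * expR (eta * cmod w / 2).
    have a0 : 0 <= eta * cmod w / 4 by rewrite divr_ge0 // mulr_ge0 // ltW.
    have := sqr_le_expR a0; rewrite (_ : 2 * _ = eta * cmod w / 2); last by field.
    move=> h; rewrite (_ : cmod w ^+ 2 = 16 / eta ^+ 2 * (eta * cmod w / 4) ^+ 2).
      by rewrite ler_wpM2l // divr_ge0 // sqr_ge0.
    by field; rewrite lt0r_neq0.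
  have EE : E = expR (eta * cmod w / 2) ^+ 2.
    by rewrite expr2 -expRD -splitr.
  set e2 := expR (eta * cmod w / 2) in h3 h4 EE.
  have e20 : 0 < e2 by exact: expR_gt0.
  apply: (@le_trans _ _ ((48 * k ^+ 2 / eta ^+ 2 * E + k / eta * E) * cmod t ^+ 2)).
    apply: le_trans (cmodD _ _) _; rewrite mulrDl; apply: lerD.
      apply: le_trans h2 _.
      apply: (@le_trans _ _ (3 * (cmod w ^+ 2 * (k * cmod t) ^+ 2) * e2)).
        have q : cmod (w * lam) ^+ 2 <= cmod w ^+ 2 * (k * cmod t) ^+ 2.
          rewrite cmodM exprMn ler_wpM2l ?sqr_ge0 //.
          by apply: lerXn2r; rewrite ?nnegrE ?cmod_ge0 // mulr_ge0 // ltW.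
        apply: ler_pM; [|exact: expR_ge0|by rewrite ler_wpM2l|exact: h3].
        by apply: mulr_ge0 => //; exact: sqr_ge0.
      rewrite EE exprMn.
      have := ler_wpM2r (mulr_ge0 (mulr_ge0 (sqr_ge0 k) (sqr_ge0 (cmod t))) (ltW e20)) h4.
      by lra.
    rewrite cmodM; apply: le_trans (ler_pM _ _ E1' hl2) _; rewrite ?cmod_ge0 //.
    by rewrite le_eqVlt; apply/orP; left; apply/eqP; ring.
  rewrite ler_wpM2r ?sqr_ge0 // -mulrDl ler_wpM2r ?lerDl //.
  exact: le_trans Ege1.
Qed.

(** Expanding a product of two jets leaves exactly four products of two error terms, so constants K
    and L combine to K + L + 4 K L; equivalently 1 + 4K is multiplicative. The assumption t <= 1
    brings t^3 and t^4 down to t^2. *)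
Lemma qjet_prod (I : eqType) (s : seq I) (f u v : I -> C) (U : I -> R) (K t : R) :
  0 <= K -> 0 <= t -> t <= 1 -> uniq s ->
  (forall i, [/\ cmod (u i) <= U i, cmod (v i) <= K * U i * t &
     cmod (f i - u i - v i) <= K * U i * t ^+ 2]) ->
  let Ks : R := ((1 + 4 * K) ^+ size s - 1) / 4 in
  let U' := \prod_(i <- s) U i in
  let v' := \sum_(i <- s) v i * \prod_(j <- s | j != i) u j in
  [/\ cmod (\prod_(i <- s) u i) <= U', cmod v' <= Ks * U' * t &
      cmod (\prod_(i <- s) f i - \prod_(i <- s) u i - v') <= Ks * U' * t ^+ 2].
Proof.
move=> K0 t0 t1 + H /=; elim: s => [_|i s IH /andP[iNs us]].
  rewrite !big_nil subrr subr0 cmod0 cmod1 /=; split => //; rewrite ?subrr ?mul0r //.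
  by rewrite cmod0.
rewrite !big_cons.
have -> : \prod_(j <- s | j != i) u j = \prod_(j <- s) u j.
  by rewrite big_seq_cond [RHS]big_seq; apply: eq_bigl => j; case: eqVneq => [->|]; rewrite ?andbT // (negPf iNs).
rewrite eqxx /=.
have -> : \sum_(j <- s) v j * \prod_(k <- i :: s | k != j) u k =
    u i * \sum_(j <- s) v j * \prod_(k <- s | k != j) u k.
  rewrite mulr_sumr !big_seq; apply: eq_bigr => j js.
  rewrite big_cons ifT; first by rewrite mulrCA.
  by apply: contraNneq iNs => ->.
have [] := IH us; have [] := H i.
set ps := \prod_(j <- s) u j; set fs := \prod_(j <- s) f j.
set vs := \sum_(j <- s) _; set Us := \prod_(j <- s) U j.
set Ks := (X in X / 4).
rewrite [(1 + 4 * K) ^+ size (i :: s)]exprS.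
have Ks0 : 0 <= Ks / 4.
  by rewrite divr_ge0 // subr_ge0 exprn_ege1 // lerDl mulr_ge0.
rewrite [(1 + 4 * K) * _](_ : _ = (1 + 4 * K) * (1 + 4 * (Ks / 4))); last first.
  by rewrite /Ks; field.
move: (Ks / 4) Ks0 => L L0 a1 a2 a3 b1 b2 b3.
have U0 : 0 <= U i by apply: le_trans a1; exact: cmod_ge0.
have Us0 : 0 <= Us by apply: le_trans b1; exact: cmod_ge0.
have -> : ((1 + 4 * K) * (1 + 4 * L) - 1) / 4 = K + L + 4 * (K * L) by field.
have UU := mulr_ge0 U0 Us0.
have KL := mulr_ge0 K0 L0.
split.
- by rewrite cmodM ler_pM // cmod_ge0.
- apply: le_trans (cmodD _ _) _; rewrite !cmodM.
  have := ler_pM (cmod_ge0 _) (cmod_ge0 _) a2 b1.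
  have := ler_pM (cmod_ge0 _) (cmod_ge0 _) a1 b2.
  have := mulr_ge0 KL (mulr_ge0 UU t0).
  by move=> *; lra.
- set r1 := f i - u i - v i in a3; set r2 := fs - ps - vs in b3.
  have -> : f i * fs - u i * ps - (v i * ps + u i * vs) =
     u i * r2 + v i * vs + v i * r2 + r1 * ps + r1 * vs + r1 * r2.
    by rewrite /r1 /r2; ring.
  do 5!(apply: le_trans (cmodD _ _) _; rewrite -lerBrDr).
  have c1 := ler_pM (cmod_ge0 _) (cmod_ge0 _) a1 b3.
  have c2 := ler_pM (cmod_ge0 _) (cmod_ge0 _) a2 b2.
  have c3 := ler_pM (cmod_ge0 _) (cmod_ge0 _) a2 b3.
  have c4 := ler_pM (cmod_ge0 _) (cmod_ge0 _) a3 b1.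
  have c5 := ler_pM (cmod_ge0 _) (cmod_ge0 _) a3 b2.
  have c6 := ler_pM (cmod_ge0 _) (cmod_ge0 _) a3 b3.
  have t3 : t ^+ 3 <= t ^+ 2 by rewrite exprSr ler_piMr // sqr_ge0.
  have t4 : t ^+ 4 <= t ^+ 2 by rewrite (exprD t 2 2) ler_piMr ?sqr_ge0 // exprn_ile1.
  have W := mulr_ge0 KL UU.
  have d3 := ler_wpM2l W t3; have d4 := ler_wpM2l W t4.
  rewrite !cmodM; lra.
Qed.

End Jets.

(** * Series with symbolic coefficients and exponents *)

Section Series.
Variables (R : realType) (n : nat).
Local Notation C := (Cx R).
Variables (sg vs : {set 'I_n}) (lg : 'I_n -> C -> C) (q : 'I_n -> 'I_n -> R).
Variable Rr : 'I_n -> R.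
Local Notation idxT := 'cV[nat]_n.

(* For q = A_sg^-1 A and g = A_sg^-1 b this is the exponent v^l. *)
Definition exponent (g : 'I_n -> C) (l : idxT) (i : 'I_n) : C :=
  if i \in sg then g i - \sum_(j | j \notin sg) toC (q i j) * (l j 0%R)%:R
  else (l i 0%R)%:R.

(** Outside [vs] the factor is 1: the variable is formal and its power is carried by the index of
    the series. *)
Definition term_factor g l i (z : C) : C :=
  if i \in sg then cexp (exponent g l i * lg i z)
  else if i \in vs then z ^+ l i 0%R else 1.

Definition term_dfactor g l i (z : C) : C :=
  if i \in sg then exponent g l i * cexp (exponent g l i * lg i z) / z
  else if i \in vs then (l i 0%R)%:R * z ^+ (l i 0%R).-1 else 0.

Definition agree_off (a l : idxT) : bool := [forall i, (i \notin vs) ==> (l i 0%R == a i 0%R)].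

Definition weight (rho : 'I_n -> R) (l : idxT) : R :=
  \prod_(i | i \notin sg) rho i ^+ l i 0%R.

Definition slice (a : idxT) (F : idxT -> C) (l : idxT) : C := if agree_off a l then F l else 0.

Definition slice_series (c : idxT -> C) g (a : idxT) (x : 'cV[C]_n) : C :=
  tsum (slice a (fun l => c l * \prod_i term_factor g l i (x i 0))).

Definition is_polyradius (rho : 'I_n -> R) : Prop :=
  forall j, j \notin sg -> 0 < rho j < Rr j.

(** All polyradii below [Rr] are required, and not a single one, because a derivative multiplies the
    coefficients by l_j, which is paid for by a slightly larger radius. *)
Definition slices_summable (c : idxT -> C) : Prop := forall rho, is_polyradius rho ->
  forall a, exists K, absb (slice a (fun l => c l * toC (weight rho l))) K.

(** For q = A_sg^-1 A and j in vs \ sg this is |y_j| < [Rr j], where y_j = x_j x_sg^(-A_sg^-1 a_j)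
    is computed with the branches [lg]. *)
Definition branch_domain (x : 'cV[C]_n) : Prop :=
  (forall i, i \in sg -> log_branch (x i 0) (lg i)) /\
  forall j, j \notin sg -> j \in vs ->
    cmod (x j 0) * expR (- \sum_(i in sg) q i j * re (lg i (x i 0))) < Rr j.

Hypothesis sub : sg \subset vs.
Hypothesis Rr0 : forall j, j \notin sg -> 0 < Rr j.

Lemma notin_sub j : j \notin vs -> j \notin sg.
Proof. by apply: contraNN => /(fintype.subsetP sub). Qed.

Lemma wt_gt0 rho l : is_polyradius rho -> 0 < weight rho l.
Proof.
move=> hr; apply: prodr_gt0 => i ie; apply: exprn_gt0.
by have /andP[] := hr i ie.
Qed.

Lemma eta_ex (a Q k r : R) : a * k < r ->
  \forall e \near (0 : R)^'+, (a + e) * (k * expR (e * Q)) < r.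
Proof.
move=> akr.
have cf : continuous (fun e : R => (a + e) * (k * expR (e * Q))).
  move=> e; apply: continuousM.
    by apply: continuousD; [exact: cst_continuous|exact: (fun=> cvg_id)].
  apply: continuousM; first exact: cst_continuous.
  apply: (@continuous_comp _ _ _ (fun e : R => e * Q)); last exact: continuous_expR.
  apply: continuousM; [exact: (fun=> cvg_id)|exact: cst_continuous].
apply: cvg_within.
have : (a + 0) * (k * expR (0 * Q)) < r by rewrite addr0 mul0r expR0 mulr1.
by move=> /(cvgr_lt _ (cf 0)).
Qed.

(** One radius and one constant serve the jets of all factors of all terms. The exponents on sg are
    affine in l, so the loss exp(eta |w|) multiplies the radii by factors close to 1; a small eta
    keeps them below [Rr]. [C0] collects what depends on [g] and on the coordinates prescribed by
    [a]. *)
Lemma factor_bounds x : branch_domain x ->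
  exists e K rho, [/\ 0 < e, e <= 1, 0 <= K, is_polyradius rho &
    forall g a, exists2 C0, 0 <= C0 & forall l, agree_off a l ->
    exists U : 'I_n -> R,
      (forall i, qjet (term_factor g l i) (x i 0) (term_dfactor g l i (x i 0)) (U i) K e) /\
      \prod_i U i <= C0 * weight rho l].
Proof.
move=> [hlg hdom].
pose nu i := re (lg i (x i 0)).
pose Q j := \sum_(i in sg) `|q i j|.
(* What one unit of l_j contributes on sg: |x_sg^(-q_j)| times the loss exp(eta sum_i |q_ij|). *)
pose kap eta j := expR (- \sum_(i in sg) q i j * nu i) * expR (eta * Q j).
have [eta [eta0 heta]] : exists eta : R, 0 < eta /\
    forall j, j \notin sg -> j \in vs -> (cmod (x j 0) + eta) * kap eta j < Rr j.
  have : \forall e \near (0 : R)^'+, (0 < e) /\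
      forall j, j \notin sg -> j \in vs -> (cmod (x j 0) + e) * kap e j < Rr j.
    apply: filterI; first exact: nbhs_right_gt.
    have H (j : 'I_n) : \forall e \near (0 : R)^'+, j \notin sg -> j \in vs ->
        (cmod (x j 0) + e) * kap e j < Rr j.
      case: (boolP (j \in sg)) => js; first by apply: filterE => e.
      case: (boolP (j \in vs)) => jv; last by apply: filterE => e _.
      have := eta_ex (Q j) (hdom j js jv).
      by apply: filterS => e h _ _.
    exact: (@filter_forall R 'I_n _ (0 : R)^'+ _ H).
  by move=> /filter_ex[e [e0 he]]; exists e.
have kap0 j : 0 < kap eta j by rewrite mulr_gt0 // expR_gt0.
have /choice[KE hKE] : forall i, exists p : R * R, i \in sg ->
   [/\ 0 <= p.1, 0 < p.2 & forall w : C,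
    qjet (fun z => cexp (w * lg i z)) (x i 0) (w * cexp (w * lg i (x i 0)) / x i 0)
      (expR (re (w * lg i (x i 0)) + eta * cmod w)) p.1 p.2].
  move=> i.
  case: (boolP (i \in sg)) => [is_|_]; last by exists (0, 0).
  by have [K [e he]] := exp_qjet (hlg i is_) eta0; exists (K, e).
(* Bounded by eta for the sake of [pow_qjet] and by 1 for that of [qjet_prod]. *)
pose e := \big[Num.min/Num.min 1 eta]_(i in sg) (KE i).2.
pose K := (eta^-1 + eta ^- 2) + \sum_(i in sg) (KE i).1.
have Ks0 : 0 <= \sum_(i in sg) (KE i).1 by apply: sumr_ge0 => i /hKE[].
have Ke0 : 0 <= eta^-1 + eta ^- 2 by rewrite addr_ge0 // invr_ge0 ?sqr_ge0 // ltW.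
(* Outside vs any radius will do: l_j = a_j there, and [C2] corrects the mismatch. *)
pose rho j := if j \in vs then (cmod (x j 0) + eta) * kap eta j else Rr j / 2.
have rho_ok : is_polyradius rho.
  move=> j js; rewrite /rho; case: ifP => jv.
    by rewrite heta // andbT mulr_gt0 // ltr_wpDl // cmod_ge0.
  by have := Rr0 js => r0; apply/andP; split; lra.
have e0 : 0 < e.
  by rewrite /e; elim/big_ind: _ => [|a b a0 b0|i /hKE[]//]; rewrite lt_min ?ltr01 ?a0.
have ele : e <= Num.min 1 eta by apply: bigmin_le_id.
exists e, K, rho; split => //.
- by move: ele; rewrite le_min => /andP[].
- exact: addr_ge0.
move=> g a.
pose C1 := \prod_(i in sg) expR (re (g i * lg i (x i 0)) + eta * cmod (g i)).
pose C2 := \prod_(j | j \notin vs) (kap eta j / rho j) ^+ a j 0%R.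
exists (C1 * C2).
  apply: mulr_ge0; apply: prodr_ge0 => j jv; first exact: expR_ge0.
  have js := notin_sub jv.
  by rewrite exprn_ge0 // divr_ge0 ?ltW //; have /andP[] := rho_ok j js.
move=> l al.
pose U i := if i \in sg then expR (re (exponent g l i * lg i (x i 0)) + eta * cmod (exponent g l i))
  else if i \in vs then (cmod (x i 0) + eta) ^+ l i 0%R else 1.
exists U; split.
  move=> i; rewrite /term_factor /term_dfactor /U; case: ifP => [is_|_].
    have [k1 k2 /(_ (exponent g l i))] := hKE i is_; apply: qjet_le.
      by rewrite /K (bigD1 i) //= addrCA lerDl addr_ge0 // sumr_ge0 // => j /andP[/hKE[]].
    exact: bigmin_le_cond.
  case: ifP => _.
    have := pow_qjet (x i 0) (l i 0%R) eta0; apply: qjet_le.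
      by rewrite /K lerDl.
    by move: ele; rewrite le_min => /andP[].
  split; rewrite ?cmod1 // ?cmod0 ?mulr1 //; first exact: addr_ge0.
  move=> t _; rewrite subrr mulr0 subr0 cmod0 mulr_ge0 ?sqr_ge0 //.
  exact: addr_ge0.
rewrite (bigID (mem sg)) /=.
have -> : \prod_(i | i \notin sg) U i =
   \prod_(i | i \notin sg) (if i \in vs then (cmod (x i 0) + eta) ^+ l i 0%R else 1).
  by apply: eq_bigr => i /negPf is_; rewrite /U is_.
have h1 : \prod_(i in sg) U i <= C1 * \prod_(j | j \notin sg) kap eta j ^+ l j 0%R.
  apply: (@le_trans _ _ (\prod_(i in sg) (expR (re (g i * lg i (x i 0)) + eta * cmod (g i)) *
     \prod_(j | j \notin sg) expR (- (q i j * nu i) + eta * `|q i j|) ^+ l j 0%R))).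
    apply: ler_prod => i is_; rewrite /U is_ expR_ge0 /=.
    have -> : \prod_(j | j \notin sg) expR (- (q i j * nu i) + eta * `|q i j|) ^+ l j 0%R =
        expR (- (\sum_(j | j \notin sg) (l j 0%R)%:R * (q i j * nu i)) +
          \sum_(j | j \notin sg) (l j 0%R)%:R * (eta * `|q i j|)).
      rewrite -sumrN -big_split /= expR_sum; apply: eq_bigr => j _.
      by rewrite -expRM_natl mulrDr mulrN.
    rewrite -expRD ler_expR /exponent is_ mulrBl reD reN mulr_suml re_sum.
    have -> : \sum_(j | j \notin sg) re (toC (q i j) * (l j 0%R)%:R * lg i (x i 0)) =
       \sum_(j | j \notin sg) (l j 0%R)%:R * (q i j * nu i).
      apply: eq_bigr => j _; rewrite -mulrA reMl -toC_nat reMl /nu; ring.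
    have h2 : cmod (g i - \sum_(j | j \notin sg) toC (q i j) * (l j 0%R)%:R) <=
       cmod (g i) + \sum_(j | j \notin sg) (l j 0%R)%:R * `|q i j|.
      apply: le_trans (cmodB _ _) _; rewrite lerD2l.
      apply: le_trans (cmod_sum _ _ _) _; apply: ler_sum => j _.
      by rewrite cmodM cmod_toC cmod_nat mulrC.
    have := ler_wpM2l (ltW eta0) h2.
    have -> : \sum_(j | j \notin sg) (l j 0%R)%:R * (eta * `|q i j|) =
       eta * \sum_(j | j \notin sg) (l j 0%R)%:R * `|q i j|.
      by rewrite mulr_sumr; apply: eq_bigr => j _; ring.
    lra.
  rewrite big_split /= -/C1 exchange_big /=.
  rewrite le_eqVlt; apply/orP; left; apply/eqP; congr (_ * _).
  apply: eq_bigr => j _; rewrite prodrXl; congr (_ ^+ _).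
  rewrite /kap -expRD -expR_sum big_split /= sumrN /Q mulr_sumr //.
have U0 : 0 <= \prod_(i | i \notin sg) (if i \in vs then (cmod (x i 0) + eta) ^+ l i 0%R else 1).
  apply: prodr_ge0 => i _; case: ifP => // _.
  by rewrite exprn_ge0 // addr_ge0 ?cmod_ge0 // ltW.
apply: le_trans (ler_wpM2r U0 h1) _.
rewrite -!mulrA ler_wpM2l //; last first.
  rewrite le_eqVlt; apply/orP; left; apply/eqP.
  have -> : C2 = \prod_(j | j \notin sg) (if j \in vs then 1 else (kap eta j / rho j) ^+ l j 0%R).
    rewrite [RHS](bigID (mem vs)) /= [X in X * _]big1; last by move=> j /andP[_ ->].
    rewrite mul1r; apply: eq_big => [j|j jv].
      by case: (boolP (j \in vs)) => jv; rewrite ?andbF // notin_sub.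
    rewrite (negPf jv); congr (_ ^+ _); apply/esym/eqP.
    by have /forallP/(_ j)/implyP := al; apply.
  rewrite /weight -!big_split /=; apply: eq_bigr => j js.
  have rj : rho j != 0 by rewrite lt0r_neq0 //; have /andP[] := rho_ok j js.
  case: ifP => jv; first by rewrite mul1r /rho jv [RHS]exprMn mulrC.
  by rewrite mulr1 -exprMn divfK.
by apply: prodr_ge0 => i _; exact: expR_ge0.
Qed.

Lemma sel_absb c g a x : slices_summable c -> branch_domain x ->
  exists K, absb (slice a (fun l => c l * \prod_i term_factor g l i (x i 0))) K.
Proof.
move=> hc hx; have [e [K [rho [_ _ _ hr /(_ g a)[C0 C00 H]]]]] := factor_bounds hx.
have [K1 hK] := hc _ hr a.
exists (cmod (toC C0) * K1); apply: absb_le (absbZ (toC C0) hK) => l.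
rewrite /slice; case: ifP => al; last by rewrite cmod0 mulr0 cmod0.
have [U [hU hp]] := H l al.
rewrite !cmodM mulrCA ler_wpM2l ?cmod_ge0 //.
rewrite cmod_prod !cmod_toC !ger0_norm ?(ltW (wt_gt0 _ hr)) //.
apply: le_trans hp; apply: ler_prod => i _; rewrite cmod_ge0 /=.
by case: (hU i).
Qed.

(** By [qjet_prod] the remainder of each term is at most a constant times |c l| weight(l) t^2, so
    the remainders are summable with a quadratic bound and [diff_of_quad] applies. *)
Lemma Phi_diff c g a x : slices_summable c -> branch_domain x ->
  [/\ differentiable (slice_series c g a) x,
   forall i, 'D_(delta_mx i 0) (slice_series c g a) x =
     tsum (slice a (fun l => c l * (term_dfactor g l i (x i 0) *
        \prod_(j | j != i) term_factor g l j (x j 0)))) &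
   forall i, exists K, absb (slice a (fun l => c l * (term_dfactor g l i (x i 0) *
        \prod_(j | j != i) term_factor g l j (x j 0)))) K].
Proof.
move=> hc hx; have [e [K [rho [e0 e1 K0 hr /(_ g a)[C0 C00 H]]]]] := factor_bounds hx.
have [K1 hK] := hc _ hr a.
pose G i := slice a (fun l => c l * (term_dfactor g l i (x i 0) *
        \prod_(j | j != i) term_factor g l j (x j 0))).
have hG i : exists K, absb (G i) K.
  exists (cmod (toC (K * C0)) * K1); apply: absb_le (absbZ (toC (K * C0)) hK) => l.
  rewrite /G /slice; case: ifP => al; last by rewrite cmod0 mulr0 cmod0.
  have [U [hU hp]] := H l al.
  rewrite !cmodM [leRHS]mulrCA ler_wpM2l ?cmod_ge0 //.
  rewrite cmod_prod !cmod_toC !ger0_norm ?(ltW (wt_gt0 _ hr)) ?mulr_ge0 //.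
  apply: (@le_trans _ _ (K * \prod_i U i)); last by rewrite -mulrA ler_wpM2l.
  rewrite [leRHS](_ : _ = K * U i * \prod_(j | j != i) U j); last first.
    by rewrite (bigD1 i) //= mulrA.
  apply: ler_pM; rewrite ?cmod_ge0 //.
  - by apply: prodr_ge0 => j _; exact: cmod_ge0.
  - by case: (hU i).
  - by apply: ler_prod => j _; rewrite cmod_ge0 /=; case: (hU j).
pose Ks := ((1 + 4 * K) ^+ size (index_enum 'I_n) - 1) / 4.
have Ks0 : 0 <= Ks.
  by rewrite divr_ge0 // subr_ge0 exprn_ege1 // lerDl mulr_ge0.
have [df dD] : differentiable (slice_series c g a) x /\
    forall i, 'D_(delta_mx i 0) (slice_series c g a) x = tsum (G i).
  apply: (@diff_of_quad _ _ _ _ _ (cmod (toC (Ks * C0)) * K1) _ e0) => h t te ht t0.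
  pose F (y : 'cV[C]_n) := slice a (fun l => c l * \prod_i term_factor g l i (y i 0)).
  pose D l := F (h + x) l - F x l - \sum_i h i 0 * G i l.
  have hD : absb D (cmod (toC (Ks * C0)) * K1 * t ^+ 2).
    have := absbZ (toC (t ^+ 2)) (absbZ (toC (Ks * C0)) hK).
    rewrite [X in absb _ (X * _)]cmod_toC ger0_norm ?sqr_ge0 // [X in absb _ X]mulrC => h1.
    apply: absb_le h1 => l.
    rewrite /D /F /G /slice; case: ifP => al; last first.
      by rewrite subrr sub0r big1 ?oppr0 ?cmod0 ?cmod_ge0 // => i _; rewrite mulr0.
    have [U [hU hp]] := H l al.
    have -> : c l * \prod_i term_factor g l i ((h + x) i 0) - c l * \prod_i term_factor g l i (x i 0)
       - \sum_i h i 0 * (c l * (term_dfactor g l i (x i 0) * \prod_(j | j != i) term_factor g l j (x j 0)))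
      = c l * (\prod_i term_factor g l i (h i 0 + x i 0) - \prod_i term_factor g l i (x i 0) -
         \sum_i (h i 0 * term_dfactor g l i (x i 0)) * \prod_(j | j != i) term_factor g l j (x j 0)).
      rewrite !mulrBr mulr_sumr; congr (_ - _ - _).
        by congr (_ * _); apply: eq_bigr => i _; rewrite mxE.
      by apply: eq_bigr => i _; ring.
    rewrite cmodM 3!cmodM [leRHS](_ : _ = cmod (c l) * (cmod (toC (t ^+ 2)) *
      (cmod (toC (Ks * C0)) * cmod (toC (weight rho l))))); last by ring.
    rewrite ler_wpM2l ?cmod_ge0 //.
    rewrite !cmod_toC !ger0_norm ?(ltW (wt_gt0 _ hr)) ?(mulr_ge0 Ks0 C00) ?sqr_ge0 //.
    have [||_ _] := @qjet_prod R 'I_n (index_enum 'I_n) (fun i => term_factor g l i (h i 0 + x i 0))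
      (fun i => term_factor g l i (x i 0)) (fun i => h i 0 * term_dfactor g l i (x i 0)) U K t K0 t0
      _ (index_enum_uniq _).
    - by rewrite (le_trans (ltW te)).
    - move=> i; have [q1 q2 q3] := hU i; have hi := ht i.
      have U0 : 0 <= K * U i by apply: le_trans q2; exact: cmod_ge0.
      split=> //; first by rewrite cmodM mulrC ler_pM // cmod_ge0.
      apply: (le_trans (q3 _ (le_lt_trans hi te))); rewrite ler_wpM2l //.
      by apply: lerXn2r; rewrite ?nnegrE ?cmod_ge0.
    move=> /le_trans; apply.
    by rewrite [leLHS]mulrC ler_wpM2l ?sqr_ge0 // -[leRHS]mulrA ler_wpM2l.
  have [Kx hFx] := @sel_absb c g a x hc hx.
  have -> : slice_series c g a (h + x) - slice_series c g a x - \sum_i h i 0 * tsum (G i) = tsum D.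
    have hS : hsum (fun l => \sum_i h i 0 * G i l) (\sum_i h i 0 * tsum (G i)).
      apply: hsum_sum => i; apply: hsumZ; have [K2] := hG i; exact: absb_hsum.
    have hx1 : hsum (F x) (slice_series c g a x) by exact: absb_hsum hFx.
    have e1' : hsum (F (h + x)) (tsum D + slice_series c g a x + \sum_i h i 0 * tsum (G i)).
      have := hsumD (hsumD (absb_hsum hD) hx1) hS.
      congr hsum; apply/funext => l; rewrite /D; ring.
    rewrite {1}/slice_series -/(F (h + x)) (hsum_tsum e1'); ring.
  exact: absb_tsum_le hD.
by split.
Qed.

End Series.

(** * Derivatives act on the coefficients *)

Lemma re_continuous (R : realType) : continuous (@re R).
Proof.
move=> z; apply/(@cvgrPdist_lt _ R _ (nbhs z)) => e e0; apply/nearCP.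
exists e => // w wz.
by rewrite -reN -reD; apply: le_lt_trans (re_le_cmod _) _; rewrite cmodBC.
Qed.

Lemma cmod_continuous (R : realType) : continuous (@cmod R).
Proof.
move=> z; apply/(@cvgrPdist_lt _ R _ (nbhs z)) => e e0; apply/nearCP.
exists e => // w wz.
apply: le_lt_trans wz; rewrite ler_norml.
have := cmodB z (z - w); rewrite subKr.
have := cmodB w (w - z); rewrite subKr (cmodBC z w) => h1 h2.
by apply/andP; split; lra.
Qed.

Section Action.
Variables (R : realType) (n : nat).
Local Notation C := (Cx R).
Variables (sg vs : {set 'I_n}) (lg : 'I_n -> C -> C) (q : 'I_n -> 'I_n -> R).
Variable Rr : 'I_n -> R.
Local Notation idxT := 'cV[nat]_n.
Local Notation ex := (exponent sg q).
Local Notation factor := (term_factor sg vs lg q).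
Local Notation dfactor := (term_dfactor sg vs lg q).
Local Notation idx := (agree_off vs).
Local Notation wt := (weight sg).
Local Notation sel := (@slice R n vs).
Local Notation Phi := (slice_series sg vs lg q).
Local Notation polyradius := (is_polyradius sg Rr).
Local Notation cnv := (slices_summable sg vs Rr).
Local Notation dom := (branch_domain sg vs lg q Rr).

Hypothesis sub : sg \subset vs.
Hypothesis Rr0 : forall j, j \notin sg -> 0 < Rr j.
Hypothesis qsg : forall i j, i \in sg -> j \in sg -> q i j = (i == j)%:R.

Lemma dom_open x : dom x -> \forall y \near (x : 'cV[C]_n), dom y.
Proof.
move=> [h1 h2].
have A1 (i : 'I_n) : \forall y \near (x : 'cV[C]_n), i \in sg ->
    log_branch ((y : 'cV[C]_n) i 0) (lg i).
  case: (boolP (i \in sg)) => is_; last by apply: filterE.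
  have := near_coord (nbhs_interior (h1 i is_)).
  by apply: filterS => y hy _.
have cj (i : 'I_n) : {for x, continuous (fun y : 'cV[C]_n => y i 0)}.
  exact: coord_continuous.
have A2 (j : 'I_n) : \forall y \near (x : 'cV[C]_n), j \notin sg -> j \in vs ->
    cmod ((y : 'cV[C]_n) j 0) *
      expR (- \sum_(i in sg) q i j * re (lg i ((y : 'cV[C]_n) i 0))) < Rr j.
  case: (boolP (j \in sg)) => js; first by apply: filterE => e.
  case: (boolP (j \in vs)) => jv; last by apply: filterE => e _.
  pose f (y : 'cV[C]_n) := cmod (y j 0) * expR (- \sum_(i in sg) q i j * re (lg i (y i 0))).
  have cf : {for x, continuous f}.
    apply: (@continuousM _ _ (fun y : 'cV[C]_n => cmod (y j 0))).
      apply: (@continuous_comp _ _ _ (fun y : 'cV[C]_n => y j 0) (@cmod R)); first exact: cj.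
      exact: cmod_continuous.
    apply: (@continuous_comp _ _ _ (fun y : 'cV[C]_n => - \sum_(i in sg) q i j * re (lg i (y i 0))));
      last exact: continuous_expR.
    apply: continuousN; rewrite (_ : (fun y => _) =
      \sum_(i in sg) (fun y : 'cV[C]_n => q i j * re (lg i (y i 0)))); last first.
      by apply/funext => y; rewrite fct_sumE.
    apply: (@big_ind _ (fun F : 'cV[C]_n -> R => {for x, continuous F})).
    - exact: (@cst_continuous _ _ (0 : R)).
    - by move=> F G cF cG; apply: continuousD.
    - move=> i is_.
      apply: (@continuousM _ _ (fun=> q i j) (fun y : 'cV[C]_n => re (lg i (y i 0)))).
        exact: cst_continuous.
      apply: (@continuous_comp _ _ _ (fun y : 'cV[C]_n => y i 0) (fun z => re (lg i z))).
        exact: cj.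
      apply: continuous_comp; last exact: re_continuous.
      by have [] := nbhs_singleton (h1 i is_).
  have H : \forall y \near (x : 'cV[C]_n), f y < Rr j.
    by apply: (cvgr_lt _ cf); exact: h2.
  by apply: filterS H => y hy _ _.
have B1 : \forall y \near (x : 'cV[C]_n), forall i, i \in sg ->
    log_branch ((y : 'cV[C]_n) i 0) (lg i) by exact: (@filter_forall _ 'I_n _ (nbhs x) _ A1).
have B2 : \forall y \near (x : 'cV[C]_n), forall j, j \notin sg -> j \in vs ->
    cmod ((y : 'cV[C]_n) j 0) * expR (- \sum_(i in sg) q i j * re (lg i ((y : 'cV[C]_n) i 0))) < Rr j.
  by exact: (@filter_forall _ 'I_n _ (nbhs x) _ A2).
by apply: filterS2 B1 B2 => y.
Qed.

(** Equality on the whole open domain and not at a point, so that derivatives may be taken of both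
    sides. *)
Definition series_eq (f g : fseries R n) : Prop :=
  forall a, Nbar vs a -> forall x, dom x -> f a x = g a x.

Lemma feq_trans f g h : series_eq f g -> series_eq g h -> series_eq f h.
Proof. by move=> h1 h2 a aN x hx; rewrite h1 // h2. Qed.

Lemma act_feq P f g : series_eq f g -> series_eq (act vs P f) (act vs P g).
Proof.
elim: P f g => [c|i|i|P IP Q IQ|P IP Q IQ] f g fg /=.
- by move=> a aN x hx; rewrite fg.
- case: ifP => iv a aN x hx; first by rewrite fg.
  case: ifP => // _; apply: fg => // j jv.
  by rewrite mxE aN.
- case: ifP => iv a aN x hx; last first.
    congr (_ * _); apply: fg => // j jv; rewrite mxE aN //.
    by case: eqVneq => [ji|//]; rewrite ji iv in jv.
  have h : {near x, f a =1 g a}.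
    by have := dom_open hx; apply: filterS => y hy; exact: fg.
  case: (eqVneq (delta_mx i 0 : 'cV[C]_n) 0) => [->|n0].
    by rewrite !derive0.
  exact: near_eq_derive.
- by move=> a aN x hx; rewrite (IP f g) // (IQ f g).
- exact/IP/IQ.
Qed.

Lemma act_cst0 P : act vs P (fun _ _ => 0) = (fun _ _ => 0) :> fseries R n.
Proof.
elim: P => [c|i|i|P IP Q IQ|P IP Q IQ] /=; apply/funext => a; apply/funext => x.
- by rewrite mulr0.
- by case: ifP => _; rewrite ?mulr0 //; case: ifP.
- by case: ifP => _; rewrite ?mulr0 // derive_cst.
- by rewrite IP IQ addr0.
- by rewrite IQ IP.
Qed.

Lemma tsumZ (I : choiceType) (F : I -> C) K k : absb F K ->
  tsum (fun l => k * F l) = k * tsum F.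
Proof. by move=> /absb_hsum h; apply: hsum_tsum; exact: hsumZ. Qed.

Lemma selZ a F k : sel a (fun l => k * F l) = fun l => k * sel a F l.
Proof. by apply/funext => l; rewrite /slice; case: ifP; rewrite ?mulr0. Qed.

Definition sh (i : 'I_n) (l : idxT) : idxT := \col_j (l j 0%R + (j == i))%N.

Lemma sh_inj i : injective (sh i).
Proof.
move=> l m /matrixP h; apply/matrixP => j k; rewrite ord1.
by have := h j 0; rewrite !mxE => /addIn.
Qed.

Lemma sh_surj i (l : idxT) : l i 0%R != 0%N -> exists m, l = sh i m.
Proof.
move=> l0; exists (\col_j (l j 0%R - (j == i))%N); apply/matrixP => j k.
rewrite ord1 !mxE; case: eqVneq => [->|_]; last by rewrite subn0 addn0.
by rewrite subnK // lt0n.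
Qed.

Lemma idx_sh_vs i a l : i \in vs -> idx a (sh i l) = idx a l.
Proof.
move=> iv; apply: eq_forallb => j; rewrite mxE.
by case: (eqVneq j i) => [->|_]; rewrite ?iv ?addn0.
Qed.

Lemma idx_sh i a l : idx (sh i a) (sh i l) = idx a l.
Proof. by apply: eq_forallb => j; rewrite !mxE eqn_add2r. Qed.

Lemma idxE a l i : idx a l -> i \notin vs -> l i 0%R = a i 0%R.
Proof. by move=> /forallP/(_ i)/implyP h /h/eqP. Qed.

(** For g = A_sg^-1 b this is A_sg^-1 (b - a_i): the derivative in x_i shifts the parameter by
    a_i. *)
Definition sub_entries (g : 'I_n -> C) (i : 'I_n) : 'I_n -> C := fun k => g k - toC (q k i).

Lemma ex_gsub_sg g l i k : i \in sg -> k \in sg ->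
  ex (sub_entries g i) l k = ex g l k - (k == i)%:R.
Proof.
move=> is_ ks; rewrite /exponent ks /sub_entries qsg // addrAC; congr (_ - _).
by rewrite -toC_nat.
Qed.

Lemma ex_sh_sg g l i k : i \notin sg -> k \in sg -> ex g (sh i l) k = ex (sub_entries g i) l k.
Proof.
move=> is_ ks; rewrite /exponent ks /sub_entries -addrA -opprD; congr (_ - _).
rewrite (bigD1 i) //= [in RHS](bigD1 i) //= addrA mxE eqxx addn1 -natr1 mulrDr mulr1 [X in X + _]addrC.
congr (_ + _); apply: eq_bigr => j /andP[_ ji].
by rewrite mxE (negPf ji) addn0.
Qed.

Lemma ex_Nsg g l k : k \notin sg -> ex g l k = (l k 0%R)%:R.
Proof. by rewrite /exponent => /negPf ->. Qed.

(** For i in sg only [g] records the derivative; for i outside sg the index drops by e_i, and the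
    change of [g] keeps the sg-exponents of the old index. *)
Definition deriv_coef i g (c : idxT -> C) : idxT -> C := fun l =>
  if i \in sg then c l * ex g l i else c (sh i l) * (l i 0%R).+1%:R.

Lemma geom_ge (r : R) (l : nat) : 1 < r -> l%:R <= (r - 1)^-1 * r ^+ l.
Proof.
move=> r1; have d0 : 0 < r - 1 by rewrite subr_gt0.
rewrite ler_pdivlMl //; elim: l => [|l IH]; first by rewrite mulr0 expr0.
have h : 1 <= r ^+ l by rewrite exprn_ege1 // ltW.
rewrite -natr1 mulrDr mulr1 exprS.
have := ler_wpM2l (ltW d0) h; lra.
Qed.

Lemma wt_sh (rho : 'I_n -> R) i l : i \notin sg -> wt rho (sh i l) = wt rho l * rho i.
Proof.
move=> is_; rewrite /weight (bigD1 i) //= [in RHS](bigD1 i) //= mxE eqxx addn1 exprSr.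
rewrite -!mulrA; congr (_ * _); rewrite mulrC; congr (_ * _).
by apply: eq_bigr => j /andP[_ ji]; rewrite mxE (negPf ji) addn0.
Qed.

Lemma cnvZ k c : cnv c -> cnv (fun l => k * c l).
Proof.
move=> hc rho hr a; have [K hK] := hc rho hr a.
exists (cmod k * K); have := absbZ k hK; apply: absb_le => l.
by rewrite /slice; case: ifP => _; rewrite ?mulr0 // mulrA.
Qed.

Lemma cnvD c1 c2 : cnv c1 -> cnv c2 -> cnv (fun l => c1 l + c2 l).
Proof.
move=> h1 h2 rho hr a; have [K hK] := h1 rho hr a; have [L hL] := h2 rho hr a.
exists (K + L); have := absbD hK hL; apply: absb_le => l.
by rewrite /slice; case: ifP => _; rewrite ?addr0 // mulrDl.
Qed.

Lemma cnv0 : cnv (fun=> 0).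
Proof.
move=> rho hr a; exists 0 => B; rewrite big1 // => l _.
by rewrite /slice; case: ifP => _; rewrite ?mul0r cmod0.
Qed.

Lemma cnv_sum (J : Type) (s : seq J) (P : pred J) (F : J -> idxT -> C) :
  (forall j, P j -> cnv (F j)) -> cnv (fun l => \sum_(j <- s | P j) F j l).
Proof.
move=> h; elim: s => [|j s IH].
  by under eq_fun do rewrite big_nil; exact: cnv0.
case: (boolP (P j)) => Pj.
  by under eq_fun do rewrite big_cons Pj; apply: cnvD => //; exact: h.
by under eq_fun do rewrite big_cons (negPf Pj).
Qed.

(** The radius in direction j can be raised to the midpoint of rho_j and [Rr j]; the geometric gain
    dominates the factor l_j. *)
Lemma cnv_mull c j : j \notin sg -> cnv c -> cnv (fun l => c l * (l j 0%R)%:R).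
Proof.
move=> js hc rho hr a.
pose rho' k := if k == j then (rho j + Rr j) / 2 else rho k.
have /andP[r0 rR] := hr j js.
have hr' : polyradius rho'.
  move=> k ks; rewrite /rho'; case: eqVneq => [->|_]; last exact: hr.
  by apply/andP; split; lra.
have [K hK] := hc rho' hr' a.
have hd : 1 < rho' j / rho j.
  by rewrite ltr_pdivlMr // mul1r /rho' eqxx; lra.
exists (cmod (toC (rho' j / rho j - 1)^-1) * K).
have := absbZ (toC (rho' j / rho j - 1)^-1) hK; apply: absb_le => l.
rewrite /slice; case: ifP => _; last by rewrite mulr0.
rewrite !cmodM cmod_nat mulrCA -!mulrA ler_wpM2l ?cmod_ge0 //.
have d0 : 0 <= (rho' j / rho j - 1)^-1 by rewrite invr_ge0 subr_ge0 ltW.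
rewrite !cmod_toC !ger0_norm ?(ltW (wt_gt0 _ hr)) ?(ltW (wt_gt0 _ hr')) //.
have -> : wt rho' l = (rho' j / rho j) ^+ l j 0%R * wt rho l.
  rewrite /weight (bigD1 j) //= [in RHS](bigD1 j) //= mulrA -exprMn divfK ?lt0r_neq0 //.
  by congr (_ * _); apply: eq_bigr => k /andP[_ /negPf kj]; rewrite /rho' kj.
by rewrite mulrA ler_wpM2r ?(ltW (wt_gt0 _ hr)) // geom_ge.
Qed.

Lemma cnv_sh c i : i \notin sg -> cnv c -> cnv (fun l => c (sh i l)).
Proof.
move=> is_ hc rho hr a; have /andP[r0 _] := hr i is_.
pose a' := if i \in vs then a else sh i a.
have [K hK] := hc rho hr a'.
exists (cmod (toC (rho i)^-1) * K).
have := absbZ (toC (rho i)^-1) (absb_comp (@sh_inj i) hK); apply: absb_le => l.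
rewrite /slice /=.
have -> : idx a' (sh i l) = idx a l.
  by rewrite /a'; case: ifP => iv; rewrite ?idx_sh // idx_sh_vs.
case: ifP => _; last by rewrite mulr0.
rewrite wt_sh // [X in _ <= cmod X](_ : _ = c (sh i l) * toC (wt rho l)) //.
by rewrite mulrCA -toCM mulrCA mulVf ?mulr1 // lt0r_neq0.
Qed.

Lemma cnv_ex c g i : cnv c -> cnv (fun l => c l * ex g l i).
Proof.
move=> hc; rewrite /exponent; case: (boolP (i \in sg)) => is_; last exact: cnv_mull.
have -> : (fun l : idxT => c l * (g i - \sum_(j | j \notin sg) toC (q i j) * (l j 0%R)%:R)) =
  (fun l => g i * c l + \sum_(j | j \notin sg) (- toC (q i j)) * (c l * (l j 0%R)%:R)).
  apply/funext => l; rewrite mulrBr mulrC; congr (_ + _).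
  rewrite mulr_sumr -sumrN; apply: eq_bigr => j _; ring.
apply: cnvD; first exact: cnvZ.
by apply: cnv_sum => j js; apply: cnvZ; exact: cnv_mull.
Qed.

Lemma cnv_dcf i g c : cnv c -> cnv (deriv_coef i g c).
Proof.
move=> hc; rewrite /deriv_coef; case: (boolP (i \in sg)) => is_; first exact: cnv_ex.
have -> : (fun l => c (sh i l) * (l i 0%R).+1%:R) =
    (fun l => (fun m : idxT => c m * (m i 0%R)%:R) (sh i l)).
  by apply/funext => l; rewrite mxE eqxx addn1.
by apply: (@cnv_sh (fun m : idxT => c m * (m i 0%R)%:R)) => //; exact: cnv_mull.
Qed.

Lemma factor_sh g i l j z : i \notin sg -> j != i ->
  factor g (sh i l) j z = factor (sub_entries g i) l j z.
Proof.
move=> is_ ji; rewrite /term_factor; case: ifP => js; first by rewrite ex_sh_sg.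
by rewrite mxE (negPf ji) addn0.
Qed.

Lemma dom_cexp x i : dom x -> i \in sg -> cexp (lg i (x i 0)) = x i 0.
Proof. by move=> [h _] is_; have [] := nbhs_singleton (h i is_). Qed.

Lemma act_OD i c g : cnv c ->
  series_eq (act vs (OD i) (Phi c g)) (Phi (deriv_coef i g c) (sub_entries g i)).
Proof.
move=> hc a aN x hx /=; case: (boolP (i \in vs)) => iv.
  have [_ -> /(_ i)[K hK]] := Phi_diff sub Rr0 g a hc hx.
  rewrite /slice_series /deriv_coef; case: (boolP (i \in sg)) => is_.
    congr tsum; apply/funext => l; rewrite /slice; case: ifP => // _.
    rewrite [in RHS](bigD1 i) //= -[RHS]mulrA; congr (_ * _).
    rewrite [RHS]mulrA; congr (_ * _).
      rewrite /term_dfactor /term_factor is_ ex_gsub_sg // eqxx mulrBl mul1r cexpD cexpN.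
      by rewrite dom_cexp // mulrA.
    apply: eq_bigr => j ji; rewrite /term_factor; case: ifP => // js.
    by rewrite ex_gsub_sg // (negPf ji) subr0.
  (* [sh i] misses only the indices with l_i = 0, whose terms the derivative kills. *)
  have hs := @hsum_reindex _ _ (sh i) _ _ (@sh_inj i) _ (absb_hsum hK).
  rewrite -(hsum_tsum (hs _)); last first.
    move=> l h; apply: sh_surj; apply: contraNneq h => l0.
    rewrite /slice /term_dfactor (negPf is_) iv l0 !mul0r mulr0.
    by case: ifP.
  congr tsum; apply/funext => l; rewrite /slice /= idx_sh_vs //; case: ifP => // _.
  rewrite -mulrA; congr (_ * _); rewrite [in RHS](bigD1 i) //= mulrA; congr (_ * _).
    by rewrite /term_dfactor /term_factor (negPf is_) iv mxE eqxx addn1.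
  by apply: eq_bigr => j ji; rewrite factor_sh.
have is_ := notin_sub sub iv.
have [K hK] := sel_absb sub Rr0 g (sh i a) hc hx.
rewrite -/(sh i a) /slice_series /deriv_coef (negPf is_).
have hs := @hsum_reindex _ _ (sh i) _ _ (@sh_inj i) _ (absb_hsum hK).
rewrite -(hsum_tsum (hs _)); last first.
  move=> l; rewrite /slice; case: ifP => [/idxE/(_ iv)|_]; last by rewrite eqxx.
  by rewrite mxE eqxx addn1 => li _; apply: sh_surj; rewrite li.
rewrite -(tsumZ _ (absb_comp (@sh_inj i) hK)).
congr tsum; apply/funext => l; rewrite /slice /= idx_sh; case: ifP => [al|_]; last by rewrite mulr0.
rewrite (idxE al iv) mulrCA -mulrA; congr (_ * _); congr (_ * _).
apply: eq_bigr => j _; case: (eqVneq j i) => [->|ji]; last by rewrite factor_sh.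
by rewrite /term_factor (negPf is_) (negPf iv).
Qed.

(** x_i d_i acts diagonally, by the exponent. The Euler operators contain [OX] only in this
    combination. *)
Lemma act_OXD i c g : cnv c ->
  series_eq (act vs (OX i) (act vs (OD i) (Phi c g))) (Phi (fun l => c l * ex g l i) g).
Proof.
move=> hc a aN x hx /=; case: (boolP (i \in vs)) => iv.
  have [_ -> /(_ i)[K hK]] := Phi_diff sub Rr0 g a hc hx.
  rewrite -(tsumZ _ hK) -selZ; congr tsum; apply/funext => l; rewrite /slice; case: ifP => // _.
  rewrite mulrCA -mulrA; congr (_ * _).
  rewrite [in RHS](bigD1 i) //= !mulrA; congr (_ * _).
  rewrite /term_dfactor /term_factor /exponent iv; case: ifP => is_.
    have x0 : x i 0 != 0 by rewrite -(dom_cexp hx is_) cexp_neq0.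
    by rewrite is_; field.
  by case: (l i 0%R) => [|m] /=; rewrite ?mul0r ?mulr0 // exprS mulrCA.
have is_ := notin_sub sub iv.
have [K hK] := sel_absb sub Rr0 g a hc hx.
transitivity ((a i 0%R)%:R * Phi c g a x).
  (* The value 0 that [act] gives to multiplication by a formal x_i at a_i = 0 agrees with the
     factor a_i. *)
  case: eqP => [->|/eqP a0]; first by rewrite mul0r.
  rewrite mxE eqxx; congr (_%:R * Phi c g _ x); first by rewrite subn1 prednK // lt0n.
  apply/matrixP => j k; rewrite ord1 !mxE; case: eqVneq => [->|_]; last by rewrite subn0 addn0.
  by rewrite subnK // lt0n.
rewrite -(tsumZ _ hK) -selZ; congr tsum; apply/funext => l; rewrite /slice; case: ifP => // al.
by rewrite ex_Nsg // (idxE al iv) mulrCA mulrA.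
Qed.

End Action.

(** * Box and Euler operators on series *)

Section Falling.
Variable F : comNzRingType.

Definition falling (v : F) (t : nat) : F := \prod_(1 <= j < t.+1) (v - j%:R + 1).

Lemma falling0 v : falling v 0 = 1.
Proof. by rewrite /falling big_geq. Qed.

Lemma fallingS v t : falling v t.+1 = falling v t * (v - t%:R).
Proof. by rewrite /falling big_nat_recr //=; congr (_ * _); rewrite -natr1; ring. Qed.

Lemma fallingD v s t : falling v (s + t) = falling v s * falling (v - s%:R) t.
Proof.
elim: t => [|t IH]; first by rewrite addn0 falling0 mulr1.
by rewrite addnS !fallingS IH -mulrA natrD opprD addrA.
Qed.

End Falling.

Section Words.
Variables (R : realType) (n : nat).
Local Notation C := (Cx R).
Variables (sg vs : {set 'I_n}) (lg : 'I_n -> C -> C) (q : 'I_n -> 'I_n -> R).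
Variable Rr : 'I_n -> R.
Local Notation idxT := 'cV[nat]_n.
Local Notation ex := (exponent sg q).
Local Notation Phi := (slice_series sg vs lg q).
Local Notation cnv := (slices_summable sg vs Rr).
Local Notation dom := (branch_domain sg vs lg q Rr).
Local Notation feq := (series_eq sg vs lg q Rr).
Local Notation dcf := (deriv_coef sg q).
Local Notation gsub := (sub_entries q).

Hypothesis sub : sg \subset vs.
Hypothesis Rr0 : forall j, j \notin sg -> 0 < Rr j.
Hypothesis qsg : forall i j, i \in sg -> j \in sg -> q i j = (i == j)%:R.

Definition add_idx (u l : idxT) : idxT := \col_j (l j 0%R + (if j \in sg then 0 else u j 0%R))%N.

Definition dpow_exponent (u : idxT) (g : 'I_n -> C) : 'I_n -> C :=
  fun k => g k - \sum_i toC (q k i) * (u i 0%R)%:R.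

(** Closed form of [deriv_coef] iterated along d^u: the index moves by u off sg, and each coordinate
    i contributes the falling factorial [v_i]_(u_i) of the old exponent. *)
Definition dpow_coef (u : idxT) g (c : idxT -> C) : idxT -> C := fun l =>
  c (add_idx u l) * \prod_i falling (ex g (add_idx u l) i) (u i 0%R).

Lemma ex_gu u g l i : ex (dpow_exponent u g) l i + (if i \in sg then 0 else (u i 0%R)%:R)
   = ex g (add_idx u l) i - (if i \in sg then (u i 0%R)%:R else 0).
Proof.
rewrite /exponent; case: ifP => is_; last first.
  by rewrite mxE is_ natrD subr0.
rewrite addr0 /dpow_exponent (bigID (mem sg)) /= (bigD1 i) //= qsg // eqxx toC1 mul1r.
rewrite big1 ?addr0; last first.
  by move=> j /andP[js /negPf ji]; rewrite qsg // eq_sym ji toC0 mul0r.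
have -> : \sum_(j | j \notin sg) toC (q i j) * (add_idx u l j 0%R)%:R =
   \sum_(j | j \notin sg) toC (q i j) * (l j 0%R)%:R + \sum_(j | j \notin sg) toC (q i j) * (u j 0%R)%:R.
  rewrite -big_split /=; apply: eq_bigr => j /negPf js.
  by rewrite mxE js natrD mulrDr.
ring.
Qed.

Lemma gsub_gu u g i : gsub (dpow_exponent u g) i = dpow_exponent (sh i u) g.
Proof.
apply/funext => k; rewrite /sub_entries /dpow_exponent -addrA -opprD; congr (_ - _).
under [RHS]eq_bigr => j _ do rewrite mxE natrD mulrDr.
rewrite big_split /=; congr (_ + _).
rewrite (bigD1 i) //= eqxx mulr1 big1 ?addr0 // => j /negPf ->.
by rewrite mulr0.
Qed.

Lemma dcf_cu u g c i : dcf i (dpow_exponent u g) (dpow_coef u g c) = dpow_coef (sh i u) g c.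
Proof.
apply/funext => l; rewrite /deriv_coef.
have H m : \prod_j falling (ex g m j) (sh i u j 0%R) =
    (\prod_j falling (ex g m j) (u j 0%R)) * (ex g m i - (u i 0%R)%:R).
  rewrite (bigD1 i) //= [in RHS](bigD1 i) //= mxE eqxx addn1 fallingS -!mulrA; congr (_ * _).
  rewrite mulrC; congr (_ * _); apply: eq_bigr => j ji.
  by rewrite mxE (negPf ji) addn0.
rewrite [RHS]/dpow_coef H mulrA; case: ifP => is_.
  have -> : add_idx (sh i u) l = add_idx u l.
    by apply/matrixP => j k; rewrite !mxE; case: eqVneq => [->|_]; rewrite ?is_ ?addn0.
  congr (_ * _); have := ex_gu u g l i; rewrite is_ addr0 => ->; by [].
have e : add_idx u (sh i l) = add_idx (sh i u) l.
  apply/matrixP => j k; rewrite !mxE; case: eqVneq => [->|_]; rewrite ?is_ ?addn0 //.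
  by rewrite addnAC addnA.
rewrite /dpow_coef e; congr (_ * _).
rewrite ex_Nsg ?is_ // !mxE is_ eqxx addn1 addnS -!natr1 natrD; ring.
Qed.

Lemma cu0 g c : dpow_coef 0 g c = c.
Proof.
apply/funext => l; rewrite /dpow_coef big1 => [|i _]; last by rewrite mxE falling0.
rewrite mulr1; congr c; apply/matrixP => j k; rewrite ord1 !mxE.
by case: ifP; rewrite addn0.
Qed.

Lemma gu0 g : dpow_exponent 0 g = g.
Proof.
by apply/funext => k; rewrite /dpow_exponent big1 ?subr0 // => i _; rewrite mxE mulr0.
Qed.

Lemma act_iter c g i t u f :
  cnv (dpow_coef u g c) -> feq f (Phi (dpow_coef u g c) (dpow_exponent u g)) ->
  let u' := iter t (sh i) u in
  cnv (dpow_coef u' g c) /\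
  feq (act vs (iter t (OMul (OD i)) (OCst 1)) f) (Phi (dpow_coef u' g c) (dpow_exponent u' g)).
Proof.
move=> hc hf /=; elim: t => [|t [IH1 IH2]].
  by split=> //= a aN x hx; rewrite mul1r hf.
rewrite !iterS -dcf_cu -gsub_gu; split; first exact: cnv_dcf.
apply: feq_trans (act_OD sub Rr0 qsg i (dpow_exponent (iter t (sh i) u) g) IH1).
exact: (act_feq (OD i) IH2).
Qed.

Lemma act_dpow a c g : cnv c ->
  feq (act vs (dpow R a) (Phi c g)) (Phi (dpow_coef a g c) (dpow_exponent a g)).
Proof.
move=> hc; rewrite /dpow.
(* The part of [a] whose derivatives have already been applied. *)
pose us (s : seq 'I_n) : idxT := \col_j (if j \in s then a j 0%R else 0%N).
suff H s : uniq s -> cnv (dpow_coef (us s) g c) /\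
    feq (act vs (\big[@OMul R n/OCst 1]_(i <- s) iter (a i 0%R) (OMul (OD i)) (OCst 1)) (Phi c g))
      (Phi (dpow_coef (us s) g c) (dpow_exponent (us s) g)).
  have [_] := H _ (index_enum_uniq 'I_n).
  rewrite (_ : us _ = a) //; apply/matrixP => j k.
  by rewrite ord1 mxE mem_index_enum.
elim: s => [_|i s IH /= /andP[iNs us_]].
  have -> : us [::] = 0 by apply/matrixP => j k; rewrite !mxE.
  rewrite cu0 gu0; split=> //; rewrite big_nil => b bN x hx /=.
  by rewrite mul1r.
have [h1 h2] := IH us_; rewrite big_cons.
have -> : us (i :: s) = iter (a i 0%R) (sh i) (us s).
  apply/matrixP => j k; rewrite ord1.
  have -> : iter (a i 0%R) (sh i) (us s) j 0 = (us s j 0%R + (if j == i then a i 0%R else 0))%N.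
    elim: (a i 0%R) => [|t IHt] /=; first by case: ifP; rewrite addn0.
    by rewrite mxE IHt; case: ifP => _; rewrite ?addn0 // -addnA addn1.
  rewrite !mxE inE; case: eqVneq => [->|ji] /=; last by rewrite addn0.
  by rewrite (negPf iNs) add0n.
exact: act_iter.
Qed.

Lemma act_box c g (u : 'cV[int]_n) : cnv c ->
  dpow_coef (pospart u) g c = dpow_coef (negpart u) g c ->
  dpow_exponent (pospart u) g = dpow_exponent (negpart u) g ->
  feq (act vs (box R u) (Phi c g)) (fun _ _ => 0).
Proof.
move=> hc e1 e2 a aN x hx /=.
by rewrite !act_dpow // e1 e2 mulN1r subrr.
Qed.

Lemma Phi_lin (J : Type) (s : seq J) (k : J -> C) (c : J -> idxT -> C) g a x :
  dom x -> (forall j, cnv (c j)) ->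
  Phi (fun l => \sum_(j <- s) k j * c j l) g a x = \sum_(j <- s) k j * Phi (c j) g a x.
Proof.
move=> hx hc; apply: hsum_tsum.
have := @hsum_sum R 'cV[nat]_n J s (fun j l => k j * slice vs a (fun l => c j l * \prod_i term_factor sg vs lg q g l i (x i 0)) l)
  (fun j => k j * Phi (c j) g a x).
have hs : forall j, hsum (fun l => k j * slice vs a (fun l => c j l * \prod_i term_factor sg vs lg q g l i (x i 0)) l)
   (k j * Phi (c j) g a x).
  move=> j; apply: hsumZ; have [K hK] := sel_absb sub Rr0 g a (hc j) hx.
  exact: absb_hsum hK.
move=> /(_ hs); congr hsum; apply/funext => l; rewrite /slice; case: ifP => _.
  by rewrite mulr_suml; apply: eq_bigr => j _; rewrite mulrA.
by rewrite big1 // => j _; rewrite mulr0.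
Qed.

(** The operator multiplies the coefficient of l by (A v)_i - b_i, v being the exponent. This is
    asked to vanish on the support of [c] only, as [exponent] is v^l for indices vanishing on sg. *)
Lemma act_euler d (A : 'M[int]_(d, n)) (b : 'cV[C]_d) i c g : cnv c ->
  (forall l, c l != 0 -> \sum_j (A i j)%:~R * ex g l j = b i 0) ->
  feq (act vs (euler A b i) (Phi c g)) (fun _ _ => 0).
Proof.
move=> hc he a aN x hx /=.
have -> : act vs (\big[@OAdd R n/OCst 0]_(j < n) OMul (OCst (A i j)%:~R) (OMul (OX j) (OD j)))
    (Phi c g) a x = \sum_j (A i j)%:~R * Phi (fun l => c l * ex g l j) g a x.
  elim: (index_enum 'I_n) => [|j s IH]; first by rewrite !big_nil /= mul0r.
  rewrite !big_cons /= IH; congr (_ * _ + _).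
  by have := act_OXD sub Rr0 j g hc aN hx.
rewrite -Phi_lin // => [|j]; last exact: cnv_ex.
have -> : (fun l : idxT => \sum_j (A i j)%:~R * (c l * ex g l j)) =
   (fun l => \sum_(j <- [:: tt]) b i 0 * c l).
  apply/funext => l; rewrite big_seq1.
  have [->|c0] := eqVneq (c l) 0; first by rewrite mulr0 big1 // => j _; rewrite mul0r mulr0.
  by rewrite -(he l c0) mulr_suml; apply: eq_bigr => j _; ring.
by rewrite Phi_lin // big_seq1; ring.
Qed.

End Words.

(** * The simplex sigma *)

Section Simplex.
Variables (R : realType) (d n : nat) (A : 'M[int]_(d, n)).
Local Notation C := (Cx R).
Variables (sg : {set 'I_n}) (hsg : #|sg| = d).
Hypothesis hdet : \det (Asub A hsg) != 0.
Local Notation sgi := (sg_index hsg).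

Lemma sgi_in j : sgi j \in sg.
Proof. by rewrite /sg_index; exact: enum_valP. Qed.

Lemma sgi_inj : injective sgi.
Proof. by move=> i j /enum_val_inj /cast_ord_inj. Qed.

Lemma sgi_ex i : i \in sg -> exists j, i = sgi j.
Proof.
move=> is_; exists (cast_ord hsg (enum_rank_in is_ i)).
by rewrite /sg_index cast_ordK enum_rankK_in.
Qed.

Section Emb.
Variable F : fieldType.
Implicit Type w : 'cV[F]_d.

Lemma emb_sgi w j : emb hsg w (sgi j) 0 = w j 0.
Proof.
rewrite mxE (bigD1 j) //= big1 ?addr0 // => k /andP[/eqP/sgi_inj ->].
by rewrite eqxx.
Qed.

Lemma emb_N w i : i \notin sg -> emb hsg w i 0 = 0.
Proof.
move=> is_; rewrite mxE big1 // => k /eqP ki.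
by rewrite -ki sgi_in in is_.
Qed.

Lemma embB w1 w2 : emb hsg (w1 - w2) = emb hsg w1 - emb hsg w2.
Proof.
apply/matrixP => i j; rewrite ord1 {j} [RHS]mxE [X in _ = _ + X]mxE.
case: (boolP (i \in sg)) => is_; last by rewrite !emb_N // subr0.
by have [j ->] := sgi_ex is_; rewrite !emb_sgi !mxE.
Qed.

Lemma mul_emb m (B : 'M[F]_(m, n)) w i :
  (B *m emb hsg w) i 0 = \sum_j B i (sgi j) * w j 0.
Proof.
rewrite mxE; under eq_bigr do rewrite mxE mulr_sumr.
rewrite (exchange_big_dep predT) //=; apply: eq_bigr => j _.
by rewrite (big_pred1 (sgi j)) // => k; rewrite eq_sym.
Qed.

Lemma Asub_emb w :
  map_mx (intr : int -> F) A *m emb hsg w = map_mx intr (Asub A hsg) *m w.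
Proof.
apply/matrixP => i j; rewrite ord1 mul_emb mxE.
by apply: eq_bigr => k _; rewrite !mxE.
Qed.

End Emb.

Lemma Asub_unit (F : numFieldType) :
  map_mx (intr : int -> F) (Asub A hsg) \in unitmx.
Proof. by rewrite unitmxE det_map_mx unitfE intr_eq0. Qed.

Lemma AinvE (F : numFieldType) m (B : 'M[F]_(d, m)) :
  map_mx intr (Asub A hsg) *m (Ainv A hsg F *m B) = B.
Proof. by rewrite mulmxA mulmxV ?mul1mx // Asub_unit. Qed.

Lemma AinvK (F : numFieldType) m (B : 'M[F]_(d, m)) :
  Ainv A hsg F *m (map_mx intr (Asub A hsg) *m B) = B.
Proof. by rewrite mulmxA mulVmx ?mul1mx // Asub_unit. Qed.

(** The matrix A_sg^-1 A, its rows placed at sg and completed by zero rows: the [q] of the preceding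
    sections. *)
Definition Ainv_entry (i j : 'I_n) : R := emb hsg (Ainv A hsg R *m acol R A j) i 0.

Lemma acol_sgi (F : fieldType) j :
  map_mx (intr : int -> F) (col (sgi j) A) = map_mx intr (Asub A hsg) *m delta_mx j 0.
Proof. by rewrite -colE -map_col; congr map_mx; apply/matrixP => i k; rewrite !mxE. Qed.

Lemma Ainv_entry_sg i j : i \in sg -> j \in sg -> Ainv_entry i j = (i == j)%:R.
Proof.
move=> /sgi_ex[i' ->] /sgi_ex[j' ->]; rewrite /Ainv_entry emb_sgi /acol acol_sgi AinvK mxE.
by rewrite andbT (inj_eq sgi_inj).
Qed.

Lemma Ainv_entry_N i j : i \notin sg -> Ainv_entry i j = 0.
Proof. exact: emb_N. Qed.

Lemma sum_sg (V : nmodType) (f : 'I_n -> V) : \sum_(i in sg) f i = \sum_j f (sgi j).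
Proof.
rewrite -(big_imset (h := sgi) (A := predT)) //=; last by move=> i j _ _; exact: sgi_inj.
apply: eq_bigl => i; apply/idP/imsetP => [/sgi_ex[j ->]|[j _ ->]]; first by exists j.
exact: sgi_in.
Qed.

Lemma Ainv_toC : Ainv A hsg C = map_mx (@toC R) (Ainv A hsg R).
Proof.
rewrite -[map_mx _ _]/(map_mx (real_complex R) _) /Ainv map_invmx; congr invmx.
apply/matrixP => i j.
by rewrite !mxE; exact/esym/toC_int.
Qed.

Definition base_exponent (b : 'cV[C]_d) (i : 'I_n) : C := emb hsg (Ainv A hsg C *m b) i 0.

Lemma vkE b l i : Nbar sg l -> vk A hsg b l i 0 = exponent sg Ainv_entry (base_exponent b) l i.
Proof.
move=> lN; rewrite /exponent /vk [LHS]mxE [map_mx _ _ _ _]mxE.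
have -> : toZ l i 0 = (l i 0%R)%:Z by rewrite mxE.
case: ifP => is_; last by rewrite emb_N ?is_ // addr0 -pmulrn.
rewrite lN // add0r /base_exponent; have [j ->] := sgi_ex is_; rewrite !emb_sgi mulmxBr.
rewrite [LHS]mxE; congr (_ + _); rewrite mxE; congr (- _).
rewrite map_mxM Ainv_toC mulmxA mxE.
rewrite (bigID (mem sg)) /= big1 ?add0r; last first.
  by move=> k ks; rewrite !mxE lN // mulr0.
apply: eq_bigr => k ks; congr (_ * _); last by rewrite !mxE -pmulrn.
rewrite /Ainv_entry emb_sgi !mxE toC_sum; apply: eq_bigr => m _.
by rewrite !mxE toCM toC_int.
Qed.

Lemma mul_vk (b : 'cV[C]_d) l : map_mx intr A *m vk A hsg b l = b.
Proof.
rewrite /vk mulmxDr Asub_emb AinvE map_mxM addrCA subrr addr0 //.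
Qed.

Lemma vk_um (b : 'cV[C]_d) k l : vk A hsg b k + um A hsg C (toZ l - toZ k) = vk A hsg b l.
Proof.
rewrite /vk /um [map_mx _ (toZ l - _)]map_mxB addrACA [map_mx _ (toZ k) + _]addrC subrK.
congr (_ + _); rewrite -embB -mulmxBr; congr (emb _ (_ *m _)).
by rewrite mulmxBr map_mxB opprB addrA subrK.
Qed.

Definition embZ (z : 'cV[int]_d) : 'cV[int]_n := \col_i \sum_(j | sgi j == i) z j 0.

Lemma Asub_embZ z : A *m embZ z = Asub A hsg *m z.
Proof.
apply/matrixP => i j; rewrite ord1 !mxE; under eq_bigr do rewrite mxE mulr_sumr.
rewrite (exchange_big_dep predT) //=; apply: eq_bigr => m _.
by rewrite (big_pred1 (sgi m)) ?mxE // => p; rewrite eq_sym.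
Qed.

Lemma embZ_sgi z j : embZ z (sgi j) 0 = z j 0.
Proof.
rewrite mxE (bigD1 j) //= big1 ?addr0 // => k /andP[/eqP/sgi_inj ->].
by rewrite eqxx.
Qed.

Lemma embZ_N z i : i \notin sg -> embZ z i 0 = 0.
Proof.
move=> is_; rewrite mxE big1 // => k /eqP ki.
by rewrite -ki sgi_in in is_.
Qed.

Lemma um_embZ k l z (F : numFieldType) : A *m (toZ l - toZ k) = Asub A hsg *m z ->
  um A hsg F (toZ l - toZ k) = map_mx intr (toZ l - toZ k - embZ z).
Proof.
move=> hz; rewrite /um hz map_mxM AinvK [in RHS]map_mxB; congr (_ - _).
apply/matrixP => i j; rewrite [LHS]mxE [RHS]mxE [embZ z i j]mxE [RHS]raddf_sum /=.
by apply: eq_bigr => m _; rewrite mxE.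
Qed.

(** On Lambda_k the vector u(m) is integral, as A_sg^-1 A m is. A single integral vector is produced
    for all fields because [coef] reads u(m) both over R and over C. *)
Lemma Lambda_int k l : Lambda A hsg k l -> exists z : 'cV[int]_n,
  A *m z = 0 /\ forall F : numFieldType, um A hsg F (toZ l - toZ k) = map_mx intr z.
Proof.
move=> [lN [z hz]]; exists (toZ l - toZ k - embZ z); split.
  by rewrite mulmxBr hz Asub_embZ subrr.
by move=> F; exact: um_embZ.
Qed.

End Simplex.

(** * The box identity for the coefficients *)

Lemma truncn_int (F : archiNumDomainType) (z : int) :
  Num.truncn (z%:~R : F) = if 0 <= z then `|z|%N else 0%N.
Proof.
case: z => m; first by rewrite -pmulrn natrK.
by apply/truncn0Pn; rewrite (_ : (1 : F) = 1%:~R) // ler_int.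
Qed.

Section Gam.
Variable R : realType.
Local Notation C := (Cx R).

Definition negint (w : C) : Prop := exists2 z : int, z < 0 & w = z%:~R.

(** If v - t < 0 <= v for an integer v, then the factor of index j = v + 1 in [falling v t] is
    zero. *)
Lemma falling_neg (v : C) t : falling v t != 0 -> negint (v - t%:R) -> negint v.
Proof.
move=> h [z z0 e]; exists (z + t%:Z); last by rewrite intrD -e -pmulrn subrK.
rewrite ltNge; apply/negP => zt.
move/negP: h; apply.
have [m em] : exists m : nat, z + t%:Z = m%:Z by exists (absz (z + t%:Z)); rewrite gez0_abs.
have mt : (m < t)%N by lia.
have ev : v = m%:R.
  by apply: (addIr (- t%:R)); rewrite e -[m%:R]/(m%:Z%:~R) -em intrD -pmulrn addrK.
apply/eqP; rewrite /falling (bigD1_seq m.+1) /= ?iota_uniq //.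
  by rewrite ev -natr1 opprD addrA subrr sub0r addNr mul0r.
by rewrite mem_index_iota /=; lia.
Qed.

(** A zero factor forces v in {0, ..., t-1}, so that v - t is a negative integer and v is not. *)
Lemma falling_neq0 (v : C) t : (negint v <-> negint (v - t%:R)) -> falling v t != 0.
Proof.
move=> h; rewrite /falling prodf_seq_neq0; apply/allP => j; rewrite mem_index_iota => /andP[j1 jt].
apply/implyP => _; apply/eqP => e.
have ev : v = (j.-1)%:R.
  have -> : v = v - j%:R + 1 + (j%:R - 1) by ring.
  by rewrite e add0r -[in LHS](prednK j1) -natr1 addrK.
have [z z0 ez] : negint v.
  apply/h; exists (j.-1%:Z - t%:Z); first by lia.
  by rewrite ev intrB -!pmulrn.
have : z%:~R = j.-1%:Z%:~R :> C by rewrite -ez ev -pmulrn.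
by move/intr_inj; lia.
Qed.

(* The contribution to [coef] of a coordinate with v^k_i = v and u(m)_i = z. *)
Definition gam (v : C) (z : int) : C :=
  if 0 <= z then (falling (v + z%:~R) `|z|)^-1 else falling v `|z|.

(** [gam v z] plays the role of Gamma(v+1) / Gamma(v+z+1), and the product telescopes. That v, v+z
    and v+z-p are negative integers together or not at all makes the cancelled factors nonzero. *)
Lemma gam_step (v : C) (z : int) (p : nat) :
  (negint v <-> negint (v + z%:~R)) -> (negint v <-> negint (v + z%:~R - p%:R)) ->
  gam v z * falling (v + z%:~R) p = gam v (z - p%:Z).
Proof.
move=> h1 h2; rewrite /gam.
have [z0|z0] := leP 0 z.
  have [m em] : exists m : nat, z = m%:Z by exists `|z|%N; rewrite gez0_abs.
  subst z; rewrite absz_nat -pmulrn in h1 h2 *.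
  have [pm|pm] := leP 0 (m%:Z - p%:Z).
    have e : (m = p + (m - p))%N by lia.
    have -> : m%:Z - p%:Z = (m - p)%:Z by lia.
    rewrite absz_nat -pmulrn.
    have -> : falling (v + m%:R) m = falling (v + m%:R) p * falling (v + (m - p)%:R) (m - p).
      have pm' : (p <= m)%N by lia.
      by rewrite natrB // addrA -fallingD subnKC.
    rewrite invfM mulrAC mulVf ?mul1r // falling_neq0 //.
    exact: iff_trans (iff_sym h1) h2.
  have e : (p = m + (p - m))%N by lia.
  have -> : absz (m%:Z - p%:Z) = (p - m)%N by lia.
  have -> : falling (v + m%:R) p = falling (v + m%:R) m * falling (v + m%:R - m%:R) (p - m).
    by rewrite -fallingD -e.
  rewrite addrK mulrA mulVf ?mul1r // falling_neq0 // addrK.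
  exact: iff_sym.
have -> : (0 <= z - p%:Z) = false by lia.
have -> : absz (z - p%:Z) = (absz z + p)%N by lia.
rewrite fallingD; congr (_ * falling _ _).
by rewrite {1}(_ : z = - (`|z|%N)%:Z) ?intrN -?pmulrn //; lia.
Qed.

Lemma gam_box (v w1 w2 : C) (z1 z2 : int) (s t : nat) :
  w1 = v + z1%:~R -> w2 = v + z2%:~R -> w1 - s%:R = w2 - t%:R ->
  s = 0%N \/ t = 0%N -> (negint v <-> negint w1) -> (negint v <-> negint w2) ->
  gam v z1 * falling w1 s = gam v z2 * falling w2 t.
Proof.
move=> -> -> sh st n1 n2.
have zz : z1 - s%:Z = z2 - t%:Z.
  apply: (@intr_inj C); apply: (addrI v).
  by rewrite !intrB -!pmulrn !addrA sh.
case: st => p0; subst; rewrite falling0 mulr1 ?subr0 in sh zz *.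
  by rewrite gam_step // -?zz ?subr0 // -sh.
by rewrite gam_step // ?zz ?subr0 // sh.
Qed.

End Gam.

Lemma nsupp_iff (R : realType) n (w1 w2 : 'cV[Cx R]_n) :
  nsupp w1 = nsupp w2 -> forall i, negint (w1 i 0) <-> negint (w2 i 0).
Proof. by move=> e i; change (nsupp w1 i <-> nsupp w2 i); rewrite e. Qed.

Lemma nsupp_eq (R : realType) n (w1 w2 : 'cV[Cx R]_n) :
  (forall i, negint (w1 i 0) -> negint (w2 i 0)) -> ~ (nsupp w1 `<` nsupp w2) ->
  nsupp w1 = nsupp w2.
Proof.
by move=> h1 h2; apply/seteqP; split=> //; apply: contrapT => h3; apply: h2; split.
Qed.

Section BoxIdentity.
Variables (R : realType) (d n : nat) (A : 'M[int]_(d, n)).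
Local Notation C := (Cx R).
Variables (sg : {set 'I_n}) (hsg : #|sg| = d).
Hypothesis hdet : \det (Asub A hsg) != 0.
Local Notation ex := (exponent sg (@Ainv_entry R d n A sg hsg)).
Local Notation gu := (dpow_exponent (@Ainv_entry R d n A sg hsg)).
Local Notation cu := (dpow_coef sg (@Ainv_entry R d n A sg hsg)).
Local Notation gb := (@base_exponent R d n A sg hsg).
Local Notation shu := (add_idx sg).
Implicit Types (b : 'cV[C]_d) (k l : 'cV[nat]_n) (u : 'cV[int]_n).

(** Extension by 0 from S_k, so that sums and shifts run over all indices. *)
Definition supp_coef b k l : C := if `[< Sk A hsg b k l >] then coef A hsg b k l else 0.

Lemma coefE b k l (z : 'cV[int]_n) :
  (forall F : numFieldType, um A hsg F (toZ l - toZ k) = map_mx intr z) ->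
  coef A hsg b k l = \prod_i gam (vk A hsg b k i 0) (z i 0).
Proof.
move=> hz; rewrite /coef /bracket !hz -prodf_div; apply: eq_bigr => i _.
rewrite /gam /negpart /pospart -/(falling _ _) -/(falling _ _) !mxE -intrN !truncn_int oppr_ge0.
case: (ltgtP 0 (z i 0)) => z0.
- by rewrite falling0 div1r.
- by rewrite falling0 divr1 abszN.
- by rewrite -z0 !falling0 divr1 invr1.
Qed.

Lemma vk_int b k l (z : 'cV[int]_n) :
  (forall F : numFieldType, um A hsg F (toZ l - toZ k) = map_mx intr z) ->
  vk A hsg b l = vk A hsg b k + map_mx intr z.
Proof. by move=> hz; rewrite -(vk_um A hsg b k l) hz. Qed.

Lemma vk_intE b k l (z : 'cV[int]_n) i :
  (forall F : numFieldType, um A hsg F (toZ l - toZ k) = map_mx intr z) ->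
  vk A hsg b l i 0 = vk A hsg b k i 0 + (z i 0)%:~R.
Proof.
by move=> hz; rewrite (vk_int b hz) [LHS]mxE; congr (_ + _); rewrite mxE.
Qed.

Lemma pnE u i : u i 0 = (pospart u i 0)%:Z - (negpart u i 0)%:Z.
Proof.
rewrite /negpart /pospart !mxE -[u i 0]intz -intrN !truncn_int oppr_ge0 ?intz.
by case: (ltgtP 0 (u i 0)) => z0; lia.
Qed.

Lemma pn0 u i : pospart u i 0 = 0%N \/ negpart u i 0 = 0%N.
Proof.
rewrite /negpart /pospart !mxE -[u i 0]intz -intrN !truncn_int oppr_ge0 ?intz.
by case: (ltgtP 0 (u i 0)) => z0; [right|left|left; rewrite -z0].
Qed.

Lemma gu_box g u : A *m u = 0 -> gu (pospart u) g = gu (negpart u) g.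
Proof.
move=> Au; apply/funext => j; rewrite /dpow_exponent; congr (_ - _).
apply/eqP; rewrite -subr_eq0 -sumrB; apply/eqP.
transitivity (toC (\sum_i Ainv_entry R A hsg j i * (u i 0)%:~R)).
  rewrite toC_sum; apply: eq_bigr => i _.
  by rewrite pnE intrB toCM toCB mulrBr -!pmulrn !toC_nat.
rewrite -toC0; congr toC.
case: (boolP (j \in sg)) => js; last by rewrite big1 // => i _; rewrite Ainv_entry_N // mul0r.
have [j' ->] := sgi_ex hsg js.
transitivity ((Ainv A hsg R *m (map_mx intr (A *m u))) j' 0).
  rewrite map_mxM mulmxA mxE; apply: eq_bigr => i _.
  rewrite /Ainv_entry emb_sgi; congr (_ * _); last by rewrite mxE.
  by rewrite !mxE; apply: eq_bigr => m _; rewrite !mxE.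
by rewrite Au map_mx0 mulmx0 mxE.
Qed.

Lemma shu_N (u l : 'cV[nat]_n) : Nbar sg l -> Nbar sg (shu u l).
Proof. by move=> lN i is_; rewrite mxE is_ addn0 lN. Qed.

Lemma shu_Nr (u l : 'cV[nat]_n) : Nbar sg (shu u l) -> Nbar sg l.
Proof. by move=> lN i is_; have := lN i is_; rewrite mxE is_ addn0. Qed.

Section Pair.
Variables (b : 'cV[C]_d) (l : 'cV[nat]_n) (u : 'cV[int]_n).
Hypothesis lN : Nbar sg l.
Hypothesis Au : A *m u = 0.
(** The terms of index [l1] and [l2] are those that d^(u_+) and d^(u_-) send to one and the same
    monomial. *)
Let l1 := shu (pospart u) l.
Let l2 := shu (negpart u) l.

Lemma box_shift i :
  vk A hsg b l1 i 0 - (pospart u i 0%R)%:R = vk A hsg b l2 i 0 - (negpart u i 0%R)%:R.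
Proof.
have h1 := @vkE R d n A sg hsg b _ i (@shu_N (pospart u) l lN).
have h2 := @vkE R d n A sg hsg b _ i (@shu_N (negpart u) l lN).
suff h : ex (gb b) l1 i - (pospart u i 0%R)%:R = ex (gb b) l2 i - (negpart u i 0%R)%:R.
  exact: (etrans (congr1 (+%R^~ _) h1) (etrans h (esym (congr1 (+%R^~ _) h2)))).
have e1 := ex_gu (Ainv_entry_sg R hdet) (pospart u) (gb b) l i.
have e2 := ex_gu (Ainv_entry_sg R hdet) (negpart u) (gb b) l i.
rewrite -(gu_box _ Au) in e2; move: e1 e2; rewrite /l1 /l2.
case: ifP => is_; first by rewrite !addr0 => <-.
rewrite !subr0 => _ _; rewrite !ex_Nsg ?is_ // !mxE is_ !natrD; ring.
Qed.

Lemma Lambda_other k : Lambda A hsg k l1 -> Lambda A hsg k l2.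
Proof.
move=> [_ [z hz]]; split; first exact: shu_N.
exists (z + \col_j u (sg_index hsg j) 0).
rewrite [RHS]mulmxDr -hz -Asub_embZ -mulmxDr.
have -> : toZ l2 - toZ k = (toZ l1 - toZ k + embZ hsg (\col_j u (sg_index hsg j) 0)) - u.
  have ei i : embZ hsg (\col_j u (sg_index hsg j) 0) i 0 = if i \in sg then u i 0 else 0.
    case: (boolP (i \in sg)) => [/(sgi_ex hsg)[m ->]|/embZ_N -> //].
    by rewrite embZ_sgi mxE.
  apply/matrixP => i j; rewrite ord1; have := ei i; move: (embZ _ _) => E.
  rewrite !mxE => ->; have := pnE u i; rewrite !mxE.
  by move: (Num.truncn _) (Num.truncn _) => s t -> ; case: ifP => _; rewrite !PoszD; ring.
by rewrite mulmxBr Au subr0.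
Qed.

(* A box operator that leads out of S_k would shrink the negative support, unless
   one of the falling factorials vanishes. *)
Lemma box_zero k : min_neg_support A (vk A hsg b k) ->
  Sk A hsg b k l1 -> ~ Sk A hsg b k l2 ->
  \prod_i falling (vk A hsg b l1 i 0) (pospart u i 0%R) = 0.
Proof.
move=> hmin [L1 S1] nS2; apply/eqP; apply: contraPT nS2 => /prodf_neq0 h; apply.
have L2 := Lambda_other L1; split; first exact: L2.
apply: nsupp_eq.
  (* If v(l2)_i is a negative integer then so is v(l2)_i - (u_-)_i = v(l1)_i - (u_+)_i; as the
     falling factorial is nonzero, v(l1)_i is one too. *)
  move=> i [z z0 ez]; apply: (proj1 (nsupp_iff S1 i)).
  apply: (falling_neg (h i isT)).
  exists (z - (negpart u i 0%R)%:Z); first by lia.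
  by rewrite box_shift ez intrB -!pmulrn.
move=> lt; apply: hmin.
have [z [Az hz]] := Lambda_int hdet L2; exists z; first exact: Az.
by rewrite -(vk_int b hz).
Qed.

End Pair.

Lemma supp_coef_N b k l : ~ Nbar sg l -> supp_coef b k l = 0.
Proof. by move=> nN; rewrite /supp_coef asboolF // => -[[/nN]]. Qed.

Lemma supp_coef_T b k l : Sk A hsg b k l -> supp_coef b k l = coef A hsg b k l.
Proof. by move=> h; rewrite /supp_coef asboolT. Qed.

Lemma supp_coef_F b k l : ~ Sk A hsg b k l -> supp_coef b k l = 0.
Proof. by move=> h; rewrite /supp_coef asboolF. Qed.

Lemma vk_ex b l (u : 'cV[nat]_n) i : Nbar sg l -> ex (gb b) (shu u l) i = vk A hsg b (shu u l) i 0.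
Proof. by move=> lN; rewrite (@vkE R d n A sg hsg b _ i (@shu_N _ l lN)). Qed.

(** If both indices lie in S_k, the identity is the coordinatewise [gam_box], whose condition that s
    or t be 0 is the disjointness of the supports of u_+ and u_-. If only one does, its side
    vanishes by [box_zero], used for u or for -u; otherwise both sides are 0. *)
Lemma cu_box b k u : min_neg_support A (vk A hsg b k) -> A *m u = 0 ->
  cu (pospart u) (gb b) (supp_coef b k) = cu (negpart u) (gb b) (supp_coef b k).
Proof.
move=> hmin Au; apply/funext => l; rewrite /dpow_coef.
have [lN|lN] := pselect (Nbar sg l); last first.
  by rewrite !supp_coef_N ?mul0r // => /shu_Nr.
under eq_bigr do rewrite vk_ex //; under [in RHS]eq_bigr do rewrite vk_ex //.
have Au' : A *m - u = 0 by rewrite mulmxN Au oppr0.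
have [S1|S1] := pselect (Sk A hsg b k (shu (pospart u) l)); [
  rewrite [supp_coef b k (shu (pospart u) l)](supp_coef_T S1)|
  rewrite [supp_coef b k (shu (pospart u) l)](supp_coef_F S1)];
have [S2|S2] := pselect (Sk A hsg b k (shu (negpart u) l)); try (
  rewrite [supp_coef b k (shu (negpart u) l)](supp_coef_T S2)); try (
  rewrite [supp_coef b k (shu (negpart u) l)](supp_coef_F S2)).
- have [z1 [_ hz1]] := Lambda_int hdet S1.1; have [z2 [_ hz2]] := Lambda_int hdet S2.1.
  rewrite (coefE b hz1) (coefE b hz2) -!big_split /=; apply: eq_bigr => i _.
  exact: (gam_box (vk_intE b i hz1) (vk_intE b i hz2) (box_shift b lN Au i) (pn0 u i)
    (nsupp_iff (esym S1.2) i) (nsupp_iff (esym S2.2) i)).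
- rewrite mul0r; apply/eqP; rewrite mulf_eq0; apply/orP; right; apply/eqP.
  exact: (box_zero lN Au hmin S1 S2).
- rewrite mul0r; apply/esym/eqP; rewrite mulf_eq0; apply/orP; right; apply/eqP.
  have := @box_zero b l (- u) lN Au' k hmin; rewrite /negpart opprK => H.
  exact: (H S2 S1).
- exact: (etrans (mul0r _) (esym (mul0r _))).
Qed.

End BoxIdentity.

(** * phi is a Gevrey solution of order s *)

(** [M j] is the sum over the fibre of [key] at j; the fibre sums add up to at most K. This turns
    absolute summability over all l into a majorant indexed by the formal variables. *)
Lemma rsum_fibers (R : realType) (I J : choiceType) (D : set J) (G : I -> R) (key : I -> J) (K : R) :
  (forall i, 0 <= G i) -> (forall B : {fset I}, \sum_(i <- B) G i <= K) ->
  exists2 M : J -> R, summable D (fun j => (M j)%:E) &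
    forall j (B : {fset I}), \sum_(i <- B | key i == j) G i <= M j.
Proof.
move=> G0 GK.
pose S j := (\esum_(i in key @^-1` [set j]) (G i)%:E)%E.
have p0 i : (0 <= (G i)%:E)%E by rewrite lee_fin.
have SK : (\esum_(j in setT) S j <= K%:E)%E.
  rewrite /S (esum_esum (a := fun j i => (G i)%:E)) //.
  rewrite (@reindex_esum R I (J * I)%type setT _ (fun i => (key i, i))) //; last first.
    split.
    - by move=> i _ /=.
    - by move=> i j _ _ [].
    - by move=> [j i] [_ /= <-]; exists i.
  apply: ge_ereal_sup => _ [A [fA _] <-].
  by rewrite fsbig_finite //= sumEFin lee_fin.
have S0 j : (0 <= S j)%E by exact: esum_ge0.
have Sj j : (S j <= K%:E)%E.
  apply: le_trans SK; rewrite -(@esum_set1 R J j S (S0 j)).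
  by rewrite [leLHS]esum_mkcond; apply: le_esum => i _; case: ifP.
have fS j : S j \is a fin_num.
  by rewrite ge0_fin_numE //; apply: le_lt_trans (Sj j) _; exact: ltry.
exists (fun j => fine (S j)).
  apply: (@le_lt_trans _ _ K%:E); last exact: ltry.
  apply: le_trans SK; rewrite esum_mkcond; apply: le_esum => j _.
  by case: ifP => _ //; rewrite fineK // gee0_abs.
move=> j B; rewrite -lee_fin fineK // -sumEFin /S.
apply: ereal_sup_ubound; exists ([set` B] `&` key @^-1` [set j]).
  by split; [exact: finite_setIl|exact: subIsetr].
rewrite fsbig_finite /=; last exact: finite_setIl.
rewrite -[RHS]big_filter; apply: perm_big; apply: uniq_perm.
- exact: fset_uniq.
- exact: filter_uniq.
move=> i; rewrite in_fset_set; last exact: finite_setIl.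
rewrite mem_filter; apply/idP/andP => [/set_mem[/= iB /eqP ij]|[/eqP ij iB]] //.
by apply/mem_set; split.
Qed.

(** With x = B^(1/e) this is x^l <= exp(x) l!, one term of the exponential series, raised to the
    power e. *)
Lemma pow_le_fact (R : realType) (B e : R) : 0 < B -> 0 < e ->
  exists2 D, 0 < D & forall l : nat, B ^+ l <= D * l`!%:R `^ e.
Proof.
move=> B0 e0; pose x := B `^ e^-1; have x0 : 0 <= x by exact: powR_ge0.
exists ((expR x) `^ e); first by rewrite powR_gt0 // expR_gt0.
move=> l; rewrite -powRM ?expR_ge0 //.
have -> : B ^+ l = (x ^+ l) `^ e.
  rewrite -[x ^+ l]powR_mulrn // -[RHS]powRrM /x -[RHS]powRrM.
  rewrite -[LHS]powR_mulrn ?(ltW B0) //; congr (_ `^ _).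
  by field; rewrite lt0r_neq0.
apply: ge0_ler_powR; rewrite ?nnegrE ?(ltW e0) ?exprn_ge0 ?mulr_ge0 ?expR_ge0 //.
case: l => [|l].
  by rewrite expr0 fact0 mulr1; apply: le_trans (expR_ge1Dx x); rewrite lerDl.
rewrite -ler_pdivrMr ?ltr0n ?fact_gt0 //.
by apply: le_trans (expR_ge1Dxn l x0); rewrite lerDr.
Qed.

Lemma powR_prod (R : realType) (I : Type) (s : seq I) (P : pred I) (f : I -> R) (e : R) :
  (forall i, 0 <= f i) -> \prod_(i <- s | P i) f i `^ e = (\prod_(i <- s | P i) f i) `^ e.
Proof.
move=> f0; elim: s => [|i s IH]; first by rewrite !big_nil powR1.
by rewrite !big_cons; case: ifP => // _; rewrite IH powRM // prodr_ge0.
Qed.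

Section Solution.
Variables (R : realType) (d n : nat) (A : 'M[int]_(d, n)).
Local Notation C := (Cx R).
Variables (sg : {set 'I_n}) (hsg : #|sg| = d).
Hypothesis hdet : \det (Asub A hsg) != 0.
Variable r : R.
Hypothesis hr : convergence_bound A hsg r.
Variable s : R.
Hypothesis hs : forall i, i \notin sg -> slope R A hsg i <= s.
Variables (b : 'cV[C]_d) (k : 'cV[nat]_n).
Hypothesis kN : Nbar sg k.
Variable vs : {set 'I_n}.
Hypothesis sub : sg \subset vs.
Hypothesis hvs : [set` vs] `<=` tau R A hsg.
Variable p : 'cV[C]_n.
Hypothesis hp : (Yplane vs `&` Usg A hsg r) p.
Variable lg : 'I_n -> C -> C.
Hypothesis hlg : forall i, i \in sg -> log_branch (p i 0) (lg i).

Local Notation q := (@Ainv_entry R d n A sg hsg).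
Local Notation g := (@base_exponent R d n A sg hsg b).
Local Notation c := (@supp_coef R d n A sg hsg b k).
Local Notation f := (phi A hsg vs lg b k).

(* |x_j x_sg^(-A_sg^-1 a_j)|, computed with the branches lg. *)
Definition ymod (x : 'cV[C]_n) (j : 'I_n) : R :=
  cmod (x j 0) * expR (- \sum_(i in sg) q i j * re (lg i (x i 0))).

(* At slopes below 1 the term_factor l_j!^(1 - slope) makes every radius admissible. *)
Definition radius (j : 'I_n) : R :=
  if j \in vs then (if slope R A hsg j == 1 then r else ymod p j + 1) else r.

Lemma r_gt0 : 0 < r. Proof. by case: hr. Qed.

Lemma ymod_ge0 x j : 0 <= ymod x j.
Proof. by rewrite mulr_ge0 ?cmod_ge0 ?expR_ge0. Qed.

Lemma Rr0 j : j \notin sg -> 0 < radius j.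
Proof.
have := r_gt0 => r0 _; rewrite /radius; case: ifP => // _; case: ifP => // _.
by rewrite ltr_wpDl // ymod_ge0.
Qed.

Lemma slope_le1 j : j \in vs -> slope R A hsg j <= 1.
Proof.
move=> jv; have := hvs jv; rewrite /tau /Hsg_plus /= => h.
by rewrite leNgt; apply/negP.
Qed.

Lemma p_sg i : i \in sg -> cmod (p i 0) = expR (re (lg i (p i 0))).
Proof. by move=> is_; rewrite -cmod_cexp; have [-> _] := nbhs_singleton (hlg is_). Qed.

Lemma ymod_Rr j : j \notin sg -> ymod p j < radius j.
Proof.
move=> js; rewrite /radius; case: ifP => [jv|/negbT jv]; last first.
  by rewrite /ymod (hp.1 j jv) cmod0 mul0r r_gt0.
case: eqP => [s1|_]; last by rewrite ltrDl.
have := hp.2.2 j js s1; rewrite /ymod -ltr_pdivlMr ?expR_gt0 //.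
rewrite expRN invrK expR_sum; congr (_ < _ * _); apply: eq_bigr => i is_.
by rewrite p_sg // -expRM mulrC.
Qed.

Lemma dom_p : branch_domain sg vs lg q radius p.
Proof. by split=> // j js _; exact: ymod_Rr. Qed.

Lemma termE x a l :
  patch (fun=> 0) (phi_index A hsg vs b k a) (fun l => phi_term A hsg vs lg b k l x) l =
  slice vs a (fun l => c l * \prod_i term_factor sg vs lg q g l i (x i 0)) l.
Proof.
rewrite /patch /slice; case: (boolP (agree_off vs a l)) => al; last first.
  rewrite memNset // => -[_ h]; move/negP: al; apply.
  by apply/forallP => i; apply/implyP => iv; apply/eqP; exact: h.
have [S1|S1] := pselect (Sk A hsg b k l); last first.
  by rewrite memNset ?(supp_coef_F S1) ?mul0r // => -[/S1].
rewrite mem_set; last by split=> // i iv; exact: (idxE al).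
rewrite (supp_coef_T S1) /phi_term -mulrA; congr (_ * _).
rewrite [RHS](bigID (mem sg)) /=; congr (_ * _).
  apply: eq_bigr => i is_; rewrite /term_factor is_.
  by rewrite (vk_um A hsg b k l) (@vkE R d n A sg hsg b l i S1.1.1).
rewrite [RHS](bigID (mem vs)) /= [X in _ * X]big1 ?mulr1; last first.
  by move=> i /andP[/negPf is_ /negPf iv]; rewrite /term_factor is_ iv.
apply: eq_big => [i|i]; first by rewrite finset.in_setD.
by rewrite finset.in_setD => /andP[/negPf is_ iv]; rewrite /term_factor is_ iv.
Qed.

Lemma phiE : f = slice_series sg vs lg q c g.
Proof.
apply/funext => a; apply/funext => x; rewrite /phi /csum /slice_series /tsum.
by congr summability.sum; apply/funext => l; exact: termE.
Qed.

(** The Gevrey weight (a!)^(1-s) read on a full index l; it sees only the coordinates outside vs and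
    is constant on slices. *)
Definition gw (l : 'cV[nat]_n) : R := \prod_(j | j \notin vs) (l j 0%R)`!%:R `^ (1 - s).

Lemma gw_gt0 l : 0 < gw l.
Proof. by apply: prodr_gt0 => j _; rewrite powR_gt0 // ltr0n fact_gt0. Qed.

(** Comparison with the majorant of [convergence_bound], coordinate by coordinate. Outside vs, slope
    <= s gives l!^(1-s) <= l!^(1-slope). In vs at slope 1 both radii agree. In vs below slope 1, the
    radius r/2, an arbitrary choice below r, suffices by [pow_le_fact]. *)
Lemma total_bound rho : is_polyradius sg radius rho ->
  exists K, absb (fun l => c l * toC (weight sg rho l * gw l)) K.
Proof.
move=> hrho; have r0 := r_gt0.
pose rho' j := if (j \in vs) && (slope R A hsg j != 1) then r / 2 else rho j.
have hrho' j : j \notin sg -> cmod (toC (rho' j)) < r.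
  move=> js; rewrite cmod_toC /rho'; have /andP[a0 a1] := hrho j js.
  case: ifP => [_|h]; first by rewrite ger0_norm ?divr_ge0 ?ltW //; lra.
  rewrite ger0_norm ?ltW //; apply: lt_le_trans a1 _; rewrite /radius.
  by move: h; case: ifP => //= _; case: ifP.
have hy j : j \notin sg -> cmod ((\col_j toC (rho' j) : 'cV[C]_n) j 0) < r.
  by move=> js; rewrite mxE; exact: hrho'.
have /abs_summableP[K hK] := hr.2 b k kN _ hy.
have /choice[D hD] j : exists D, 0 <= D /\ (j \notin sg -> forall l : nat,
    rho j ^+ l * (if j \in vs then 1 else l`!%:R `^ (1 - s)) <=
    D * (l`!%:R `^ (1 - slope R A hsg j) * rho' j ^+ l)).
  case: (boolP (j \in sg)) => js; first by exists 0.
  have /andP[a0 a1] := hrho j js.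
  rewrite /rho'; case: (boolP (j \in vs)) => jv /=; last first.
    exists 1; split=> // _ l; rewrite mul1r [leLHS]mulrC ler_wpM2r ?exprn_ge0 ?(ltW a0) //.
    by rewrite ler_powR ?lerD2l ?lerN2 ?hs // ler1n fact_gt0.
  case: eqP => [s1|/eqP s1] /=.
    by exists 1; split=> // _ l; rewrite s1 subrr powRr0 mulr1 !mul1r.
  have s1' : 0 < 1 - slope R A hsg j by rewrite subr_gt0 lt_neqAle s1 slope_le1.
  have B0 : 0 < rho j / (r / 2) by rewrite !divr_gt0.
  have [D D0 hD] := pow_le_fact B0 s1'.
  exists D; split; first exact: ltW.
  move=> _ l; rewrite mulr1 mulrA -ler_pdivrMr ?exprn_gt0 ?divr_gt0 //.
  by rewrite -expr_div_n.
pose DD := \prod_(j | j \notin sg) D j.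
exists (cmod (toC DD) * K); have := absbZ (toC DD) hK; move=> h; apply: absb_le h => l.
rewrite /patch; have [S1|S1] := pselect (Sk A hsg b k l); last first.
  by rewrite (supp_coef_F S1) mul0r cmod0 cmod_ge0.
rewrite mem_set // (supp_coef_T S1).
have hF : weight sg rho l * gw l <= DD * (\prod_(i | i \notin sg)
    ((l i 0%R)`!)%:R `^ (1 - slope R A hsg i) * \prod_(i | i \notin sg) rho' i ^+ l i 0%R).
  have -> : gw l = \prod_(j | j \notin sg) (if j \in vs then 1 else (l j 0%R)`!%:R `^ (1 - s)).
    rewrite [RHS](bigID (mem vs)) /= [X in X * _]big1 ?mul1r; last by move=> j /andP[_ ->].
    apply: eq_big => [j|j /negPf -> //].
    by case: (boolP (j \in vs)) => jv; rewrite /= ?andbF // (notin_sub sub).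
  rewrite /weight /DD -!big_split /=; apply: ler_prod => j js.
  have /andP[a0 a1] := hrho j js; have [_ /(_ js) h] := hD j.
  rewrite h andbT mulr_ge0 ?exprn_ge0 ?(ltW a0) //.
  by case: ifP => // _; exact: powR_ge0.
have P0 : 0 <= \prod_(i | i \notin sg) ((l i 0%R)`!)%:R `^ (1 - slope R A hsg i).
  by apply: prodr_ge0 => j _; exact: powR_ge0.
have W0 : 0 <= weight sg rho l * gw l by rewrite mulr_ge0 ?ltW ?gw_gt0 ?(wt_gt0 l hrho).
have D0 : 0 <= DD by apply: prodr_ge0 => j _; case: (hD j).
have r0' : 0 <= \prod_(i | i \notin sg) rho' i ^+ l i 0%R.
  apply: prodr_ge0 => j js; rewrite exprn_ge0 // /rho'.
  by case: ifP => _; [rewrite divr_ge0 ?ltW|have /andP[/ltW] := hrho j js].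
have -> : \prod_(i | i \notin sg) (\col_j toC (rho' j)) i 0 ^+ l i 0 =
    toC (\prod_(i | i \notin sg) rho' i ^+ l i 0%R) :> C.
  rewrite (big_morph _ (@toCM R) (@toC1 R)); apply: eq_bigr => j _.
  by rewrite mxE toCX.
move: hF P0 r0'; set PP := \prod_(i | _) _ `^ _; set QQ := \prod_(i | _) rho' i ^+ _.
move=> hF P0 r0'; move: (coef A hsg b k l) => cf.
rewrite (_ : toC DD * (cf * toC PP * toC QQ) = cf * toC (DD * (PP * QQ))); last first.
  by rewrite !toCM; ring.
rewrite !cmodM ler_wpM2l ?cmod_ge0 // !cmod_toC.
by rewrite !ger0_norm // !mulr_ge0.
Qed.

Lemma gw_idx a l : agree_off vs a l -> gw l = gw a.
Proof. by move=> al; apply: eq_bigr => j jv; rewrite (idxE al jv). Qed.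

Lemma cnv_c : slices_summable sg vs radius c.
Proof.
move=> rho hrho a; have [K hK] := total_bound hrho.
exists (cmod (toC (gw a)^-1) * K).
have h := absbZ (toC (gw a)^-1) hK; apply: absb_le h => l.
rewrite /slice; case: ifP => al; last by rewrite cmod0 cmod_ge0.
rewrite (gw_idx al) toCM [X in _ <= cmod X](_ : _ = c l * toC (weight sg rho l)) //.
rewrite toCV; field.
by rewrite -toC0 (inj_eq (@toC_inj R)) lt0r_neq0 // gw_gt0.
Qed.

Lemma near_dom : \forall x \near p, branch_domain sg vs lg q radius x.
Proof. exact: dom_open dom_p. Qed.

Lemma phi_is_defined : phi_defined A hsg vs lg b k p.
Proof.
apply: filterS near_dom => x hx a aN; apply/abs_summableP.
have [K hK] := sel_absb sub Rr0 g a cnv_c hx.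
by exists K; apply: absb_le hK => l; rewrite termE.
Qed.

Lemma phi_formal : formal_germ vs p f.
Proof.
rewrite phiE; split.
  move=> a x y aN xy; rewrite /slice_series; congr tsum; apply/funext => l.
  rewrite /slice; case: ifP => // _; congr (_ * _); apply: eq_bigr => i _.
  rewrite /term_factor; case: ifP => is_; first by rewrite xy // (fintype.subsetP sub).
  by case: ifP => // iv; rewrite xy.
apply: filterS near_dom => x hx a aN.
by have [] := Phi_diff sub Rr0 g a cnv_c hx.
Qed.

Lemma phi_solution : min_neg_support A (vk A hsg b k) -> hyp_solution A b vs p f.
Proof.
move=> hmin; split; first exact: phi_formal.
move=> P hP; suff h : series_eq sg vs lg q radius (act vs P f) (fun _ _ => 0).
  by apply: filterS near_dom => x hx a aN; exact: h.
rewrite phiE; elim: hP => [u Au|i|P1 P2 _ IH1 _ IH2|P1 P2 _ IH] /=.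
- apply: (act_box sub Rr0 (Ainv_entry_sg R hdet) cnv_c); first exact: cu_box.
  exact: gu_box.
- apply: (act_euler sub Rr0 cnv_c) => l cl.
  have lN : Nbar sg l by apply: contrapT => nN; move/eqP: cl; apply; exact: supp_coef_N.
  rewrite -[in RHS](mul_vk hdet b l) mxE; apply: eq_bigr => j _.
  by rewrite (@vkE R d n A sg hsg b l j lN) mxE.
- by move=> a aN x hx /=; rewrite IH1 // IH2 // addr0.
- have := act_feq P1 IH; rewrite act_cst0; exact.
Qed.

(** Near p the term of index l, with weight and formal monomial included, is at most E |c l| rho^l
    gw(l), a summable family; grouping it by formal index with [rsum_fibers] gives the required
    majorant. *)
Lemma gevrey_phi : gevrey_order vs p s f.
Proof.
split; first exact: phi_formal.
pose rho j := (ymod p j + radius j) / 2.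
have yR := ymod_Rr; have R0 := Rr0.
have hrho : is_polyradius sg radius rho.
  move=> j js; have := yR j js; have := R0 j js; have := ymod_ge0 p j; rewrite /rho => *.
  by apply/andP; split; lra.
have [K hK] := total_bound hrho.
(* With all variables counted as analytic, formal ones included, p still lies in the domain, and
   |y_j(x)| < rho_j holds near p for every j outside sg. *)
have domT : branch_domain sg [set: 'I_n] lg q rho p.
  by split=> // j js _; have := yR j js; rewrite -/(ymod p j) /rho; lra.
have ndom := dom_open domT.
(* Bounds |x_sg^g| near p; the 1 leaves room for x to move. *)
pose E := \prod_(i in sg) expR (re (g i * lg i (p i 0)) + 1).
have nE : \forall x \near p, forall i, i \in sg ->
    re (g i * lg i ((x : 'cV[C]_n) i 0)) < re (g i * lg i (p i 0)) + 1.
  have H (i : 'I_n) : \forall x \near p, i \in sg ->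
      re (g i * lg i ((x : 'cV[C]_n) i 0)) < re (g i * lg i (p i 0)) + 1.
    case: (boolP (i \in sg)) => is_; last by apply: filterE.
    have cl : {for p i 0, continuous (fun z => re (g i * lg i z))}.
      apply: (@continuous_comp _ _ _ (fun z => g i * lg i z)); last exact: re_continuous.
      apply: continuousM; first exact: cst_continuous.
      by have [] := nbhs_singleton (hlg is_).
    have H2 : \forall z \near p i 0, re (g i * lg i z) < re (g i * lg i (p i 0)) + 1.
      by apply: (cvgr_lt _ cl); rewrite ltrDl.
    by apply: filterS (near_coord H2) => x hx _.
  exact: (@filter_forall _ 'I_n _ (nbhs p) _ H).
pose key (l : 'cV[nat]_n) : 'cV[nat]_n := \col_j (if j \in vs then 0%N else l j 0%R).
pose G l := E * cmod (c l * toC (weight sg rho l * gw l)).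
have E0 : 0 <= E by apply: prodr_ge0 => i _; exact: expR_ge0.
have GK (B : {fset 'cV[nat]_n}) : \sum_(l <- B) G l <= E * K.
  by rewrite -mulr_sumr ler_wpM2l.
have G0 l : 0 <= G l by rewrite mulr_ge0 ?cmod_ge0.
have [M Ms hM] := @rsum_fibers R _ _ (Nbar vs) G key _ G0 GK.
exists M => //.
apply: filterS3 near_dom ndom nE => x hx [_ hxr] hxE a aN.
have keyE l : agree_off vs a l -> key l == a.
  move=> al; apply/eqP/matrixP => j m; rewrite ord1 mxE.
  by case: ifP => [/aN->//|/negbT jv]; rewrite (idxE al jv).
have mf : (mfact a)%:R `^ (1 - s) = gw a :> R.
  rewrite /mfact natr_prod -powR_prod; last by move=> *.
  rewrite (bigID (mem vs)) /= [X in X * _]big1 ?mul1r // => j jv.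
  by rewrite aN // fact0 powR1.
rewrite phiE mf; set mono := monomial x a.
have [K1 hK1] := sel_absb sub Rr0 g a cnv_c hx.
rewrite /slice_series -mulrA mulrC -(tsumZ _ hK1); apply: absb_tsum_le => B.
apply: le_trans (hM a B); rewrite [leRHS]big_mkcond /=; apply: ler_sum => l _.
rewrite /slice; case: (boolP (agree_off vs a l)) => al; last first.
  by rewrite mulr0 cmod0; case: ifP.
rewrite keyE // /G (gw_idx al).
have -> : toC (gw a) * mono * (c l * \prod_i term_factor sg vs lg q g l i (x i 0)) =
  c l * toC (gw a) * (mono * \prod_i term_factor sg vs lg q g l i (x i 0)) by ring.
have -> : c l * toC (weight sg rho l * gw a) = c l * toC (gw a) * toC (weight sg rho l).
  by rewrite toCM; ring.
rewrite !cmodM [leRHS]mulrCA ler_wpM2l ?mulr_ge0 ?cmod_ge0 //.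
rewrite [X in _ <= E * X]cmod_toC ger0_norm ?(ltW (wt_gt0 l hrho)) //.
rewrite /mono /monomial !cmod_prod -big_split /=.
have mE : \prod_i (cmod (x i 0 ^+ a i 0) * cmod (term_factor sg vs lg q g l i (x i 0))) =
   \prod_(i in sg) expR (re (g i * lg i (x i 0))) * \prod_(j | j \notin sg) ymod x j ^+ l j 0%R.
  rewrite (bigID (mem sg)) /=.
  have -> : \prod_(i in sg) (cmod (x i 0 ^+ a i 0) * cmod (term_factor sg vs lg q g l i (x i 0))) =
     \prod_(i in sg) expR (re (g i * lg i (x i 0))) *
     \prod_(j | j \notin sg) expR (- \sum_(i in sg) q i j * re (lg i (x i 0))) ^+ l j 0%R.
    transitivity (\prod_(i in sg) (expR (re (g i * lg i (x i 0))) *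
       \prod_(j | j \notin sg) expR (- (q i j * re (lg i (x i 0)))) ^+ l j 0%R)).
      apply: eq_bigr => i is_; rewrite aN ?(fintype.subsetP sub) // expr0 cmod1 mul1r.
      rewrite /term_factor is_ cmod_cexp /exponent is_ mulrBl reD expRD reN; congr (_ * _).
      rewrite mulr_suml re_sum -sumrN expR_sum; apply: eq_bigr => j _.
      by rewrite -mulrA reMl -toC_nat reMl -expRM_natl; congr expR; ring.
    rewrite big_split /= exchange_big /=; congr (_ * _); apply: eq_bigr => j _.
    by rewrite prodrXl -expR_sum sumrN.
  rewrite -mulrA -big_split /=; congr (_ * _); apply: eq_bigr => j js.
  rewrite /ymod exprMn mulrC; congr (_ * _); rewrite /term_factor (negPf js) cmodX.
  case: ifP => jv; first by rewrite aN // expr0 mul1r cmodX.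
  by rewrite cmod1 mulr1 (idxE al) ?jv.
rewrite mE /E; apply: ler_pM.
- by apply: prodr_ge0 => i _; exact: expR_ge0.
- by apply: prodr_ge0 => j _; rewrite exprn_ge0 // ymod_ge0.
- by apply: ler_prod => i is_; rewrite expR_ge0 ler_expR ltW // hxE.
- apply: ler_prod => j js; rewrite exprn_ge0 ?ymod_ge0 //=.
  apply: lerXn2r; rewrite ?nnegrE ?ymod_ge0 //; first by have /andP[/ltW] := hrho j js.
  by apply/ltW; apply: hxr => //; rewrite inE.
Qed.

End Solution.

(** * A two constants theorem *)

Section TwoConstants.
Variable R : realType.
Local Notation C := (Cx R).
Implicit Types (p : {poly C}) (rho : R).

(** The weighted l^1 norm: it dominates the supremum over |z| <= rho and controls every
    coefficient. *)
Definition pn rho p : R := \sum_(i < size p) cmod p`_i * rho ^+ i.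

Lemma pn_widen rho p n : (size p <= n)%N -> pn rho p = \sum_(i < n) cmod p`_i * rho ^+ i.
Proof.
move=> pn_; rewrite /pn (big_ord_widen n (fun i => cmod p`_i * rho ^+ i)) // big_mkcond /=.
apply: eq_bigr => i _; case: ifP => // /negbT; rewrite -leqNgt => h.
by rewrite nth_default // cmod0 mul0r.
Qed.

Lemma pnD rho p1 p2 : 0 <= rho -> pn rho (p1 + p2) <= pn rho p1 + pn rho p2.
Proof.
move=> r0; pose n := maxn (size p1) (size p2).
rewrite (@pn_widen _ _ n) ?size_polyD // (@pn_widen _ p1 n) ?leq_maxl // (@pn_widen _ p2 n) ?leq_maxr //.
rewrite -big_split /=; apply: ler_sum => i _.
by rewrite -mulrDl ler_wpM2r ?exprn_ge0 // coefD cmodD.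
Qed.

Lemma pn_monom rho (a : C) m : pn rho (a *: 'X^m) = cmod a * rho ^+ m.
Proof.
rewrite (@pn_widen _ _ m.+1); last first.
  by apply: leq_trans (size_scale_leq _ _) _; rewrite size_polyXn.
rewrite big_ord_recr /= big1 ?add0r; last first.
  by move=> i _; rewrite coefZ coefXn (ltn_eqF (ltn_ord i)) mulr0 cmod0 mul0r.
by rewrite coefZ coefXn eqxx mulr1.
Qed.

Lemma pn_sum rho (I : Type) (s : seq I) (F : I -> {poly C}) : 0 <= rho ->
  pn rho (\sum_(i <- s) F i) <= \sum_(i <- s) pn rho (F i).
Proof.
move=> r0; elim: s => [|i s IH].
  by rewrite !big_nil /pn size_poly0 big_ord0.
by rewrite !big_cons; apply: le_trans (pnD _ _ r0) _; rewrite lerD2l.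
Qed.

Lemma pn_cons rho p (a : C) : pn rho (p * 'X + a%:P) = rho * pn rho p + cmod a.
Proof.
rewrite (@pn_widen _ _ (size p).+1); last first.
  rewrite (leq_trans (size_polyD _ _)) // geq_max size_polyC.
  rewrite (leq_trans (size_polyMleq _ _)) /=; last by rewrite size_polyX addn2.
  by case: (a != 0).
rewrite big_ord_recl addrC coefD coefMX eqxx coefC eqxx add0r expr0 mulr1; congr (_ + _).
rewrite mulr_sumr; apply: eq_bigr => i _.
rewrite lift0 coefD coefMX coefC /= addr0 exprS; ring.
Qed.

(** Induction along Horner's scheme: multiplying by X + t costs a factor at most rho + |t|. *)
Lemma pn_shift (p : {poly C}) (t : C) rho : 0 <= rho ->
  pn rho (p \Po ('X + t%:P)) <= pn (rho + cmod t) p.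
Proof.
move=> r0; elim/poly_ind: p => [|p a IH].
  by rewrite comp_poly0 /pn size_poly0 !big_ord0.
rewrite comp_polyD comp_polyM comp_polyX comp_polyC.
rewrite [X in pn _ X](_ : _ = ((p \Po ('X + t%:P)) * 'X + a%:P) +
  (p \Po ('X + t%:P)) * t%:P); last by rewrite mulrDr addrAC.
apply: (le_trans (pnD _ _ r0)).
rewrite !pn_cons.
have -> : pn rho ((p \Po ('X + t%:P)) * t%:P) = cmod t * pn rho (p \Po ('X + t%:P)).
  rewrite mulrC mul_polyC (@pn_widen _ _ (size (p \Po ('X + t%:P)))) ?size_scale_leq //.
  by rewrite /pn mulr_sumr; apply: eq_bigr => i _; rewrite coefZ cmodM mulrA.
have rt : 0 <= rho + cmod t by rewrite addr_ge0 ?cmod_ge0.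
by rewrite addrAC -mulrDl lerD2r ler_wpM2l.
Qed.

Lemma prim_root_ex N : (0 < N)%N -> exists z : C, N.-primitive_root z.
Proof.
move=> N0; pose p : {poly C} := 'X^N - 1.
have [s Dp] := closed_field_poly_normal p.
rewrite (monicP _) ?monicXnsubC // scale1r in Dp.
have rn1 : all N.-unity_root s by apply/allP=> z; rewrite -root_prod_XsubC -Dp.
have sz_r : (N < (size s).+1)%N by rewrite -(size_prod_XsubC s id) -Dp size_XnsubC.
have [|z] := hasP (has_prim_root N0 rn1 _ sz_r); last by exists z.
by rewrite -separable_prod_XsubC -Dp separable_Xn_sub_1 // pnatr_eq0 -lt0n.
Qed.

(* Cauchy's estimate; for a polynomial the mean over the circle may be taken
   over the N-th roots of unity, with N exceeding the degree. *)
Lemma cauchy_poly (p : {poly C}) (e b : R) m : 0 < e ->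
  (forall t, cmod t <= e -> cmod p.[t] <= b) -> cmod p`_m * e ^+ m <= b.
Proof.
move=> e0 hb; pose N := maxn (size p) m.+1.
have N0 : (0 < N)%N by rewrite leq_max orbT.
have b0 : 0 <= b by apply: le_trans (hb 0 _); rewrite ?cmod_ge0 // cmod0 ltW.
have [w pw] := prim_root_ex N0.
have wN := prim_expr_order pw.
have w1 : cmod w = 1.
  apply/eqP; rewrite -(@pexpr_eq1 _ _ N) ?cmod_ge0 //.
  by rewrite -cmodX wN cmod1.
have w0 : w != 0 by rewrite -cmod_eq0 w1 oner_eq0.
have wu (j : nat) : cmod (w ^+ j) = 1 by rewrite cmodX w1 expr1n.
have E : \sum_(k < N) p.[toC e * w ^+ k] / w ^+ (m * k) = N%:R * (p`_m * toC e ^+ m).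
  under eq_bigr => k _ do rewrite (horner_coef_wide (n := N)) ?leq_maxl // mulr_suml.
  rewrite exchange_big /=.
  have mN : (m < N)%N by rewrite leq_max ltnSn orbT.
  rewrite (bigD1 (Ordinal mN)) //= [X in _ + X]big1 ?addr0.
    transitivity (\sum_(k < N) (p`_m * toC e ^+ m)); last first.
      by rewrite big_const_ord iter_addr_0 mulr_natl.
    by apply: eq_bigr => k _; rewrite exprMn -exprM mulnC mulrA mulfK // expf_neq0.
  move=> i im.
  have -> : \sum_(k < N) p`_i * (toC e * w ^+ k) ^+ i / w ^+ (m * k) =
     p`_i * toC e ^+ i * \sum_(k < N) (w ^+ i / w ^+ m) ^+ k.
    rewrite mulr_sumr; apply: eq_bigr => k _.
    by rewrite exprMn exprMn exprVn -!exprM mulnC !mulrA.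
  set v := w ^+ i / w ^+ m.
  have v1 : v != 1.
    apply: contraNneq im => /(canRL (mulfVK (expf_neq0 _ w0))); rewrite mul1r => /eqP.
    rewrite (eq_prim_root_expr pw) !modn_small //.
  have : (v - 1) * \sum_(k < N) v ^+ k = 0.
    by rewrite -subrX1 /v exprMn exprVn -!exprM mulnC exprM wN expr1n mulnC exprM wN expr1n invr1 mulr1 subrr.
  by move/eqP; rewrite mulf_eq0 subr_eq0 (negPf v1) /= => /eqP ->; rewrite mulr0.
have := cmod_sum (index_enum 'I_N) xpredT (fun k : 'I_N => p.[toC e * w ^+ k] / w ^+ (m * k)).
rewrite E cmodM cmod_nat cmodM cmodX cmod_toC (ger0_norm (ltW e0)) => h.
have : \sum_(k < N) cmod (p.[toC e * w ^+ k] / w ^+ (m * k)) <= \sum_(k < N) b.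
  apply: ler_sum => k _; rewrite cmodM cmodV wu invr1 mulr1; apply: hb.
  by rewrite cmodM wu mulr1 cmod_toC ger0_norm // ltW.
rewrite big_const_ord iter_addr_0 -mulr_natl => h2.
by have := le_trans h h2; rewrite ler_pM2l // ltr0n.
Qed.

Lemma geom_half n : \sum_(i < n) (2^-1 : R) ^+ i <= 2.
Proof.
suff -> : \sum_(i < n) (2^-1 : R) ^+ i = 2 - 2 * 2^-1 ^+ n.
  by rewrite gerBl mulr_ge0 // exprn_ge0.
elim: n => [|n IH]; first by rewrite big_ord0 expr0 mulr1 subrr.
by rewrite big_ord_recr /= IH exprS; field.
Qed.

(** Let a_m be the coefficients at z. Cauchy gives |a_m| e^m <= b and the norm gives |a_m| rho1^m <=
    B; their geometric mean is |a_m| (4e)^m <= sqrt(bB), since (4e)^2 <= e rho1: hence the 16. On |t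
    - z| <= 2e the series is then dominated by a geometric one of ratio 1/2. *)
Lemma disc_step (p : {poly C}) (z z' : C) (rho rho1 e b B : R) :
  0 < e -> 16 * e <= rho1 -> cmod z + rho1 <= rho -> cmod (z' - z) <= e ->
  0 < b -> 0 < B -> pn rho p <= B ->
  (forall t, cmod (t - z) <= e -> cmod p.[t] <= b) ->
  forall t, cmod (t - z') <= e -> cmod p.[t] <= 2 * Num.sqrt (b * B).
Proof.
move=> e0 er zr zz b0 B0 pB pb t tz.
pose p' := p \Po ('X + z%:P).
have hp' u : p'.[u] = p.[u + z] by rewrite horner_comp hornerD hornerX hornerC.
have r1 : 0 < rho1 by lra.
have c1 m : cmod p'`_m * e ^+ m <= b.
  by apply: cauchy_poly => // u ue; rewrite hp'; apply: pb; rewrite addrK.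
have pB' : pn rho1 p' <= B.
  apply: le_trans pB; apply: le_trans (pn_shift _ _ (ltW r1)) _.
  apply: ler_sum => i _; rewrite ler_wpM2l ?cmod_ge0 //.
  by apply: lerXn2r; rewrite ?nnegrE ?addr_ge0 ?cmod_ge0 //; have := cmod_ge0 z; lra.
have c2 m : cmod p'`_m * rho1 ^+ m <= B.
  have [mp|mp] := ltnP m (size p'); last by rewrite nth_default // cmod0 mul0r ltW.
  apply: le_trans pB'; rewrite /pn (bigD1 (Ordinal mp)) //= lerDl sumr_ge0 // => i _.
  by rewrite mulr_ge0 ?cmod_ge0 // exprn_ge0 // ltW.
have c3 m : cmod p'`_m * (4 * e) ^+ m <= Num.sqrt (b * B).
  have e4 : 0 <= 4 * e by rewrite mulr_ge0 // ltW.
  have c0 : 0 <= cmod p'`_m * (4 * e) ^+ m by rewrite mulr_ge0 ?cmod_ge0 ?exprn_ge0.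
  rewrite -(ger0_norm c0) -sqrtr_sqr.
  rewrite ler_sqrt ?mulr_ge0 ?(ltW b0) ?(ltW B0) //.
  apply: le_trans (_ : (cmod p'`_m * e ^+ m) * (cmod p'`_m * rho1 ^+ m) <= _); last first.
    by apply: ler_pM => //; rewrite mulr_ge0 ?cmod_ge0 ?exprn_ge0 ?(ltW e0) ?(ltW r1).
  rewrite [leLHS]exprMn [leRHS]mulrACA -expr2 ler_wpM2l ?sqr_ge0 //.
  rewrite -exprM mulnC exprM -exprMn; apply: lerXn2r; rewrite ?nnegrE.
  - exact: sqr_ge0.
  - by rewrite mulr_ge0 // ltW.
  - by have := ler_wpM2l (ltW e0) er; lra.
have tz2 : cmod (t - z) <= 2 * e.
  by have := cmodD (t - z') (z' - z); rewrite subrKA; lra.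
rewrite -[t](subrK z) -hp' horner_coef.
apply: le_trans (cmod_sum _ _ _) _.
apply: le_trans (_ : \sum_(i < size p') Num.sqrt (b * B) * 2^-1 ^+ i <= _); last first.
  by rewrite -mulr_sumr mulrC ler_wpM2r ?sqrtr_ge0 // geom_half.
apply: ler_sum => i _; rewrite cmodM cmodX.
apply: le_trans (_ : cmod p'`_i * (2 * e) ^+ i <= _).
  rewrite ler_wpM2l ?cmod_ge0 //; apply: lerXn2r; rewrite ?nnegrE ?cmod_ge0 //; lra.
have h0 : 0 <= (2^-1 : R) ^+ i by rewrite exprn_ge0.
have := ler_wpM2r h0 (c3 i); rewrite -mulrA -exprMn.
by rewrite (_ : 4 * e * 2^-1 = 2 * e) //; field.
Qed.

(** The constant 4 is fixed by C -> 2 sqrt(C), so iterating [disc_step] halves the exponent without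
    piling up constants. *)
Lemma sqrt_chain (b B th : R) : 0 < b -> 0 < B ->
  2 * Num.sqrt (4 * (b `^ th * B `^ (1 - th)) * B) = 4 * (b `^ (th / 2) * B `^ (1 - th / 2)).
Proof.
move=> b0 B0.
have p1 x : 0 <= b `^ x by exact: powR_ge0.
have p2 x : 0 <= B `^ x by exact: powR_ge0.
have -> : 4 * (b `^ th * B `^ (1 - th)) * B = (2 * (b `^ (th / 2) * B `^ (1 - th / 2))) ^+ 2.
  have e1 : b `^ th = (b `^ (th / 2)) ^+ 2.
    by rewrite -powR_mulrn // -powRrM; congr (_ `^ _); field.
  have e2 : (B `^ (1 - th / 2)) ^+ 2 = B `^ (1 - th) * B.
    rewrite -powR_mulrn // -powRrM.
    have -> : (1 - th / 2) * 2%:R = (1 - th) + 1 by field.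
    by rewrite powRD ?(gt_eqF B0) ?implybT // powRr1 // ltW.
  by rewrite !exprMn e2 e1; ring.
by rewrite sqrtr_sqr ger0_norm ?mulr_ge0 //; ring.
Qed.

(* A form of the two constants theorem: smallness on a small disc propagates
   to the Taylor coefficients at the center of the large disc. *)
Lemma two_constants (rho : R) (t0 : C) (e0 : R) (m : nat) : cmod t0 < rho -> 0 < e0 ->
  exists K th : R, [/\ 0 < K, 0 < th, th <= 1 &
   forall (p : {poly C}) (B b : R), 0 < B -> 0 < b -> pn rho p <= B ->
     (forall t, cmod (t - t0) <= e0 -> cmod p.[t] <= b) ->
     cmod p`_m <= K * (b `^ th * B `^ (1 - th))].
Proof.
move=> tr e00; pose rho1 := rho - cmod t0.
have r1 : 0 < rho1 by rewrite subr_gt0.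
pose e := Num.min e0 (rho1 / 16).
have ee : 0 < e by rewrite lt_min e00 divr_gt0.
have er : 16 * e <= rho1 by rewrite mulrC -ler_pdivlMr // ge_min lexx orbT.
(* Enough steps of length at most e to lead from t0 to 0 along the segment. *)
pose n := (Num.truncn (cmod t0 / e)).+1.
have n0 : 0 < n%:R :> R by rewrite ltr0n.
have hn : cmod t0 / n%:R <= e.
  rewrite ler_pdivrMr // mulrC -ler_pdivrMr // ltW // truncnS_gt //.
pose z (i : nat) : C := toC (1 - i%:R / n%:R) * t0.
pose th (i : nat) : R := 2^-1 ^+ i.
exists (4 / e ^+ m), (th n); split.
- by rewrite divr_gt0 // exprn_gt0.
- by rewrite exprn_gt0.
- by rewrite exprn_ile1 // invf_le1 // ler1n.
move=> p B b B0 b0 pB pb.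
have chain i : (i <= n)%N -> forall t, cmod (t - z i) <= e ->
    cmod p.[t] <= 4 * (b `^ th i * B `^ (1 - th i)).
  elim: i => [_|i IH ii] t.
    rewrite /z mul0r subr0 mul1r => te.
    rewrite /th expr0 subrr powRr0 powRr1 ?ltW // mulr1.
    have : cmod p.[t] <= b by apply: pb; apply: le_trans te _; rewrite ge_min lexx.
    by move: b0; lra.
  move=> tz; rewrite /th exprSr -sqrt_chain //.
  have zi : cmod (z i) <= cmod t0.
    rewrite cmodM cmod_toC ger0_norm ?ler_piMl ?cmod_ge0 ?gerBl ?divr_ge0 //.
    by rewrite subr_ge0 ler_pdivrMr // mul1r ler_nat ltnW.
  apply: (@disc_step p (z i) (z i.+1) rho rho1 e) => //.
  - by rewrite /rho1; lra.
  - rewrite /z -mulrBl -toCB cmodM cmod_toC.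
    rewrite (_ : _ - _ - _ = - n%:R^-1); last by rewrite -natr1; field; rewrite lt0r_neq0.
    by rewrite normrN ger0_norm ?invr_ge0 ?ler0n // mulrC.
  - by rewrite mulr_gt0 // mulr_gt0 // powR_gt0.
  - exact: IH (ltnW ii).
have h t : cmod t <= e -> cmod p.[t] <= 4 * (b `^ th n * B `^ (1 - th n)).
  move=> te; apply: (chain n (leqnn n)).
  by rewrite /z divff ?lt0r_neq0 // subrr mul0r subr0.
by rewrite mulrAC ler_pdivlMr ?exprn_gt0 //; exact: cauchy_poly.
Qed.

(** One variable at a time: with the others fixed, the coefficient of y_j^(k_j) is bounded by
    [two_constants], and the terms with l_j = k_j form a polynomial in one variable less, of norm at
    most B rho_j^(-k_j). [K] and [th] do not depend on [F], [c], [B], [b]. *)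
Lemma two_constants_multi n (J : seq 'I_n) (rho : 'I_n -> R) (y0 : 'I_n -> C) (e : R)
    (k : 'cV[nat]_n) : uniq J -> 0 < e ->
  (forall j, j \in J -> cmod (y0 j) + e <= rho j) ->
  exists K th : R, [/\ 0 < K, 0 < th, th <= 1 &
   forall (F : seq 'cV[nat]_n) (c : 'cV[nat]_n -> C) (B b : R), 0 < B -> 0 < b ->
     \sum_(l <- F) cmod (c l) * \prod_(j <- J) rho j ^+ l j 0%R <= B ->
     (forall y : 'I_n -> C, (forall j, j \in J -> cmod (y j - y0 j) <= e) ->
        cmod (\sum_(l <- F) c l * \prod_(j <- J) y j ^+ l j 0%R) <= b) ->
     cmod (\sum_(l <- F | all (fun j => l j 0%R == k j 0%R) J) c l) <=
       K * (b `^ th * B `^ (1 - th))].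
Proof.
move=> + e0; elim: J => [_ _|j J IH /andP[jJ uJ] hr].
  exists 1, 1; split=> // F c B b B0 b0 _ h.
  rewrite subrr powRr0 powRr1 ?(ltW b0) // mul1r mulr1.
  apply: (le_trans _ (h y0 _)) => //.
  under [X in _ <= cmod X]eq_bigr do rewrite big_nil mulr1.
  by rewrite le_eqVlt; apply/orP; left; apply/eqP; congr cmod; apply: eq_bigl.
have hrJ i : i \in J -> cmod (y0 i) + e <= rho i.
  by move=> iJ; apply: hr; rewrite inE iJ orbT.
have hj : cmod (y0 j) + e <= rho j by apply: hr; rewrite mem_head.
have rj : 0 < rho j by have := cmod_ge0 (y0 j); lra.
have [K2 [th2 [K20 th20 th21 H2]]] := IH uJ hrJ.
have [K1 [th1 [K10 th10 th11 H1]]] := @two_constants (rho j) (y0 j) e (k j 0%R) (ltac:(lra)) e0.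
(* From substituting b1 and B1 into K2 b1^th2 B1^(1 - th2). *)
exists (K2 * K1 `^ th2 * (rho j ^- (k j 0%R)) `^ (1 - th2)), (th1 * th2).
have q0 : 0 < rho j ^- (k j 0%R) by rewrite invr_gt0 exprn_gt0.
split.
- by rewrite !mulr_gt0 // powR_gt0.
- exact: mulr_gt0.
- by rewrite mulr_ile1 // ltW.
move=> F c B b B0 b0 hB hb.
pose b1 := K1 * (b `^ th1 * B `^ (1 - th1)).
pose B1 := B * rho j ^- (k j 0%R).
have b10 : 0 < b1 by rewrite !mulr_gt0 // powR_gt0.
have B10 : 0 < B1 by rewrite mulr_gt0.
pose F' := [seq l : 'cV[nat]_n <- F | l j 0%R == k j 0%R].
have hB' : \sum_(l <- F') cmod (c l) * \prod_(i <- J) rho i ^+ l i 0%R <= B1.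
  rewrite /B1 ler_pdivlMr ?exprn_gt0 // big_filter mulr_suml; apply: le_trans hB.
  rewrite big_mkcond /=; apply: ler_sum => l _; rewrite big_cons.
  case: eqP => [->|_]; first by rewrite mulrAC mulrA.
  rewrite !mulr_ge0 ?cmod_ge0 ?exprn_ge0 ?(ltW rj) //.
  rewrite big_seq; apply: prodr_ge0 => i iJ; rewrite exprn_ge0 //.
  by have := hrJ i iJ; have := cmod_ge0 (y0 i); lra.
have hb' (y : 'I_n -> C) : (forall i, i \in J -> cmod (y i - y0 i) <= e) ->
    cmod (\sum_(l <- F') c l * \prod_(i <- J) y i ^+ l i 0%R) <= b1.
  move=> hy.
  pose p : {poly C} := \sum_(l <- F) (c l * \prod_(i <- J) y i ^+ l i 0%R) *: 'X^(l j 0%R).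
  have -> : \sum_(l <- F') c l * \prod_(i <- J) y i ^+ l i 0%R = p`_(k j 0%R).
    rewrite /p coef_sum big_filter big_mkcond /=; apply: eq_bigr => l _.
    by rewrite coefZ coefXn eq_sym; case: eqP; rewrite ?mulr1 ?mulr0.
  apply: H1 => //.
    apply: le_trans (pn_sum _ _ (ltW rj)) _; apply: le_trans hB.
    apply: ler_sum => l _; rewrite pn_monom big_cons cmodM cmod_prod -mulrA ler_wpM2l ?cmod_ge0 //.
    rewrite [leLHS]mulrC ler_wpM2l ?exprn_ge0 ?(ltW rj) //.
    rewrite big_seq [leRHS]big_seq; apply: ler_prod => i iJ; rewrite cmod_ge0 cmodX /=.
    apply: lerXn2r; rewrite ?nnegrE ?cmod_ge0 //.
      by have := hrJ i iJ; have := cmod_ge0 (y0 i); lra.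
    by have := hrJ i iJ; have := hy i iJ; have := cmodD (y i - y0 i) (y0 i); rewrite subrK; lra.
  move=> t tz; pose y' i := if i == j then t else y i.
  have -> : p.[t] = \sum_(l <- F) c l * \prod_(i <- j :: J) y' i ^+ l i 0%R.
    rewrite /p horner_sum; apply: eq_bigr => l _.
    rewrite hornerZ hornerXn big_cons {1}/y' eqxx -mulrA [_ * t ^+ _]mulrC; congr (_ * (_ * _)).
    rewrite big_seq [RHS]big_seq; apply: eq_bigr => i iJ.
    by rewrite /y' ifN //; apply: contraNneq jJ => <-.
  apply: hb => i; rewrite inE /y'; case: eqP => [-> //|_ /=]; exact: hy.
have := H2 F' c B1 b1 B10 b10 hB' hb'.
rewrite big_filter_cond /= => /le_trans; apply.
rewrite /b1 /B1 !powRM ?mulr_ge0 ?powR_ge0 ?(ltW K10) ?(ltW q0) ?(ltW B0) //.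
rewrite -!powRrM [in leRHS](_ : 1 - th1 * th2 = (1 - th1) * th2 + (1 - th2)); last by ring.
rewrite [B `^ ((1 - th1) * th2 + _)]powRD ?(gt_eqF B0) ?implybT //.
by rewrite le_eqVlt; apply/orP; left; apply/eqP; ring.
Qed.

End TwoConstants.

(** * Very generic parameters *)

(** The complements of all affine hyperplanes with rational equation, enumerated by [unpickle].
    Codes without a nonzero linear form give the whole space, so that every member is open and
    nonempty. *)
Definition Gset (R : realType) (d : nat) (j : nat) : set 'cV[Cx R]_d :=
  if choice.unpickle j is Some vz then
    let: (v, z) := vz : 'rV[rat]_d * rat in
    if v == 0 then setT else [set b | \sum_i ratr (v 0 i) * b i 0 - ratr z != 0]
  else setT.

Module LinearForms.
Import -(notations) mpoly.

Lemma Gset_open (R : realType) d j : zariski_open (@Gset R d j) /\ @Gset R d j !=set0.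
Proof.
have oT : zariski_open ([set: 'cV[Cx R]_d]) /\ [set: 'cV[Cx R]_d] !=set0.
  split; last by exists 0.
  exists (fun g => g = mpoly.mpolyC d (1 : Cx R)); apply/seteqP; split=> b // _.
  by exists (mpoly.mpolyC d (1 : Cx R)) => //; rewrite mpoly.mevalC oner_neq0.
rewrite /Gset; case: choice.unpickle => // -[v z]; case: eqP => // v0.
split.
  pose g : mpoly.mpoly d (Cx R) :=
    \sum_i ratr (v 0 i) *: mpoly.mpolyX (Cx R) (mpoly.mnm1 i) - mpoly.mpolyC d (ratr z).
  have gE b : mpoly.meval (fun i => b i 0) g = \sum_i ratr (v 0 i) * b i 0 - ratr z.
    rewrite /g mpoly.mevalB mpoly.mevalC; congr (_ - _).
    rewrite (big_morph _ (mpoly.mevalD _) (mpoly.meval0 _)); apply: eq_bigr => i _.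
    by rewrite mpoly.mevalZ mpoly.mevalXU.
  exists (fun h => h = g); apply/seteqP; split=> b /=.
    by move=> h; exists g => //; rewrite gE.
  by move=> [_ ->]; rewrite gE.
have [i vi] : exists i, v 0 i != 0.
  apply: contrapT => h; apply: v0; apply/matrixP => i j'; rewrite ord1 mxE.
  by apply/eqP; apply: contraT => h'; case: h; exists j'.
exists (\col_m (if m == i then (ratr z + 1) / ratr (v 0 i) else 0)) => /=.
rewrite (bigD1 i) //= big1 ?addr0; last by move=> m /negPf mi; rewrite mxE mi mulr0.
by rewrite mxE eqxx mulrCA divff ?fmorph_eq0 // mulr1 addrAC subrr add0r oner_neq0.
Qed.

End LinearForms.

(** v^l_i is a row of A_sg^-1 applied to b, plus a rational number. The row is rational, and nonzero
    because A_sg is invertible, so an integer value would put b on an excluded hyperplane. *)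
Lemma generic_nonint (R : realType) (d n : nat) (A : 'M[int]_(d, n)) (sg : {set 'I_n})
    (hsg : #|sg| = d) (b : 'cV[Cx R]_d) :
  \det (Asub A hsg) != 0 -> (forall j, Gset j b) ->
  forall l i (z : int), i \in sg -> vk A hsg b l i 0 <> z%:~R.
Proof.
move=> hdet Gb l i z is_; have [j ->] := sgi_ex hsg is_.
have AC : Ainv A hsg (Cx R) = map_mx ratr (Ainv A hsg rat).
  rewrite /Ainv map_invmx; congr invmx; apply/matrixP => i' j'.
  by rewrite !mxE; exact/esym/ratr_int.
have -> : vk A hsg b l (sg_index hsg j) 0 = (l (sg_index hsg j) 0%R)%:~R +
    ((Ainv A hsg (Cx R) *m b) j 0 - (Ainv A hsg (Cx R) *m map_mx intr (A *m toZ l)) j 0).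
  rewrite /vk [LHS]mxE; congr (_ + _); first by rewrite !mxE.
  by rewrite emb_sgi mulmxBr [LHS]mxE; congr (_ + _); rewrite mxE.
move: (A *m toZ l) => M; pose Q := Ainv A hsg rat.
pose w : rat := z%:~R - (l (sg_index hsg j) 0%R)%:~R + (Q *m map_mx intr M) j 0.
have wE : ratr w = z%:~R - (l (sg_index hsg j) 0%R)%:~R +
     (Ainv A hsg (Cx R) *m map_mx intr M) j 0.
  rewrite /w rmorphD rmorphB /= !ratr_int; congr (_ + _).
  rewrite AC !mxE rmorph_sum; apply: eq_bigr => m _; rewrite rmorphM; congr (_ * _).
    by rewrite mxE.
  by rewrite !mxE /= ratr_int.
move=> h; have := Gb (choice.pickle (row j Q, w)); rewrite /Gset choice.pickleK.
case: eqP => [q0 _|_].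
  have := mulVmx (Asub_unit hdet rat) => /matrixP/(_ j j).
  rewrite -[invmx _]/Q !mxE eqxx big1 => [/eqP|m _]; first by rewrite eq_sym oner_eq0.
  by have /matrixP/(_ 0 m) := q0; rewrite !mxE => ->; rewrite mul0r.
move/eqP; apply; rewrite wE -h.
have -> : \sum_i0 ratr (row j Q 0 i0) * b i0 0 = (Ainv A hsg (Cx R) *m b) j 0.
  by rewrite AC [RHS]mxE; apply: eq_bigr => m _; rewrite !mxE.
ring.
Qed.

(** * Growth of factorials *)

Section Growth.
Variable R : realType.
Local Notation C := (Cx R).

(* Growth is measured by N^(N x), which up to factors D^N is (N t)! for x = t. *)
Definition growth (N : nat) (x : R) : R := N%:R `^ (N%:R * x).

Lemma growth_gt0 N x : (0 < N)%N -> 0 < growth N x.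
Proof. by move=> N0; rewrite powR_gt0 // ltr0n. Qed.

Lemma growthD N x y : (0 < N)%N -> growth N (x + y) = growth N x * growth N y.
Proof.
move=> N0; rewrite /growth mulrDr powRD //.
by rewrite pnatr_eq0 -lt0n N0 implybT.
Qed.

Lemma growth_N N x : growth N (- x) = (growth N x)^-1.
Proof. by rewrite /growth mulrN powRN. Qed.

Lemma growth0 N : growth N 0 = 1.
Proof. by rewrite /growth mulr0 powRr0. Qed.

Lemma growth_nat N t : growth N t%:R = N%:R ^+ (N * t).
Proof. by rewrite /growth -natrM powR_mulrn. Qed.

Lemma growth_sum (I : Type) (s : seq I) (P : pred I) (t : I -> R) N : (0 < N)%N ->
  growth N (\sum_(i <- s | P i) t i) = \prod_(i <- s | P i) growth N (t i).
Proof. by move=> N0; apply: (big_morph _ (fun x y => growthD x y N0) (growth0 N)). Qed.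

Lemma powE (K D x th : R) N : 0 <= K -> 0 <= D ->
  (K * D ^+ N * growth N x) `^ th = K `^ th * (D `^ th) ^+ N * growth N (th * x).
Proof.
move=> K0 D0; rewrite powRM ?mulr_ge0 ?powR_ge0 ?exprn_ge0 // powRM ?exprn_ge0 //.
congr (_ * _ * _).
  by rewrite -!powR_mulrn ?powR_ge0 // -!powRrM mulrC.
by rewrite /growth -powRrM; congr (_ `^ _); ring.
Qed.

Lemma growth_unbounded (mu K D : R) : 0 < mu -> 0 < K -> 0 < D ->
  ~ (forall N, (0 < N)%N -> growth N mu <= K * D ^+ N).
Proof.
move=> m0 K0 D0 h.
(* N^mu >= (K + 1) D would yield (K + 1)^N <= K. *)
pose X := (K + 1) * D; have X0 : 0 < X by rewrite mulr_gt0 // addr_gt0.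
pose N := (Num.truncn (X `^ mu^-1)).+1.
have hN : X <= N%:R `^ mu.
  have -> : X = (X `^ mu^-1) `^ mu by rewrite -powRrM mulVf ?lt0r_neq0 // powRr1 // ltW.
  by apply: ge0_ler_powR; rewrite ?nnegrE ?powR_ge0 ?(ltW m0) // ltW // truncnS_gt.
have := h N isT; rewrite /growth mulrC powRrM powR_mulrn ?powR_ge0 // => h1.
have : X ^+ N <= (N%:R `^ mu) ^+ N by apply: lerXn2r; rewrite ?nnegrE ?powR_ge0 ?(ltW X0).
move=> /le_trans/(_ h1); rewrite /X exprMn ler_pM2r ?exprn_gt0 // => h2.
have : (K + 1) ^+ 1 <= (K + 1) ^+ N by rewrite ler_weXn2l // lerDr ltW.
by rewrite expr1 => /le_trans/(_ h2); rewrite gerDl ler10.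
Qed.

Lemma fact_ge (n : nat) : n%:R ^+ n * expR (- n%:R) <= n`!%:R :> R.
Proof.
case: n => [|n]; first by rewrite expr0 mul1r oppr0 expR0.
rewrite expRN ler_pdivrMr ?expR_gt0 // mulrC -ler_pdivrMr ?ltr0n ?fact_gt0 //.
by apply: le_trans (expR_ge1Dxn n (ler0n R n.+1)); rewrite lerDr.
Qed.

Lemma fact_le (n : nat) : (n`! <= n ^ n)%N.
Proof.
elim: n => // n IH; rewrite factS expnS leq_mul2l /=; apply: leq_trans IH _.
by case: n => // n; rewrite leq_exp2r.
Qed.

Lemma factD_le (k n : nat) : ((k + n)`! <= k`! * k.+1 ^ n * n`!)%N.
Proof.
elim: n => [|n IH]; first by rewrite addn0 expn0 !muln1.
rewrite addnS !factS expnS.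
have -> : (k`! * (k.+1 * k.+1 ^ n) * (n.+1 * n`!) = (k.+1 * n.+1) * (k`! * k.+1 ^ n * n`!))%N by ring.
by apply: leq_mul => //; nia.
Qed.

(** The exponent x may have either sign: an upper bound for the factorial serves x >= 0 and a lower
    bound serves x < 0. *)
Lemma fact_growth (k M : nat) (x : R) : exists2 D, 0 < D &
  forall N, (0 < N)%N -> (k + N * M)`!%:R `^ x <= D ^+ N * growth N (M%:R * x).
Proof.
pose D1 : R := k`!%:R * k.+1%:R ^+ M * (M%:R ^+ M).
pose D2 : R := expR (- M%:R).
have up N : (0 < N)%N -> (k + N * M)`!%:R <= D1 ^+ N * growth N M%:R.
  move=> N0; apply: (@le_trans _ _ (k`! * k.+1 ^ (N * M) * (N * M)`!)%N%:R).
    by rewrite ler_nat factD_le.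
  rewrite !natrM natrX /D1 !exprMn growth_nat -!exprM.
  have h1 : (k`!%:R : R) <= k`!%:R ^+ N.
    by rewrite -[leLHS]expr1 ler_weXn2l // ler1n fact_gt0.
  have h2 : ((N * M)`!%:R : R) <= M%:R ^+ (M * N) * N%:R ^+ (N * M).
    by rewrite [(M * N)%N]mulnC -exprMn -natrM -natrX ler_nat [(M * N)%N]mulnC fact_le.
  rewrite -!mulrA; apply: ler_pM; rewrite ?mulr_ge0 ?exprn_ge0 //.
  by rewrite [(M * N)%N]mulnC in h2 *; rewrite ler_wpM2l ?exprn_ge0.
have lo N : (0 < N)%N -> D2 ^+ N * growth N M%:R <= (k + N * M)`!%:R.
  move=> N0; apply: (@le_trans _ _ (N * M)`!%:R); last first.
    by rewrite ler_nat leq_fact // leq_addl.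
  apply: le_trans (fact_ge _); rewrite growth_nat mulrC /D2 -expRM_natl mulrN -natrM.
  rewrite ler_wpM2r ?expR_ge0 //; case: (posnP M) => [->|M0]; first by rewrite muln0.
  by apply: lerXn2r; rewrite ?nnegrE // ler_nat leq_pmulr ?M0.
have [x0|x0] := leP 0 x.
  exists (D1 `^ x + 1); first by rewrite ltr_wpDl ?powR_ge0.
  move=> N N0; have D10 : 0 <= D1 by rewrite !mulr_ge0 // exprn_ge0.
  have := @powE 1 D1 M%:R x N ler01 D10; rewrite powR1 !mul1r => e.
  apply: (@le_trans _ _ ((D1 ^+ N * growth N M%:R) `^ x)).
    by apply: ge0_ler_powR; rewrite ?nnegrE ?mulr_ge0 ?exprn_ge0 ?(ltW (growth_gt0 _ N0)) ?up.
  rewrite e [M%:R * x]mulrC ler_wpM2r ?(ltW (growth_gt0 _ N0)) //.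
  by apply: lerXn2r; rewrite ?nnegrE ?addr_ge0 ?powR_ge0 // lerDl.
exists (D2 `^ x); first by rewrite powR_gt0 // expR_gt0.
move=> N N0; have D20 : 0 < D2 by exact: expR_gt0.
have := @powE 1 D2 M%:R x N ler01 (ltW D20); rewrite powR1 !mul1r [x * _]mulrC => <-.
have P0 : 0 < D2 ^+ N * growth N M%:R by rewrite mulr_gt0 ?exprn_gt0 ?growth_gt0.
have F0 : 0 < (k + N * M)`!%:R :> R by rewrite ltr0n fact_gt0.
rewrite -[x]opprK [leLHS]powRN [leRHS]powRN lef_pV2 ?posrE ?powR_gt0 //.
by apply: ge0_ler_powR; rewrite ?nnegrE ?oppr_ge0 ?(ltW x0) ?(ltW P0) ?(ltW F0) ?lo.
Qed.

(** |v - m| >= (m+1)/2 once m >= 2|v| + 2; finitely many m remain, none at distance 0. *)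
Lemma dist_nat (v : C) : (forall m : nat, v != m%:R) ->
  exists2 e : R, 0 < e & forall m : nat, e * m.+1%:R <= cmod (v - m%:R).
Proof.
move=> hv; pose J := (Num.truncn (2 * cmod v + 2)).+1.
pose e := \big[Num.min/2^-1]_(m < J) (cmod (v - m%:R) / m.+1%:R).
have p0 (m : nat) : 0 < cmod (v - m%:R) / m.+1%:R by rewrite divr_gt0 // cmod_gt0 subr_eq0.
exists e.
  rewrite /e; elim/big_ind: _ => [|x y x0 y0|m _]; [by rewrite invr_gt0|by rewrite lt_min x0 y0|exact: p0].
move=> m; have [mJ|Jm] := ltnP m J.
  by rewrite -ler_pdivlMr //;
    exact: (@bigmin_le _ _ _ _ (Ordinal mJ) (fun m : 'I_J => cmod (v - m%:R) / m.+1%:R)).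
apply: (@le_trans _ _ (2^-1 * m.+1%:R)); first by rewrite ler_wpM2r //; exact: bigmin_le_id.
have h1 : 2 * cmod v + 2 <= m%:R.
  by apply: le_trans (_ : J%:R <= _); [rewrite ltW // truncnS_gt|rewrite ler_nat].
have := cmodB v (v - m%:R); rewrite subKr cmod_nat -[m.+1%:R]natr1; lra.
Qed.

Lemma falling_ge (v : C) (e : R) n : 0 <= e -> (forall m : nat, e * m.+1%:R <= cmod (v - m%:R)) ->
  e ^+ n * n`!%:R <= cmod (falling v n).
Proof.
move=> e0 h; elim: n => [|n IH]; first by rewrite falling0 cmod1 expr0 mul1r.
rewrite fallingS cmodM exprSr factS natrM mulrACA [leLHS](_ : _ = (e ^+ n * n`!%:R) * (e * n.+1%:R)); last by ring.
by apply: ler_pM => //; rewrite mulr_ge0 // exprn_ge0.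
Qed.

Lemma falling_le (v : C) (X : R) n : (forall m, (m < n)%N -> cmod (v - m%:R) <= X) ->
  cmod (falling v n) <= X ^+ n.
Proof.
elim: n => [|n IH] h; first by rewrite falling0 cmod1 expr0.
rewrite fallingS cmodM exprSr; apply: ler_pM; rewrite ?cmod_ge0 ?h //.
by apply: IH => m mn; apply: h; exact: ltnW.
Qed.

(** For t > 0 the value is a falling factorial of length N t, bounded below through [dist_nat]; for
    t < 0 it is the inverse of a product of N|t| factors of size at most (|v| + 1) N |t|. *)
Lemma gam_lower (v : C) (t : int) :
  (0 < t -> forall m : nat, v != m%:R) -> (forall m : nat, v + m.+1%:R != 0) ->
  exists2 D, 0 < D & forall N, (0 < N)%N -> D ^+ N * growth N t%:~R <= cmod (gam v (- (N%:Z * t))).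
Proof.
case: t => [[|u]|u] h1 h2.
- exists 1 => // N N0; rewrite mulr0 oppr0 /gam /= falling0 invr1 cmod1 expr1n mul1r.
  by rewrite growth0.
- have [e e0 he] := dist_nat (h1 isT).
  exists (e ^+ u.+1 * expR (- u.+1%:R)); first by rewrite mulr_gt0 ?exprn_gt0 ?expR_gt0.
  move=> N N0; rewrite /gam ifF; last by lia.
  have -> : absz (- (N%:Z * Posz u.+1)) = (N * u.+1)%N by lia.
  apply: le_trans (falling_ge _ (ltW e0) he).
  rewrite exprMn -exprM [(u.+1 * N)%N]mulnC -mulrA ler_wpM2l ?exprn_ge0 ?(ltW e0) //.
  apply: le_trans (fact_ge _).
  rewrite -expRM_natl -pmulrn growth_nat mulrC mulrN -natrM ler_wpM2r ?expR_ge0 //.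
  by apply: lerXn2r; rewrite ?nnegrE // ler_nat leq_pmulr.
- pose X := (cmod v + 1) * u.+1%:R.
  have X0 : 0 < X by rewrite mulr_gt0 // ltr_wpDl // cmod_ge0.
  exists (X ^- u.+1); first by rewrite invr_gt0 exprn_gt0.
  move=> N N0; rewrite /gam ifT; last by lia.
  have -> : absz (- (N%:Z * Negz u)) = (N * u.+1)%N by lia.
  have -> : - (N%:Z * Negz u) = (N * u.+1)%N%:Z by lia.
  rewrite -pmulrn cmodV NegzE intrN growth_N -pmulrn growth_nat exprVn -invfM -exprM.
  set n := (N * u.+1)%N.
  have bn : falling (v + n%:R) n != 0.
    rewrite /falling prodf_seq_neq0; apply/allP => j; rewrite mem_index_iota => /andP[j1 jn] /=.
    have -> : v + n%:R - j%:R + 1 = v + (n - j).+1%:R by rewrite -natr1 natrB //; ring.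
    exact: h2.
  rewrite lef_pV2 ?posrE ?mulr_gt0 ?exprn_gt0 ?cmod_gt0 ?ltr0n //.
  rewrite [(u.+1 * N)%N]mulnC -/n -exprMn; apply: falling_le => m mn.
  rewrite /X -mulrA -natrM [(u.+1 * N)%N]mulnC -/n -addrA -natrB ?(ltnW mn) //.
  apply: le_trans (cmodD _ _) _; rewrite cmod_nat mulrDl mul1r lerD //.
    by rewrite ler_peMr ?cmod_ge0 // ler1n muln_gt0 N0.
  by rewrite ler_nat leq_subr.
Qed.

(** One finite set serves every family dominated by [G]: the terms of a slice depend on the point,
    whereas [two_constants_multi] wants a fixed list of indices. *)
Lemma tsum_trunc (I : choiceType) (G : I -> R) (K b : R) : (forall i, 0 <= G i) ->
  (forall B : {fset I}, \sum_(i <- B) G i <= K) -> 0 < b ->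
  exists A : {fset I}, forall F : I -> C, (forall i, cmod (F i) <= G i) ->
    forall B : {fset I}, (A `<=` B)%fset -> cmod (\sum_(i <- B) F i) <= cmod (tsum F) + b.
Proof.
move=> G0 GK b0; have [S hS] := rsum_ex G0 GK.
have b2 : 0 < b / 2 by rewrite divr_gt0.
have [A hA] := hS _ b2; exists A => F FG B AB.
have FK : absb F K by apply: absb_le_real FG GK.
apply/ler_addgt0Pr => e e0; have [A2 hA2] := absb_hsum FK e0.
pose B2 := (B `|` A2)%fset.
have h1 := hA2 B2 (fsubsetUr _ _).
have gS : \sum_(i <- B2) G i - \sum_(i <- B) G i <= b.
  have := hA B AB; have := hA B2 (fsubset_trans AB (fsubsetUl _ _)).
  by rewrite !ltr_norml => /andP[? ?] /andP[? ?]; lra.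
have split2 (V : nmodType) (f : I -> V) : \sum_(i <- B2) f i =
    \sum_(i <- B) f i + \sum_(i <- (B2 `\` B)%fset) f i.
  have e1 : [fset x in B2 | x \in B]%fset = B.
    by apply/fsetP => x; rewrite !inE /=; case: (x \in B); rewrite ?andbT ?andbF.
  have e2 : [fset x in B2 | x \notin B]%fset = (B2 `\` B)%fset.
    by apply/fsetP => x; rewrite !inE /= andbC.
  by rewrite (big_fsetID _ (mem B)) /= e1 e2.
have h3 : cmod (\sum_(i <- (B2 `\` B)%fset) F i) <= b.
  apply: le_trans (cmod_sum _ _ _) _; apply: le_trans gS; rewrite split2 addrAC subrr add0r.
  by apply: ler_sum => i _; exact: FG.
have := split2 _ F; set s1 := \sum_(i <- B) F i; set s2 := \sum_(i <- (B2 `\` B)%fset) F i in h3 *.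
move=> es; rewrite es in h1.
have -> : s1 = (s1 + s2 - tsum F) + (tsum F - s2) by ring.
apply: le_trans (cmodD _ _) _; have := cmodB (tsum F) s2; lra.
Qed.

Lemma summable_bound (I : choiceType) (D : set I) (M : I -> R) :
  summable D (fun a => (M a)%:E) -> exists2 K, 0 < K & forall a, D a -> M a <= K.
Proof.
rewrite /summable => h; set S := (\esum_(x in D) _)%E in h.
have S0 : (0 <= S)%E by exact: esum_ge0.
have fS : S \is a fin_num by rewrite ge0_fin_numE.
exists (fine S + 1); first by rewrite ltr_wpDl // fine_ge0.
move=> a Da; apply: (@le_trans _ _ (fine S)); last by rewrite lerDl.
rewrite -lee_fin fineK //; apply: (@le_trans _ _ `|(M a)%:E|%E).
  by rewrite lee_fin ler_norm.
apply: ereal_sup_ubound; exists [set a]; last by rewrite fsbig_set1.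
by split; [exact: finite_set1|move=> _ ->].
Qed.

End Growth.

(** * Lower bound along a ray *)

(** The exponents of N^N on the two sides are x and th y + (1 - th) x, whose difference th (x - y)
    is positive. *)
Lemma growth_contra (R : realType) (x y th K0 K1 D1 K2 D2 K3 D3 : R) :
  0 < th -> y < x -> 0 < K0 -> 0 < K1 -> 0 < D1 -> 0 < K2 -> 0 < D2 -> 0 < K3 -> 0 < D3 ->
  ~ (forall N, (0 < N)%N -> K3 * D3 ^+ N * growth N x <=
      K0 * ((K1 * D1 ^+ N * growth N y) `^ th * (K2 * D2 ^+ N * growth N x) `^ (1 - th))).
Proof.
move=> th0 yx K00 K10 D10 K20 D20 K30 D30 h.
pose mu := th * (x - y); have mu0 : 0 < mu by rewrite mulr_gt0 // subr_gt0.
apply: (@growth_unbounded R mu (K0 * K1 `^ th * K2 `^ (1 - th) / K3)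
  (D1 `^ th * D2 `^ (1 - th) / D3) mu0).
- by rewrite divr_gt0 // !mulr_gt0 // powR_gt0.
- by rewrite divr_gt0 // !mulr_gt0 // powR_gt0.
move=> N N0; have := h N N0; rewrite !powE ?(ltW K10) ?(ltW K20) ?(ltW D10) ?(ltW D20) //.
set a := D1 `^ th; set a' := D2 `^ (1 - th); set e := K1 `^ th; set e' := K2 `^ (1 - th).
have -> : growth N x = growth N mu * (growth N (th * y) * growth N ((1 - th) * x)).
  by rewrite -!growthD //; congr growth; rewrite /mu; ring.
set w := _ * growth N ((1 - th) * x); have w0 : 0 < w by rewrite mulr_gt0 ?growth_gt0.
have -> : K0 * (e * a ^+ N * growth N (th * y) * (e' * a' ^+ N * growth N ((1 - th) * x))) =
   (K0 * e * e') * (a * a') ^+ N * w by rewrite exprMn /w; ring.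
rewrite mulrA ler_pM2r // => h1.
rewrite -(ler_pM2l (mulr_gt0 K30 (exprn_gt0 N D30))); apply: le_trans h1 _.
rewrite le_eqVlt; apply/orP; left; apply/eqP; rewrite [(_ / D3) ^+ N]exprMn exprVn.
by field; rewrite ?expf_neq0 ?lt0r_neq0.
Qed.

Lemma fact_powR_growth (R : realType) (k M : nat) (B x : R) : 0 < B ->
  exists K D, [/\ 0 < K, 0 < D & forall N, (0 < N)%N ->
    B ^+ (k + N * M) * (k + N * M)`!%:R `^ x <= K * D ^+ N * growth N (M%:R * x)].
Proof.
move=> B0; have [D D0 hD] := fact_growth k M x.
exists (B ^+ k), (B ^+ M * D); split; rewrite ?exprn_gt0 ?mulr_gt0 ?exprn_gt0 //.
move=> N N0; rewrite exprD [(N * M)%N]mulnC exprM exprMn -!mulrA.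
rewrite !ler_pM2l ?exprn_gt0 // mulnC; exact: hD.
Qed.

Lemma prod_growth (R : realType) (n : nat) (P : pred 'I_n) (k M : 'I_n -> nat) (B : 'I_n -> R) (x : R) :
  (forall j, P j -> 0 < B j) ->
  exists K D, [/\ 0 < K, 0 < D & forall N, (0 < N)%N ->
    \prod_(j | P j) (B j ^+ (k j + N * M j) * (k j + N * M j)`!%:R `^ x) <=
      K * D ^+ N * growth N ((\sum_(j | P j) M j)%:R * x)].
Proof.
move=> B0.
have /choice[KD hKD] j : exists KD : R * R, [/\ 0 < KD.1, 0 < KD.2 & P j -> forall N, (0 < N)%N ->
    B j ^+ (k j + N * M j) * (k j + N * M j)`!%:R `^ x <= KD.1 * KD.2 ^+ N * growth N ((M j)%:R * x)].
  case: (boolP (P j)) => [Pj|_]; last by exists (1, 1).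
  by have [K [D [K0 D0 h]]] := fact_powR_growth (k j) (M j) x (B0 j Pj); exists (K, D).
exists (\prod_(j | P j) (KD j).1), (\prod_(j | P j) (KD j).2); split.
- by apply: prodr_gt0 => j _; case: (hKD j).
- by apply: prodr_gt0 => j _; case: (hKD j).
move=> N N0; rewrite natr_sum mulr_suml growth_sum // -prodrXl -!big_split /=.
apply: ler_prod => j Pj; have [_ _ /(_ Pj N N0) ->] := hKD j.
by rewrite andbT mulr_ge0 ?powR_ge0 // exprn_ge0 // ltW // B0.
Qed.

Section CoefLower.
Variables (R : realType) (d n : nat) (A : 'M[int]_(d, n)).
Local Notation C := (Cx R).
Variables (sg : {set 'I_n}) (hsg : #|sg| = d).
Hypothesis hdet : \det (Asub A hsg) != 0.
Variables (b : 'cV[C]_d) (k : 'cV[nat]_n).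
Hypothesis kN : Nbar sg k.
Hypothesis Gb : forall j, Gset j b.
Variable i0 : 'I_n.
Hypothesis i0s : i0 \notin sg.

(** With empty negative supports S_k is all of Lambda_k, which is what lets the ray stay in it. *)
Lemma nsupp0 l : Nbar sg l -> nsupp (vk A hsg b l) = set0.
Proof.
move=> lN; apply/seteqP; split=> // i [z z0 ez]; case: (boolP (i \in sg)) => is_.
  exact: (@generic_nonint _ _ _ _ _ _ _ hdet Gb l i z is_ ez).
have := esym (@vkE R d n A sg hsg b l i lN); rewrite /exponent (negPf is_) => e.
have := etrans e ez; rewrite -toC_nat -toC_int => /toC_inj/eqP.
by rewrite [_%:R]pmulrn eqr_int => /eqP h; move: z0; rewrite -h.
Qed.

Definition ray (M N : nat) : 'cV[nat]_n := \col_j (k j 0%R + N * (M * (j == i0)))%N.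

Lemma ray_N M N : Nbar sg (ray M N).
Proof.
move=> i is_; rewrite mxE kN // (_ : i == i0 = false) ?muln0 //.
by apply: contraNF i0s => /eqP <-.
Qed.

(** M = |det A_sg| makes M A_sg^-1 a_i0 integral, so u(m) = -N t for a fixed integral t with
    coordinate sum M (slope - 1). By [gam_lower] each coordinate grows at least like N^(N t_i), and
    the exponents add up. *)
Lemma coef_lower : exists M D, [/\ (0 < M)%N, 0 < D & forall N, (0 < N)%N ->
  D ^+ N * growth N (M%:R * (slope R A hsg i0 - 1)) <= cmod (supp_coef A hsg b k (ray M N))].
Proof.
pose M := absz (\det (Asub A hsg)).
(* Cramer's rule: zz = M A_sg^-1 a_i0, the sign turning det into |det|. *)
pose zz : 'cV[int]_d := sgz (\det (Asub A hsg)) *: (\adj (Asub A hsg) *m col i0 A).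
have hzz : Asub A hsg *m zz = M%:Z *: col i0 A.
  by rewrite -scalemxAr mulmxA mul_mx_adj mul_scalar_mx scalerA /M abszEsg.
have dE N : toZ (ray M N) - toZ k = (N * M)%N%:Z *: delta_mx i0 0.
  apply/matrixP => i j; rewrite ord1 !mxE eqxx andbT PoszD addrAC subrr add0r.
  by case: (i == i0); rewrite ?muln1 ?muln0 ?mulr1 ?mulr0.
have hA N : A *m (toZ (ray M N) - toZ k) = Asub A hsg *m (N%:Z *: zz).
  by rewrite dE -[RHS]scalemxAr -[LHS]scalemxAr hzz scalerA -colE PoszM.
pose t : 'cV[int]_n := embZ hsg zz - M%:Z *: delta_mx i0 0.
have hz N (F : numFieldType) := @um_embZ d n A sg hsg hdet k (ray M N) (N%:Z *: zz) F (hA N).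
have tE N i : (toZ (ray M N) - toZ k - embZ hsg (N%:Z *: zz)) i 0 = - (N%:Z * t i 0).
  rewrite dE /t [LHS]mxE [in RHS]mxE [(- embZ _ _) i 0]mxE.
  have -> : embZ hsg (N%:Z *: zz) i 0 = N%:Z * embZ hsg zz i 0.
    by rewrite !mxE mulr_sumr; apply: eq_bigr => j _; rewrite mxE.
  by rewrite !mxE PoszM; ring.
have SkN N : Sk A hsg b k (ray M N).
  split; last by rewrite !nsupp0 //; exact: ray_N.
  by split; [exact: ray_N|exists (N%:Z *: zz)].
have sumt : \sum_i (t i 0)%:~R = M%:R * (slope R A hsg i0 - 1) :> R.
  have -> : \sum_i (t i 0)%:~R = \sum_(i in sg) (embZ hsg zz i 0)%:~R - M%:R :> R.
    rewrite /t; under eq_bigr do rewrite mxE intrD.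
    rewrite big_split /=; congr (_ + _).
      rewrite [LHS](bigID (mem sg)) /= [X in _ + X]big1 ?addr0 // => i is_.
      by rewrite embZ_N.
    rewrite (bigD1 i0) //= big1 ?addr0 => [|i /negPf ii].
      by rewrite !mxE !eqxx mulr1 intrN -pmulrn.
    by rewrite !mxE ii mulr0 oppr0.
  rewrite [RHS]mulrBr mulr1 (sum_sg hsg) /slope /vsum mulr_sumr; congr (_ - _); apply: eq_bigr => j _.
  rewrite embZ_sgi.
  have -> : (zz j 0)%:~R = (Ainv A hsg R *m (map_mx intr (Asub A hsg) *m map_mx intr zz)) j 0.
    rewrite (AinvK hdet) [RHS]mxE; reflexivity.
  by rewrite -map_mxM hzz map_mxZ -scalemxAr [LHS]mxE.
have /choice[D hD] i : exists D : R, 0 < D /\ forall N, (0 < N)%N ->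
   D ^+ N * growth N (t i 0)%:~R <= cmod (gam (vk A hsg b k i 0) (- (N%:Z * t i 0))).
  have [] := @gam_lower R (vk A hsg b k i 0) (t i 0); last by move=> D D0 h; exists D.
    case: (boolP (i \in sg)) => is_.
      move=> _ m; apply/eqP => h.
      by apply: (@generic_nonint _ _ _ _ _ _ _ hdet Gb k i m%:Z is_); rewrite h.
    (* Off sg, t_i is 0 or -M, so the case t > 0 of [gam_lower], which excludes natural numbers v,
       does not arise. *)
    rewrite ltNge (_ : t i 0 <= 0) // /t mxE embZ_N // add0r !mxE oppr_le0.
    by rewrite mulr_ge0 // ler0n.
  move=> m; apply/eqP => /eqP; rewrite addr_eq0 => /eqP h.
  have : nsupp (vk A hsg b k) i by exists (- m.+1%:Z) => //; rewrite h intrN -pmulrn.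
  by rewrite nsupp0.
exists M, (\prod_i D i); split.
- by rewrite absz_gt0.
- by apply: prodr_gt0 => i _; case: (hD i).
move=> N N0; rewrite (supp_coef_T (SkN N)) (coefE b (hz N)) -sumt growth_sum // -prodrXl -big_split /=.
rewrite cmod_prod; apply: ler_prod => i _; have [D0 /(_ N N0)] := hD i; rewrite -tE => h.
by rewrite mulr_ge0 ?exprn_ge0 ?(ltW D0) ?(ltW (growth_gt0 _ N0)).
Qed.

End CoefLower.

(** * Upper bound from a smaller Gevrey order *)

Section Index.
Variables (R : realType) (d n : nat) (A : 'M[int]_(d, n)).
Local Notation C := (Cx R).
Variables (sg : {set 'I_n}) (hsg : #|sg| = d).
Hypothesis hdet : \det (Asub A hsg) != 0.
Variable r : R.
Hypothesis hr : convergence_bound A hsg r.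
Variable s : R.
Hypothesis hs : forall i, i \notin sg -> slope R A hsg i <= s.
Variables (b : 'cV[C]_d) (k : 'cV[nat]_n).
Hypothesis kN : Nbar sg k.
Variable vs : {set 'I_n}.
Hypothesis sub : sg \subset vs.
Hypothesis hvs : [set` vs] `<=` tau R A hsg.
Variable p : 'cV[C]_n.
Hypothesis hp : (Yplane vs `&` Usg A hsg r) p.
Variable lg : 'I_n -> C -> C.
Hypothesis hlg : forall i, i \in sg -> log_branch (p i 0) (lg i).

Local Notation q := (@Ainv_entry R d n A sg hsg).
Local Notation g := (@base_exponent R d n A sg hsg b).
Local Notation c := (@supp_coef R d n A sg hsg b k).
Local Notation f := (phi A hsg vs lg b k).
Local Notation Rr := (radius A hsg r vs p lg).
Local Notation ym := (ymod A hsg lg p).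

(** p_sg^(-A_sg^-1 a_j) by the chosen branches: at x_sg = p_sg it converts x_j into y_j. *)
Definition branch_factor (j : 'I_n) : C := \prod_(i in sg) cexp (- (toC (q i j) * lg i (p i 0))).

Definition base_factor : C := \prod_(i in sg) cexp (g i * lg i (p i 0)).

(* With x_sg frozen at p_sg, a slice of phi is a power series in the x_j with
   j in vs \ sg; these are its coefficients. *)
Definition coef_at (l : 'cV[nat]_n) : C :=
  c l * (base_factor * \prod_(j | j \notin sg) branch_factor j ^+ l j 0%R).

Definition free_idx : seq 'I_n := [seq j <- index_enum 'I_n | (j \notin sg) && (j \in vs)].

Lemma branch_factor_gt0 j : 0 < cmod (branch_factor j).
Proof. by rewrite cmod_prod; apply: prodr_gt0 => i _; rewrite cmod_cexp expR_gt0. Qed.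

Lemma base_factor_gt0 : 0 < cmod base_factor.
Proof. by rewrite cmod_prod; apply: prodr_gt0 => i _; rewrite cmod_cexp expR_gt0. Qed.

Lemma ymod_kap j : ym j = cmod (p j 0) * cmod (branch_factor j).
Proof.
rewrite /ymod cmod_prod -sumrN expR_sum; congr (_ * _); apply: eq_bigr => i _.
by rewrite cmod_cexp reN reMl.
Qed.

Lemma factors_at l (x : 'cV[C]_n) : (forall i, i \in sg -> x i 0 = p i 0) ->
  c l * \prod_i term_factor sg vs lg q g l i (x i 0) =
    coef_at l * \prod_(j <- free_idx) x j 0 ^+ l j 0%R.
Proof.
move=> xp; rewrite /coef_at -mulrA; congr (_ * _).
rewrite [LHS](bigID (mem sg)) /=; congr (_ * _).
  transitivity (\prod_(i in sg) (cexp (g i * lg i (p i 0)) *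
    \prod_(j | j \notin sg) cexp (- (toC (q i j) * lg i (p i 0))) ^+ l j 0%R)).
    apply: eq_bigr => i is_; rewrite /term_factor is_ /exponent is_ xp // mulrBl cexpD; congr (_ * _).
    rewrite mulr_suml -sumrN cexp_sum; apply: eq_bigr => j _.
    by rewrite -cexp_natr; congr cexp; ring.
  rewrite big_split /= exchange_big /=; congr (_ * _); apply: eq_bigr => j _.
  by rewrite prodrXl.
rewrite /free_idx big_filter [LHS](bigID (mem vs)) /= [X in _ * X]big1 ?mulr1; last first.
  by move=> j /andP[/negPf js /negPf jv]; rewrite /term_factor js jv.
by apply: eq_bigr => j /andP[/negPf js jv]; rewrite /term_factor js jv.
Qed.

Definition mid_radius (j : 'I_n) : R := (ym j + Rr j) / 2.

(** The radius in x_j that corresponds to [mid_radius] in y_j. *)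
Definition scaled_radius (j : 'I_n) : R := mid_radius j / cmod (branch_factor j).

Lemma mid_polyradius : is_polyradius sg Rr mid_radius.
Proof.
move=> j js; have := ymod_Rr hr hp hlg js; have := Rr0 hr vs p lg js.
by have := ymod_ge0 A hsg lg p j; rewrite /mid_radius => *; apply/andP; split; lra.
Qed.

Lemma free_idx_in j : j \in free_idx -> j \notin sg /\ j \in vs.
Proof. by rewrite mem_filter => /andP[/andP[]]. Qed.

Lemma p_rhoK j : j \notin sg -> cmod (p j 0) < scaled_radius j.
Proof.
move=> js; rewrite /scaled_radius ltr_pdivlMr ?branch_factor_gt0 // -ymod_kap /mid_radius.
have := ymod_Rr hr hp hlg js; lra.
Qed.

Lemma scaled_radius_gt0 j : j \notin sg -> 0 < scaled_radius j.
Proof. by move=> js; apply: le_lt_trans (p_rhoK js); exact: cmod_ge0. Qed.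

(** What the bound of order s leaves on the slice [a]; along the ray it is at most a constant times
    D^N N^(N M (s-1)). *)
Definition big_const (a : 'cV[nat]_n) : R :=
  cmod base_factor * \prod_(j | j \notin vs)
    ((cmod (branch_factor j) / mid_radius j) ^+ a j 0%R * (a j 0%R)`!%:R `^ (s - 1)).

Lemma coef_at_rhoK a l : agree_off vs a l ->
  cmod (coef_at l) * \prod_(j <- free_idx) scaled_radius j ^+ l j 0%R =
  cmod (c l * toC (weight sg mid_radius l * gw s vs l)) * big_const a.
Proof.
move=> al; have r0 j : j \notin sg -> 0 < mid_radius j by move=> /mid_polyradius/andP[].
rewrite /coef_at /big_const !cmodM -!mulrA; congr (_ * _).
rewrite [RHS]mulrCA; congr (_ * _).
rewrite cmod_toC ger0_norm; last first.
  by rewrite mulr_ge0 ?(ltW (gw_gt0 _ _ _)) // ltW // (wt_gt0 l mid_polyradius).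
rewrite cmod_prod /weight /free_idx big_filter.
rewrite [X in X * _ = _](bigID (mem vs)) /= [X in _ = X * _ * _](bigID (mem vs)) /=.
have V (F : 'I_n -> R) : \prod_(j | (j \notin sg) && (j \notin vs)) F j = \prod_(j | j \notin vs) F j.
  by apply: eq_bigl => j; case: (boolP (j \in vs)) => jv; rewrite ?andbF // andbT (notin_sub sub).
rewrite !V mulrAC -big_split /= -!mulrA; congr (_ * _).
  apply: eq_bigr => j /andP[js _]; rewrite cmodX -exprMn /scaled_radius mulrCA divff ?mulr1 //.
  by rewrite lt0r_neq0 // branch_factor_gt0.
rewrite /gw -!big_split /=; apply: eq_bigr => j jv.
rewrite (idxE al jv) cmodX [(_ / mid_radius j) ^+ _]expr_div_n.
have j0 := r0 j (notin_sub sub jv).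
have F0 : 0 < (a j 0%R)`!%:R :> R by rewrite ltr0n fact_gt0.
rewrite -[s - 1]opprB powRN.
have p0 : (a j 0%R)`!%:R `^ (1 - s) != 0 :> R by rewrite lt0r_neq0 // powR_gt0.
by field; rewrite p0 expf_neq0 // lt0r_neq0.
Qed.


Definition majorant (a l : 'cV[nat]_n) : R :=
  if agree_off vs a l then cmod (coef_at l) * \prod_(j <- free_idx) scaled_radius j ^+ l j 0%R else 0.

Lemma prod_rhoK_ge0 (l : 'cV[nat]_n) : 0 <= \prod_(j <- free_idx) scaled_radius j ^+ l j 0%R.
Proof.
rewrite big_seq; apply: prodr_ge0 => j /free_idx_in[js _].
by rewrite exprn_ge0 // ltW // scaled_radius_gt0.
Qed.

Lemma majorant_ge0 a l : 0 <= majorant a l.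
Proof. by rewrite /majorant; case: ifP => // _; rewrite mulr_ge0 ?cmod_ge0 ?prod_rhoK_ge0. Qed.

Lemma big_const_ge0 a : 0 <= big_const a.
Proof.
rewrite mulr_ge0 ?cmod_ge0 //; apply: prodr_ge0 => j jv; rewrite mulr_ge0 ?powR_ge0 //.
rewrite exprn_ge0 // divr_ge0 ?cmod_ge0 // ltW //.
by have /andP[] := mid_polyradius (notin_sub sub jv).
Qed.

Lemma majorant_bound : exists2 K, 0 < K & forall a (B : {fset 'cV[nat]_n}),
  \sum_(l <- B) majorant a l <= K * big_const a.
Proof.
have [K hK] := total_bound hr hs b kN sub hvs mid_polyradius.
have K0 : 0 <= K by have := hK fset0; rewrite big_seq_fset0.
exists (K + 1); first by rewrite ltr_wpDl.
move=> a B; apply: (@le_trans _ _ (K * big_const a)); last first.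
  by rewrite ler_wpM2r ?big_const_ge0 // lerDl.
have := ler_wpM2r (big_const_ge0 a) (hK B); apply: le_trans.
rewrite mulr_suml; apply: ler_sum => l _; rewrite /majorant; case: ifP => [al|_].
  by rewrite (coef_at_rhoK al).
by rewrite mulr_ge0 ?cmod_ge0 ?big_const_ge0.
Qed.

Lemma phi_at a (x : 'cV[C]_n) : (forall i, i \in sg -> x i 0 = p i 0) ->
  f a x = tsum (slice vs a (fun l => coef_at l * \prod_(j <- free_idx) x j 0 ^+ l j 0%R)).
Proof.
move=> xp; rewrite phiE /slice_series; congr tsum; apply/funext => l; rewrite /slice; case: ifP => // _.
exact: factors_at.
Qed.

(** [two_constants_multi] on a truncated slice: among the indices where [coef_at] is nonzero, [l] is
    the only one in the slice [a] that agrees with [k] on the free variables. [K] and [th] are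
    chosen before [l] and [a], hence uniform along the ray. The doubled [b0] pays for the
    truncation. *)
Lemma coef_at_upper (e : R) : 0 < e -> (forall j, j \notin sg -> cmod (p j 0) + e <= scaled_radius j) ->
  exists K th : R, [/\ 0 < K, 0 < th & forall (l a : 'cV[nat]_n) (b0 B0 : R),
    Nbar sg l -> (forall j, j \in vs -> l j 0 = k j 0) ->
    (forall j, j \notin vs -> a j 0 = l j 0) ->
    0 < b0 -> 0 < B0 ->
    (forall B : {fset 'cV[nat]_n}, \sum_(l <- B) majorant a l <= B0) ->
    (forall y : 'I_n -> C, (forall j, j \in free_idx -> cmod (y j - p j 0) <= e) ->
      exists2 x : 'cV[C]_n, cmod (f a x) <= b0 & (forall i, i \in sg -> x i 0 = p i 0) /\
        (forall j, j \in free_idx -> x j 0 = y j)) ->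
    cmod (coef_at l) <= K * ((b0 *+ 2) `^ th * B0 `^ (1 - th))].
Proof.
move=> e0 he.
have [K [th [K0 th0 th1 H]]] := @two_constants_multi R n free_idx scaled_radius (fun j => p j 0) e k
  (filter_uniq _ (index_enum_uniq _)) e0 (fun j jJ => he j (free_idx_in jJ).1).
exists K, th; split=> // l a b0 B0 lN lk al b00 B00 hB hy.
have [Af hA] := @tsum_trunc R _ _ _ _ (majorant_ge0 a) hB b00.
pose B := (l |` Af)%fset.
have lB : l \in B by rewrite !inE eqxx.
have b20 : 0 < b0 *+ 2 by rewrite pmulrn_lgt0.
have := H (enum_fset B) (slice vs a coef_at) B0 (b0 *+ 2) B00 b20.
have -> : \sum_(l <- enum_fset B | all (fun j => l j 0%R == k j 0%R) free_idx)
      slice vs a coef_at l = coef_at l.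
  rewrite big_mkcond /= (bigD1_seq l lB (fset_uniq B)) /= big1 ?addr0; last first.
    move=> m ml; rewrite /slice; case: allP => // mk; case: ifP => // am.
    apply/eqP; apply: contraNT ml => cm.
    have mN : Nbar sg m.
      by apply: contrapT => nN; move/eqP: cm; apply; rewrite /coef_at supp_coef_N ?mul0r.
    apply/eqP/matrixP => j z; rewrite ord1 {z}.
    have [js|js] := boolP (j \in sg); first by rewrite mN // lN.
    have [jv|jv] := boolP (j \in vs); last by rewrite (idxE am jv) al.
    rewrite lk //; apply/eqP; apply: mk; rewrite mem_filter js jv /=.
    exact: mem_index_enum.
  have -> : all (fun j => l j 0%R == k j 0%R) free_idx.
    by apply/allP => j /free_idx_in[_ jv]; rewrite lk.
  rewrite /slice ifT //; apply/forallP => j; apply/implyP => jv; by rewrite al.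
apply.
  apply: le_trans (hB B); apply: ler_sum => m _; rewrite /majorant /slice; case: ifP => // _.
  by rewrite cmod0 mul0r.
move=> y ye; have [x fx [xp xy]] := hy y ye.
have := hA (slice vs a (fun l => coef_at l * \prod_(j <- free_idx) x j 0 ^+ l j 0%R)) _ B (fsubsetUr _ _).
rewrite -phi_at // => h.
have -> : \sum_(l <- enum_fset B) slice vs a coef_at l * \prod_(j <- free_idx) y j ^+ l j 0%R =
   \sum_(l <- B) slice vs a (fun l => coef_at l * \prod_(j <- free_idx) x j 0 ^+ l j 0%R) l.
  apply: eq_bigr => m _; rewrite /slice; case: ifP => _; last by rewrite mul0r.
  congr (_ * _); rewrite big_seq [RHS]big_seq; apply: eq_bigr => j jJ.
  by rewrite xy.
apply: le_trans (h _) _; last by rewrite mulr2n lerD2r.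
move=> m; rewrite /majorant /slice; case: ifP => _; last by rewrite cmod0.
rewrite cmodM ler_wpM2l ?cmod_ge0 // cmod_prod big_seq [leRHS]big_seq.
apply: ler_prod => j jJ; rewrite cmod_ge0 cmodX /=.
have [js _] := free_idx_in jJ; have := he j js; have := ye j jJ.
rewrite -xy // => h1 h2; apply: lerXn2r; rewrite ?nnegrE ?cmod_ge0 ?(ltW (scaled_radius_gt0 js)) //.
have := cmodD (x j 0 - p j 0) (p j 0); rewrite subrK; lra.
Qed.

End Index.

(** * Sharpness of the Gevrey order *)

Lemma gw_gevrey (R : realType) (n : nat) (vs : {set 'I_n}) (s : R) (a : 'cV[nat]_n) :
  Nbar vs a -> (mfact a)%:R `^ (1 - s) = gw s vs a.
Proof.
move=> aN; rewrite /mfact natr_prod -powR_prod; last by move=> *.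
rewrite (bigID (mem vs)) /= [X in X * _]big1 ?mul1r // => j jv.
by rewrite aN // fact0 powR1.
Qed.

(** Order s' makes the slices small near p, order s bounds them on the large polydisc with exponent
    M (s-1), and [coef_lower] gives that exponent from below: [growth_contra]. As i0 lies outside
    vs, l_N agrees with k on vs, as [coef_at_upper] demands. *)
Lemma not_gevrey_phi (R : realType) (d n : nat) (A : 'M[int]_(d, n))
    (sg : {set 'I_n}) (hsg : #|sg| = d) (r s : R) (b : 'cV[Cx R]_d) (k : 'cV[nat]_n)
    (vs : {set 'I_n}) (p : 'cV[Cx R]_n) (lg : 'I_n -> Cx R -> Cx R) (i0 : 'I_n) (s' : R) :
  \det (Asub A hsg) != 0 -> convergence_bound A hsg r ->
  (forall i, i \notin sg -> slope R A hsg i <= s) -> Nbar sg k ->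
  sg \subset vs -> [set` vs] `<=` tau R A hsg -> (Yplane vs `&` Usg A hsg r) p ->
  (forall i, i \in sg -> log_branch (p i 0) (lg i)) ->
  (forall j, Gset j b) -> i0 \notin vs -> slope R A hsg i0 = s -> s' < s ->
  ~ gevrey_order vs p s' (phi A hsg vs lg b k).
Proof.
move=> hdet hr hs kN sub hvs hp hlg Gb i0v i0s ss [_ [Mb Msum hM]].
have i0sg := notin_sub sub i0v.
have [M [D3 [M0 D30 hlow]]] := coef_lower hdet kN Gb i0sg.
pose mN (j : 'I_n) := (M * (j == i0))%N.
have sumM : (\sum_(j | j \notin vs) mN j = M)%N.
  rewrite (bigD1 i0) //= big1 ?addn0 /mN ?eqxx ?muln1 // => j /andP[_ /negPf ->].
  by rewrite muln0.
pose l_ N := ray k i0 M N.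
pose a_ N : 'cV[nat]_n := \col_j (if j \in vs then 0%N else l_ N j 0%R).
have aN N : Nbar vs (a_ N) by move=> j jv; rewrite mxE jv.
have aE N j : j \notin vs -> a_ N j 0 = (k j 0%R + N * mN j)%N.
  by move=> /negPf jv; rewrite mxE jv mxE.
have [e e0 he] := (nearVP _ _).1 hM.
have [K1 K10 hK1] := summable_bound Msum.
pose rK := scaled_radius A hsg r vs p lg.
pose rh := mid_radius A hsg r vs p lg.
pose kp := branch_factor A hsg p lg.
(* A polydisc that fits both the neighbourhood of p given by order s' and the radii
   [scaled_radius]. *)
pose e2 := \big[Num.min/e / 2]_(j | j \notin sg) (rK j - cmod (p j 0)).
have e20 : 0 < e2.
  rewrite /e2; elim/big_ind: _ => [|x y x0 y0|j js]; first by rewrite divr_gt0.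
    by rewrite lt_min x0 y0.
  by rewrite subr_gt0; exact: (p_rhoK hr hp hlg js).
have e2e : e2 <= e / 2 by exact: bigmin_le_id.
have e2r j : j \notin sg -> cmod (p j 0) + e2 <= rK j.
  move=> js; rewrite addrC -lerBrDr.
  exact: (@bigmin_le_cond _ _ _ _ j _ (fun j => rK j - cmod (p j 0)) js).
have [K0 [th [K00 th0 hup]]] := coef_at_upper hr b k hp hlg e20 e2r.
have [Kb Kb0 hKb] := majorant_bound hr hs b kN sub hvs hp hlg.
have kp0 j : 0 < cmod (kp j) by exact: branch_factor_gt0.
(* [h2] estimates [big_const], and [h4] the inverse of weight times formal monomial, both at a_N. *)
have [K2 [D2 [K20 D20 h2]]] := @prod_growth R n (fun j => j \notin vs) (fun j => k j 0%R) mN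
  (fun j => cmod (kp j) / rh j) (s - 1) (fun j jv => divr_gt0 (kp0 j)
    (proj1 (andP (mid_polyradius hr hp hlg (notin_sub sub jv))))).
have ei0 : 0 < (e / 2)^-1 by rewrite invr_gt0 divr_gt0.
have [K4 [D4 [K40 D40 h4]]] := @prod_growth R n (fun j => j \notin vs) (fun j => k j 0%R) mN
  (fun=> (e / 2)^-1) (s' - 1) (fun _ _ => ei0).
pose x := M%:R * (s - 1); pose y := M%:R * (s' - 1).
have yx : y < x by rewrite ltr_pM2l ?ltr0n // ltrD2r.
pose E := cmod (base_factor A hsg b p lg); have base_factor' : 0 < E by exact: base_factor_gt0.
pose K3 := E * \prod_(j | j \notin sg) cmod (kp j) ^+ k j 0%R.
pose D5 := \prod_(j | j \notin sg) cmod (kp j) ^+ mN j.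
have K30 : 0 < K3 by rewrite mulr_gt0 // prodr_gt0 // => j _; rewrite exprn_gt0.
have D50 : 0 < D5 by rewrite prodr_gt0 // => j _; rewrite exprn_gt0.
apply: (@growth_contra R x y th K0 (K1 * K4 *+ 2) D4 (Kb * (E * K2)) D2 K3 (D3 * D5)) => //.
- by rewrite pmulrn_lgt0 // mulr_gt0.
- by rewrite !mulr_gt0.
- by rewrite mulr_gt0.
move=> N N0; have Wx := growth_gt0 x N0; have Wy := growth_gt0 y N0.
pose bN := K1 * (K4 * D4 ^+ N * growth N y).
pose BN := Kb * (E * (K2 * D2 ^+ N * growth N x)).
have -> : K1 * K4 *+ 2 * D4 ^+ N * growth N y = bN *+ 2 by rewrite /bN !mulr2n; ring.
have -> : Kb * (E * K2) * D2 ^+ N * growth N x = BN by rewrite /BN; ring.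
have bN0 : 0 < bN by rewrite !mulr_gt0 ?exprn_gt0.
have BN0 : 0 < BN by rewrite !mulr_gt0 ?exprn_gt0.
apply: le_trans (hup (l_ N) (a_ N) bN BN _ _ _ bN0 BN0 _ _).
- rewrite /coef_at cmodM cmodM cmod_prod.
  have -> : \prod_(j | j \notin sg) cmod (branch_factor A hsg p lg j ^+ l_ N j 0%R) =
     (\prod_(j | j \notin sg) cmod (kp j) ^+ k j 0%R) * D5 ^+ N.
    rewrite /D5 -prodrXl -big_split /=; apply: eq_bigr => j _.
    by rewrite cmodX mxE exprD mulnC exprM.
  have := hlow N N0; rewrite i0s => h.
  have := ler_wpM2r (ltW (mulr_gt0 K30 (exprn_gt0 N D50))) h.
  rewrite /K3 exprMn -/E /x => h'; apply: le_trans (le_trans _ h') _.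
    by rewrite le_eqVlt; apply/orP; left; apply/eqP; ring.
  by rewrite le_eqVlt; apply/orP; left; apply/eqP; rewrite /l_; ring.
- exact: ray_N.
- move=> j jv; rewrite mxE (_ : j == i0 = false) ?muln0 ?addn0 //.
  by apply: contraNF i0v => /eqP <-.
- by move=> j /negPf jv; rewrite mxE jv.
- move=> B; apply: le_trans (hKb (a_ N) B) _; rewrite ler_pM2l // ler_pM2l //.
  have := h2 N N0; rewrite sumM; apply: le_trans; rewrite le_eqVlt; apply/orP; left.
  by apply/eqP; apply: eq_bigr => j jv; rewrite aE.
move=> z hz.
(* The formal coordinates, 0 at p, are set to e/2: the slice does not depend on them, and |w^a| =
   (e/2)^|a| can be divided out at exponential cost. *)
exists (\col_j (if j \in sg then p j 0 else if j \in vs then z j else toC (e / 2))); last first.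
  split=> [j js|j /free_idx_in[/negPf js jv]]; first by rewrite mxE js.
  by rewrite mxE js jv.
set w : 'cV[Cx R]_n := \col_j _.
have wp j : cmod (w j 0 - p j 0) < e.
  have eh : e / 2 < e by rewrite ltr_pdivrMr // ltr_pMr // ltr1n.
  rewrite mxE; case: ifP => [_|/negbT js]; first by rewrite subrr cmod0.
  case: ifP => [jv|/negbT jv].
    apply: le_lt_trans (hz j _) (le_lt_trans e2e eh).
    by rewrite mem_filter js jv mem_index_enum.
  by rewrite (hp.1 j jv) subr0 cmod_toC ger0_norm // divr_ge0 // ltW.
have := le_trans (he w wp (a_ N) (aN N)) (hK1 (a_ N) (aN N)).
rewrite (gw_gevrey _ (aN N)) cmodM cmodM cmod_toC (ger0_norm (ltW (gw_gt0 _ _ _))).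
have -> : cmod (monomial w (a_ N)) = \prod_(j | j \notin vs) (e / 2) ^+ a_ N j 0%R.
  rewrite cmod_prod (bigID (mem vs)) /= [X in X * _]big1 ?mul1r; last first.
    by move=> j jv; rewrite aN // expr0 cmod1.
  apply: eq_bigr => j jv; rewrite cmodX mxE (negPf jv) (negPf (notin_sub sub jv)).
  by rewrite cmod_toC ger0_norm // divr_ge0 // ltW.
have := h4 N N0; rewrite sumM -/y.
have -> : \prod_(j | j \notin vs) ((e / 2)^-1 ^+ (k j 0%R + N * mN j) *
     (k j 0%R + N * mN j)`!%:R `^ (s' - 1)) =
   (gw s' vs (a_ N) * \prod_(j | j \notin vs) (e / 2) ^+ a_ N j 0%R)^-1.
  rewrite /gw -big_split /= -prodfV; apply: eq_bigr => j jv; rewrite aE //.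
  by rewrite -[s' - 1]opprB powRN exprVn -invfM mulrC.
set Q := _ * \prod_(_ | _) _; have Q0 : 0 < Q.
  by rewrite mulr_gt0 ?gw_gt0 // prodr_gt0 // => j _; rewrite exprn_gt0 // divr_gt0.
move=> h1; rewrite -mulrA -/Q -ler_pdivlMr // => h; apply: le_trans h _.
by rewrite /bN ler_pM2l.
Qed.

(** A single family [Gset] serves every simplex, every k and every point. The index is claimed when
    s is the slope of some i outside vs: the Gevrey order sees only the factorials of the formal
    variables. *)
Theorem theorem3p14 (R : realType) (d n : nat) (A : 'M[int]_(d, n)) :
  \rank (map_mx (intr : int -> rat) A) = d ->
  exists G : nat -> set 'cV[Cx R]_d,
    (forall j, zariski_open (G j) /\ G j !=set0) /\
    forall (sg : {set 'I_n}) (hsg : #|sg| = d), \det (Asub A hsg) != 0 ->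
    forall r : R, convergence_bound A hsg r ->
    forall s : R, is_max [set slope R A hsg i | i in [set i | i \notin sg]] s ->
    forall (b : 'cV[Cx R]_d) (k : 'cV[nat]_n), Nbar sg k ->
    min_neg_support A (vk A hsg b k) ->
    forall vs : {set 'I_n},
    sg \subset vs -> [set` vs] `<=` tau R A hsg ->
    forall p : 'cV[Cx R]_n, (Yplane vs `&` Usg A hsg r) p ->
    forall lg : 'I_n -> Cx R -> Cx R,
    (forall i, i \in sg -> log_branch (p i 0) (lg i)) ->
    [/\ phi_defined A hsg vs lg b k p,
        hyp_solution A b vs p (phi A hsg vs lg b k),
        gevrey_order vs p s (phi A hsg vs lg b k) &
        (forall j, G j b) ->
        (exists2 i, i \notin vs & slope R A hsg i = s) ->
        gevrey_index vs p s (phi A hsg vs lg b k)].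
Proof.
move=> _; exists (@Gset R d); split; first exact: LinearForms.Gset_open.
move=> sg hsg hdet r hr s [_ ms] b k kN hmin vs sub hvs p hp lg hlg.
have hs i : i \notin sg -> slope R A hsg i <= s by move=> is_; apply: ms; exists i.
have ho := gevrey_phi hr hs b kN sub hvs hp hlg.
split=> //.
- exact: (phi_is_defined hr hs b kN sub hvs hp hlg).
- exact: (phi_solution hdet hr hs kN sub hvs hp hlg hmin).
move=> Gb [i iv si]; split=> // s' ss.
exact: (not_gevrey_phi hdet hr hs kN sub hvs hp hlg Gb iv si ss).
Qed.
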